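(* Let $M$ be an analytic manifold modelled on an ultrametric Banach space over a complete ultrametric field $\mathbb{K}$. Let $M_0\subseteq M$ be open, $f\colon M_0\to M$ be an analytic mapping, $p\in M_0$ be a fixed point of $f$, and $a\in(0,1]$. Assume that $T_p(M)$ admits an $a$-centre-stable subspace $T_p(M)_{a,\mathrm{cs}}$ with respect to $T_p(f)$. Then the following holds: (a) There exists an $a$-centre-stable manifold $N$ around $p$ with respect to $f$. (b) The germ of $N$ at $p$ is uniquely determined (i.e., $N_1\sim_p N_2$ for any two $a$-centre-stable manifolds $N_1,N_2$ around $p$ with respect to $f$). (c) For $N$ an $a$-centre-stable manifold around $p$ with respect to $f$, every neighbourhood of $p$ in $N$ contains an open neighbourhood $\Omega$ of $p$ in $N$ which is an $a$-centre-stable manifold around $p$ with respect to $f$ and a submanifold of $M$.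
   Context: A complete ultrametric field is a field $\mathbb{K}$ with an absolute value $|.|$ satisfying $|x+y|\le\max\{|x|,|y|\}$, whose associated metric defines a non-discrete topology and is complete. An ultrametric Banach space over $\mathbb{K}$ is a complete normed $\mathbb{K}$-vector space whose norm satisfies $\|x+y\|\le\max\{\|x\|,\|y\|\}$. $B^E_r(x)=\{y\in E:\|y-x\|<r\}$. Analytic maps: for ultrametric Banach spaces $E,F$, a continuous homogeneous polynomial $p_k\colon E\to F$ of degree $k$ is a map $x\mapsto\beta(x,\ldots,x)$ with $\beta\colon E^k\to F$ continuous $k$-linear (constant for $k=0$), and $\|p_k\|$ is the infimum of $\|\beta\|$ over all such $\beta$. A map $f\colon U\to F$ on an open set $U\subseteq E$ is analytic if for each $x\in U$ there are such $p_k$, $k\in\mathbb{N}_0$, with $\rho:=\sup\{r\ge 0: \|p_k\|r^k\to 0\}>0$, and $r\in(0,\rho]$ with $B^E_r(x)\subseteq U$ and $f(x+y)=\sum_k p_k(y)$ for $y\in B^E_r(0)$. Analytic manifolds modelled on $E$, tangent spaces and tangent maps are defined as usual (Hausdorff space with a maximal atlas of charts onto open subsets of $E$ with analytic transition maps). A subset $N\subseteq M$ is a submanifold if there is a complemented vector subspace $F$ of the modelling space such that each point of $N$ lies in the domain $U$ of a chart $\phi\colon U\to V$ of $M$ with $\phi(N\cap U)=F\cap V$. An analytic manifold $N$ is an immersed submanifold of $M$ if $N\subseteq M$ as a set and the inclusion map $N\to M$ is an immersion (tangent maps injective with complemented image); tangent spaces of $N$ are identified with subspaces of those of $M$. Centre-stable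 subspaces: let $E$ be an ultrametric Banach space, $\alpha\colon E\to E$ continuous linear, $a>0$. An $\alpha$-invariant vector subspace $E_{a,\mathrm{cs}}\subseteq E$ is an $a$-centre-stable subspace with respect to $\alpha$ if there exist an $\alpha$-invariant vector subspace $E_{a,\mathrm{u}}$ with $E=E_{a,\mathrm{cs}}\oplus E_{a,\mathrm{u}}$ such that $\alpha_2:=\alpha|_{E_{a,\mathrm{u}}}\colon E_{a,\mathrm{u}}\to E_{a,\mathrm{u}}$ is invertible, and an ultrametric norm $\|.\|$ on $E$ defining its topology with (i) $\|x+y\|=\max\{\|x\|,\|y\|\}$ for $x\in E_{a,\mathrm{cs}}$, $y\in E_{a,\mathrm{u}}$; (ii) $\|\alpha_1\|\le a$ and $\frac{1}{\|\alpha_2^{-1}\|}>a$ for operator norms with respect to $\|.\|$, where $\alpha_1:=\alpha|_{E_{a,\mathrm{cs}}}$ (and $\frac10:=\infty$). Such $E_{a,\mathrm{cs}}$ is uniquely determined. Centre-stable manifolds: an immersed submanifold $N\subseteq M_0$ is an $a$-centre-stable manifold around $p$ with respect to $f$ if $p\in N$; $T_p(N)=T_p(M)_{a,\mathrm{cs}}$; $f(N)\subseteq N$; and $f|_N\colon N\to N$ is analytic. Germs: for immersed submanifolds $N_1,N_2\subseteq M$ containing $p$, $N_1\sim_p N_2$ means that there is an open neighbourhood $U$ of $p$ in $N_1$ which is also an open neighbourhood of $p$ in $N_2$ and on which $N_1$ and $N_2$ induce the same analytic manifold structure. The germ of $N$ at $p$ is its $\sim_p$-equivalence class. *)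

(* Defs.v *)
(* The normed modules of MathComp-Analysis have archimedean norms, so
   ultrametric norms are plain functions into a realType here, and the
   topologies they define are given by neighbourhood filters. *)
From HB Require Import structures.
From mathcomp Require Import all_boot all_order all_algebra.
From mathcomp Require Import all_classical all_reals all_analysis.

Set Implicit Arguments.
Unset Strict Implicit.
Unset Printing Implicit Defensive.

Import Order.TTheory GRing.Theory Num.Theory.
Import numFieldNormedType.Exports.
Local Open Scope classical_set_scope.
Local Open Scope ring_scope.

Section NormTopology.
Variables (R : realType) (V : zmodType) (n : V -> R).

Definition norm_ball (x : V) (r : R) : set V := [set y | n (y - x) < r].

Definition norm_nbhs (x : V) : set_system V :=
  filter_from [set r : R | 0 < r] (norm_ball x).

Definition norm_open (U : set V) : Prop := forall x, U x -> norm_nbhs x U.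

Definition norm_complete : Prop := forall u : nat -> V,
  (forall e : R, 0 < e -> exists N : nat,
      forall i j, (N <= i)%N -> (N <= j)%N -> n (u i - u j) < e) ->
  exists l : V, u @ \oo --> norm_nbhs l.

End NormTopology.

Definition ultrametric_abs (R : realType) (K : fieldType) (abs : K -> R) : Prop :=
  [/\ forall x, 0 <= abs x,
      forall x, abs x = 0 <-> x = 0,
      forall x y, abs (x * y) = abs x * abs y
    & forall x y, abs (x + y) <= Num.max (abs x) (abs y)].

Record ultraField (R : realType) := UltraField {
  uf_sort :> fieldType;
  uf_abs : uf_sort -> R;
  uf_absP : ultrametric_abs uf_abs;
  uf_nondiscrete : ~ norm_open uf_abs [set 0];
  uf_complete : norm_complete uf_abs }.

Definition ultrametric_norm (R : realType) (K : ultraField R) (V : lmodType K)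
    (n : V -> R) : Prop :=
  [/\ forall x, 0 <= n x,
      forall x, n x = 0 <-> x = 0,
      forall c x, n (c *: x) = uf_abs c * n x
    & forall x y, n (x + y) <= Num.max (n x) (n y)].

Record ultraBanach (R : realType) (K : ultraField R) := UltraBanach {
  ub_sort :> lmodType K;
  ub_norm : ub_sort -> R;
  ub_normP : ultrametric_norm ub_norm;
  ub_complete : norm_complete ub_norm }.

Section LinearTopology.
Variable K : fieldType.

Definition subspace_set (V : lmodType K) (S : set V) : Prop :=
  S 0 /\ forall (c : K) x y, S x -> S y -> S (c *: x + y).

(* The topologies are given by the neighbourhood filters of points. *)
Definition continuous_wrt (T U : Type) (nbT : T -> set_system T)
    (nbU : U -> set_system U) (g : T -> U) : Prop :=
  forall x, g @ nbT x --> nbU (g x).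

(* Complemented as a topological vector subspace: the range of a continuous
   linear projection. *)
Definition complemented (V : lmodType K) (nb : V -> set_system V)
    (S : set V) : Prop :=
  exists q : V -> V, [/\ linear q, continuous_wrt nb nb q,
    forall x, q (q x) = q x & range q = S].

End LinearTopology.

Section AnalyticMaps.
Variables (R : realType) (K : fieldType) (E F : lmodType K).
Variables (nE : E -> R) (nF : F -> R).

Section Multilinear.
Variable k : nat.

Definition subst_arg (v : 'I_k -> E) (i : 'I_k) (x : E) : 'I_k -> E :=
  fun j => if j == i then x else v j.

Definition multilinear (b : ('I_k -> E) -> F) : Prop :=
  forall (v : 'I_k -> E) (i : 'I_k), linear (fun x => b (subst_arg v i x)).

Definition multi_continuous (b : ('I_k -> E) -> F) : Prop :=
  forall v (e : R), 0 < e -> exists2 d : R, 0 < d &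
    forall w, (forall i, nE (w i - v i) < d) -> nF (b w - b v) < e.

(* For k = 0 the product is 1 and this is the norm of the constant. *)
Definition multi_norm (b : ('I_k -> E) -> F) : R :=
  inf [set C : R | 0 <= C /\ forall v, nF (b v) <= C * \prod_(i < k) nE (v i)].

Definition poly_form (p : E -> F) (b : ('I_k -> E) -> F) : Prop :=
  [/\ multilinear b, multi_continuous b & forall x, p x = b (fun=> x)].

Definition hom_poly (p : E -> F) : Prop := exists b, poly_form p b.

Definition poly_norm (p : E -> F) : R :=
  inf [set multi_norm b | b in [set b | poly_form p b]].

End Multilinear.

Definition conv_radius (p : nat -> E -> F) : \bar R :=
  ereal_sup [set r%:E | r in [set r : R | 0 <= r /\
    (fun k => poly_norm k (p k) * r ^+ k) @ \oo --> (0 : R)]].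

(* Only the values of g on U matter; that U is open is implied. *)
Definition analytic_on (U : set E) (g : E -> F) : Prop :=
  forall x, U x -> exists2 p : nat -> E -> F,
    (forall k, hom_poly k (p k)) /\ (0 < conv_radius p)%E &
    exists r : R, [/\ 0 < r, (r%:E <= conv_radius p)%E,
      norm_ball nE x r `<=` U &
      forall y, nE y < r ->
        (fun m : nat => \sum_(k < m) p k y) @ \oo --> norm_nbhs nF (g (x + y))].

Definition is_deriv (g : E -> F) (x : E) (A : E -> F) : Prop :=
  [/\ linear A, continuous_wrt (norm_nbhs nE) (norm_nbhs nF) A &
    forall e : R, 0 < e -> \forall y \near norm_nbhs nE x,
      nF (g y - g x - A (y - x)) <= e * nE (y - x)].

End AnalyticMaps.

(* A chart is a partial map: cmap is meaningful on cdom only, and a maximal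
   atlas contains every extension of its charts outside their domains. *)
Record chart (T V : Type) := Chart { cdom : set T; cmap :> T -> V }.

Record manifold (R : realType) (K : ultraField R) (E : ultraBanach K) :=
  Manifold { mpt :> topologicalType; atlas : set (chart mpt E) }.

Section Manifolds.
Variables (R : realType) (K : ultraField R).

Section OneManifold.
Variable E : ultraBanach K.
Local Notation nE := (@ub_norm R K E).

(* Homeomorphism from an open subset of T onto an open subset of E. *)
Definition is_chart (T : topologicalType) (c : chart T E) : Prop :=
  [/\ open (cdom c), norm_open nE (c @` cdom c), set_inj (cdom c) c,
      forall x, cdom c x -> c @ x --> norm_nbhs nE (c x) &
      forall x W, cdom c x -> nbhs x W ->
        norm_nbhs nE (c x) (c @` (W `&` cdom c))].

(* The transition map d \o c^-1 is analytic. *)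
Definition analytic_transition (T : Type) (c d : chart T E) : Prop :=
  exists2 g : E -> E, analytic_on nE nE (c @` (cdom c `&` cdom d)) g &
    forall x, cdom c x -> cdom d x -> g (c x) = d x.

Definition analytic_manifold (M : manifold E) : Prop :=
  [/\ hausdorff_space M,
      forall c, atlas c -> is_chart (T := M) c,
      forall x : M, exists2 c, atlas c & cdom c x,
      forall c d : chart M E, atlas c -> atlas d -> analytic_transition c d &
      forall c : chart M E, is_chart c ->
        (forall d, atlas d -> analytic_transition c d /\ analytic_transition d c) ->
        atlas c].

Definition chart_at (M : manifold E) (x : M) (c : chart M E) : Prop :=
  atlas c /\ cdom c x.

(* The open subset U of M, with the subspace topology and the charts of M
   whose domain is contained in U. *)
Definition open_submanifold (M : manifold E) (U : set M) : manifold E :=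
  @Manifold R K E (set_type U) [set c | exists d : chart M E,
    [/\ atlas d, cdom d `<=` U, cdom c = set_val @^-1` cdom d &
        forall y, cdom c y -> c y = d (set_val y)]].

End OneManifold.

Definition analytic_map (E F : ultraBanach K) (M : manifold E) (N : manifold F)
    (U : set M) (f : M -> N) : Prop :=
  [/\ open U, forall x, U x -> {for x, continuous f} &
    forall (c : chart M E) (d : chart N F), atlas c -> atlas d ->
      let A := U `&` cdom c `&` f @^-1` cdom d in
      exists2 g : E -> F, analytic_on (@ub_norm R K E) (@ub_norm R K F) (c @` A) g &
        forall x, A x -> g (c x) = d (f x)].

(* A is the derivative at c x of d \o f \o c^-1. *)
Definition chart_deriv (E F : ultraBanach K) (M N : topologicalType)
    (f : M -> N) (x : M) (c : chart M E) (d : chart N F) (A : E -> F) : Prop :=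
  exists2 g : E -> F, \forall y \near x, g (c y) = d (f y) &
    is_deriv (@ub_norm R K E) (@ub_norm R K F) g (c x) A.

(* A tangent vector at x is a family of vectors of E, one for each chart around
   x, related by the derivatives of the transition maps.  It is extended by 0
   to the other indices, so that equality is extensional. *)
Section Tangent.
Variables (E : ultraBanach K) (M : manifold E) (x : M).

Definition tangent_family (v : chart M E -> E) : Prop :=
  (forall c, ~ chart_at x c -> v c = 0) /\
  (forall c d A, chart_at x c -> chart_at x d -> chart_deriv id x c d A ->
    v d = A (v c)).

Definition tangent_pred : {pred chart M E -> E} :=
  [pred v | `[< tangent_family v >]].

Record tangent := Tangent {
  tcoord :> chart M E -> E;
  tcoordP : tcoord \in tangent_pred }.

HB.instance Definition _ := [isSub for tcoord].
HB.instance Definition _ := [Choice of tangent by <:].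

Lemma tangent_submod_closed : submod_closed tangent_pred.
Proof.
split=> [|k u v].
  apply/asboolP; split=> [c _|c d A _ _]; first by [].
  case=> [g _ [linA _ _]].
  have := linA (-1) 0 0.
  by rewrite !scaleN1r oppr0 addr0 addNr.
move=> /asboolP[u0 uT] /asboolP[v0 vT]; apply/asboolP; split.
  move=> c cx; have : k *: u c + v c = 0 by rewrite u0// v0// scaler0 addr0.
  exact.
move=> c d A cx dx cdA; have [g _ [linA _ _]] := cdA.
have : k *: u d + v d = A (k *: u c + v c).
  by rewrite linA (uT c d A)// (vT c d A).
exact.
Qed.

HB.instance Definition _ :=
  GRing.isSubmodClosed.Build _ _ tangent_pred tangent_submod_closed.
HB.instance Definition _ := [SubChoice_isSubLmodule of tangent by <:].

(* For each chart c around x, v |-> v c is a linear bijection of the tangent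
   space onto E; the topology is the one for which it is a homeomorphism. *)
Definition tangent_nbhs (v : tangent) : set_system tangent :=
  [set W | exists2 c, chart_at x c &
    norm_nbhs (fun u : tangent => ub_norm (u c)) v W].

End Tangent.

(* The tangent map of f at x, where y = f x.  Keeping y as a separate argument
   avoids casts when x is a fixed point of f, or when f x = y is known only
   propositionally. *)
Definition tangent_map (E F : ultraBanach K) (M : manifold E) (N : manifold F)
    (f : M -> N) (x : M) (y : N) (v : tangent x) : tangent y :=
  xget 0 [set w : tangent y | forall c d A, chart_at x c -> chart_at y d ->
    chart_deriv f x c d A -> w d = A (v c)].
Arguments tangent_map {E F M N} f x y v.

(* An immersed submanifold is given by a manifold N with an injective immersion
   i, which plays the role of the inclusion map. *)
Definition immersed_submanifold (E F : ultraBanach K) (M : manifold E)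
    (N : manifold F) (i : N -> M) : Prop :=
  [/\ analytic_manifold N, injective i, analytic_map setT i &
    forall x : N, injective (tangent_map i x (i x)) /\
      complemented (@tangent_nbhs E M (i x))
        (range (tangent_map i x (i x)))].

Definition adapted_chart (E : ultraBanach K) (M : manifold E) (S : set M)
    (V0 : set E) (c : chart M E) : Prop :=
  atlas c /\ c @` (S `&` cdom c) = V0 `&` c @` cdom c.

Definition submanifold (E : ultraBanach K) (M : manifold E) (S : set M) : Prop :=
  exists V0 : set E,
    complemented (norm_nbhs (@ub_norm R K E)) V0 /\
    forall x, S x -> exists2 c, adapted_chart S V0 c & cdom c x.

(* The manifold structure of N is the one of the submanifold range i of M: its
   modelling space is identified by j with the complemented subspace range j,
   and the restrictions of adapted charts of M are charts of N. *)
Definition submanifold_structure (E F : ultraBanach K) (M : manifold E)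
    (N : manifold F) (i : N -> M) : Prop :=
  exists j : F -> E,
    [/\ linear j, injective j,
        forall W, norm_open (@ub_norm R K F) W <->
          exists2 V, norm_open (@ub_norm R K E) V & W = j @^-1` V,
        complemented (norm_nbhs (@ub_norm R K E)) (range j) &
        forall x : N, exists c : chart M E,
          [/\ adapted_chart (range i) (range j) c, cdom c (i x) &
            exists2 d : chart N F, atlas d &
              cdom d = i @^-1` cdom c /\
              forall y, cdom d y -> c (i y) = j (d y)]].

(* Equality of manifold structures on U is expressed by analyticity of the
   identity in both directions (h and k), since N1 and N2 may have different
   (necessarily isomorphic) modelling spaces. *)
Definition same_germ (E F1 F2 : ultraBanach K) (M : manifold E) (p : M)
    (N1 : manifold F1) (i1 : N1 -> M) (N2 : manifold F2) (i2 : N2 -> M) : Prop :=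
  exists U : set M,
    [/\ U p, U `<=` range i1 /\ open (i1 @^-1` U),
        U `<=` range i2 /\ open (i2 @^-1` U),
        exists2 h : N1 -> N2, analytic_map (i1 @^-1` U) h &
          forall x, U (i1 x) -> i2 (h x) = i1 x &
        exists2 k : N2 -> N1, analytic_map (i2 @^-1` U) k &
          forall x, U (i2 x) -> i1 (k x) = i2 x].

End Manifolds.

Arguments tangent_map {R K E F M N} f x y v.
Arguments tangent_nbhs {R K E M} x v.

Section CentreStable.
Variables (R : realType) (K : ultraField R).

(* Operator norm of A restricted to S; the quotient at x = 0 is 0. *)
Definition opnorm_on (V : lmodType K) (n : V -> R) (S : set V) (A : V -> V) : \bar R :=
  ereal_sup [set (n (A x) / n x)%:E | x in S].

(* S is an a-centre-stable subspace with respect to alpha; T is the unstable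
   complement, beta the inverse of alpha on T.  The extended inverse satisfies
   0^-1 = +oo. *)
Definition centre_stable_subspace (V : lmodType K) (nb : V -> set_system V)
    (alpha : V -> V) (a : R) (S : set V) : Prop :=
  subspace_set S /\ alpha @` S `<=` S /\
  exists T : set V,
    [/\ subspace_set T, alpha @` T `<=` T,
        S `&` T = [set 0] /\ [set x + y | x in S & y in T] = setT &
    exists beta : V -> V,
      [/\ beta @` T `<=` T, forall y, T y -> beta (alpha y) = y,
          forall y, T y -> alpha (beta y) = y &
      exists n : V -> R,
        [/\ ultrametric_norm n, forall x, norm_nbhs n x = nb x,
            forall x y, S x -> T y -> n (x + y) = Num.max (n x) (n y),
            (opnorm_on n S alpha <= a%:E)%E &
            (a%:E < (opnorm_on n T beta)^-1)%E]]].

(* The immersed submanifold (N, i) of M0 is a centre-stable manifold around p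
   with respect to f, for Tcs the centre-stable subspace of the tangent space. *)
Definition centre_stable_manifold (E F : ultraBanach K) (M : manifold E)
    (M0 : set M) (f : M -> M) (p : M) (Tcs : set (tangent p))
    (N : manifold F) (i : N -> M) : Prop :=
  [/\ immersed_submanifold i, range i `<=` M0,
      exists2 x : N, i x = p & range (tangent_map i x p) = Tcs &
      exists2 g : N -> N, analytic_map setT g & forall x, i (g x) = f (i x)].

End CentreStable.

(* Main.v *)
(** A power series is a function on lists of vectors whose restriction to lists of
    length [k] is a continuous [k]-linear map, evaluated along the diagonal; by the
    ultrametric inequality, sup estimates on these coefficients give composition,
    formal inversion and re-expansion around nearby points, hence the inverse
    function theorem.

    In a chart, [f] is [alpha + eta] with [alpha] preserving a splitting and [eta]
    of small Lipschitz constant near [0].  Following Irwin, an orbit [z] with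
    [|z n| <= C a^n] is a solution of [z = H x + Gamma (eta z)] in a weighted
    Banach space of sequences, where [x] is the centre-stable component of [z 0]
    and [Gamma] solves the linear inhomogeneous equation forwards on the
    centre-stable part and backwards on the unstable part.  Inverting
    [z - Gamma (eta z)] analytically gives an analytic map [phi] whose graph
    consists of the starting points of these orbits: the local centre-stable
    manifold.

    Uniqueness is a cone argument.  An arbitrary centre-stable manifold is, near
    [p], a graph over the centre-stable subspace by the inverse function theorem,
    and in a suitable norm [f] contracts small balls in it by the factor [a <= 1];
    so its points have orbits bounded by [C a^n] and lie on the graph of [phi]. *)

From HB Require Import structures.
Require Import Defs.
From mathcomp Require Import all_boot all_order all_algebra.
From mathcomp Require Import all_classical all_reals all_analysis.
From mathcomp Require Import ring lra zify.

Set Implicit Arguments.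
Unset Strict Implicit.
Unset Printing Implicit Defensive.

Import Order.TTheory GRing.Theory Num.Theory.
Import numFieldNormedType.Exports.
Local Open Scope classical_set_scope.
Local Open Scope ring_scope.

Notation "⟦ x ⟧" := (ub_norm x) (at level 0, x at level 99, format "⟦ x ⟧").

(** The field may have positive characteristic, so a series can be neither symmetrised nor recovered
    from its derivatives, both of which divide by k!. Hence coefficients are ordered multilinear
    maps, and composition and re-expansion are sums over ordered decompositions of a list; such
    sums, however many terms they have, cost no constant in an ultrametric space. The bound a <= 1
    keeps an orbit of norm at most C a^n, with C small, in the ball where f is given, and it makes
    substitution into eta preserve the weight a^n. A centre-stable manifold is only immersed: its
    topology may be finer than that of M, and a small ball of M can meet it far from p. Forward
    invariance of a small piece is therefore proved in the topology of N, by continuity of the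
    restriction of f at p followed by contraction of the centre-stable component; only then are the
    orbits of the piece known to be bounded by C a^n. The space X of the local coordinates is the
    tangent space with the norm of the centre-stable hypothesis, so the splitting estimates hold
    with their exact constants. *)

Lemma geometric_lt (R : realType) (C t e : R) : 0 <= t < 1 -> 0 < e ->
  exists N, forall m, (N <= m)%N -> C * t ^+ m < e.
Proof.
move=> /andP[t0 t1] e0.
have cv : (fun m => C * t ^+ m) @ \oo --> (0 : R).
  rewrite -(mulr0 C); apply: cvgMr; apply: cvg_expr; by rewrite ger0_norm.
have /cvgrPdist_lt /(_ e e0) [N _ HN] := cv.
exists N => m Nm; have := HN m Nm; rewrite /= sub0r normrN.
by apply: le_lt_trans; rewrite ler_norm.
Qed.

(** The radius [(M + 1)^-1] stands in for [M^-1], so that [M = 0] is not a special case. *)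
Lemma inv_succ_small (R : realType) (M t : R) : 0 <= M -> 0 <= t -> t < (M + 1)^-1 ->
  M * t < 1.
Proof.
move=> M0 t0; rewrite -[X in _ < X]mul1r ltr_pdivlMr ?ltr_wpDl//.
by apply: le_lt_trans; rewrite mulrDr mulr1 mulrC lerDl.
Qed.

(** * Ultrametric norms, limits and scalars *)

Section Norm.
Variables (R : realType) (K : ultraField R) (E : ultraBanach K).
Implicit Types x y : E.

Lemma norm_ge0 x : 0 <= ⟦x⟧.
Proof. by case: (ub_normP E). Qed.

Lemma norm_eq0 x : ⟦x⟧ = 0 -> x = 0.
Proof. by case: (ub_normP E) => _ /(_ x)[]. Qed.

Lemma norm0 : ⟦0 : E⟧ = 0.
Proof. by case: (ub_normP E) => _ /(_ 0)[_ ->]. Qed.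

Lemma norm_gt0 x : x <> 0 -> 0 < ⟦x⟧.
Proof.
by move=> x0; rewrite lt_neqAle norm_ge0 andbT eq_sym; apply/eqP => /norm_eq0.
Qed.

Lemma normZ k x : ⟦k *: x⟧ = uf_abs k * ⟦x⟧.
Proof. by case: (ub_normP E). Qed.

Lemma norm_add x y : ⟦x + y⟧ <= Num.max ⟦x⟧ ⟦y⟧.
Proof. by case: (ub_normP E). Qed.

Lemma abs1 : uf_abs (1 : K) = 1.
Proof.
case: (uf_absP K) => a0 az aM _.
have : uf_abs (1 : K) * uf_abs (1 : K) = uf_abs (1 : K) by rewrite -aM mulr1.
have n0 : uf_abs (1 : K) != 0 by apply/eqP => /az/eqP; rewrite oner_eq0.
by rewrite -{3}[uf_abs 1]mulr1 => /(mulfI n0).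
Qed.

Lemma abs_ge0 (k : K) : 0 <= uf_abs k.
Proof. by case: (uf_absP K). Qed.

Lemma absM (k l : K) : uf_abs (k * l) = uf_abs k * uf_abs l.
Proof. by case: (uf_absP K). Qed.

Lemma abs_gt0 (k : K) : k != 0 -> 0 < uf_abs k.
Proof.
move=> k0; rewrite lt_neqAle abs_ge0 andbT eq_sym; apply/eqP => kz.
by case: (uf_absP K) => _ /(_ k)[/(_ kz)/eqP]; rewrite (negbTE k0).
Qed.

Lemma absV (k : K) : uf_abs k^-1 = (uf_abs k)^-1.
Proof.
have [->|k0] := eqVneq k 0.
  by rewrite invr0; case: (uf_absP K) => _ /(_ 0)[_ ->]//; rewrite invr0.
by apply: (mulfI (lt0r_neq0 (abs_gt0 k0))); rewrite -absM !divff ?abs1 ?lt0r_neq0 ?abs_gt0.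
Qed.

Lemma absX (k : K) m : uf_abs (k ^+ m) = uf_abs k ^+ m.
Proof. by elim: m => [|m IH]; rewrite ?expr0 ?abs1// !exprS absM IH. Qed.

Lemma absN1 : uf_abs (- 1 : K) = 1.
Proof.
have /eqP : uf_abs (-1 : K) ^+ 2 = 1 by rewrite expr2 -absM mulrNN mulr1 abs1.
rewrite sqrf_eq1 => /orP[/eqP//|/eqP h].
by have := abs_ge0 (-1 : K); rewrite h; lra.
Qed.

Lemma normN x : ⟦- x⟧ = ⟦x⟧.
Proof. by rewrite -scaleN1r normZ absN1 mul1r. Qed.

Lemma norm_sub x y : ⟦x - y⟧ <= Num.max ⟦x⟧ ⟦y⟧.
Proof. by rewrite -(normN y) norm_add. Qed.

Lemma norm_distC x y : ⟦x - y⟧ = ⟦y - x⟧.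
Proof. by rewrite -normN opprB. Qed.

Lemma norm_add_le x y c : ⟦x⟧ <= c -> ⟦y⟧ <= c -> ⟦x + y⟧ <= c.
Proof. by move=> xc yc; rewrite (le_trans (norm_add _ _))// ge_max xc. Qed.

Lemma norm_sub_le x y c : ⟦x⟧ <= c -> ⟦y⟧ <= c -> ⟦x - y⟧ <= c.
Proof. by move=> xc yc; rewrite (le_trans (norm_sub _ _))// ge_max xc. Qed.

Lemma norm_add_lt x y c : ⟦x⟧ < c -> ⟦y⟧ < c -> ⟦x + y⟧ < c.
Proof. by move=> xc yc; rewrite (le_lt_trans (norm_add _ _))// gt_max xc. Qed.

Lemma norm_sub_lt x y c : ⟦x⟧ < c -> ⟦y⟧ < c -> ⟦x - y⟧ < c.
Proof. by move=> xc yc; rewrite (le_lt_trans (norm_sub _ _))// gt_max xc. Qed.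

Lemma norm_dist_lt y x z c : ⟦x - y⟧ < c -> ⟦y - z⟧ < c -> ⟦x - z⟧ < c.
Proof. by move=> xy yz; rewrite -(subrK y x) -addrA norm_add_lt. Qed.

Lemma norm_dist_le y x z c : ⟦x - y⟧ <= c -> ⟦y - z⟧ <= c -> ⟦x - z⟧ <= c.
Proof. by move=> xy yz; rewrite -(subrK y x) -addrA norm_add_le. Qed.

Lemma norm_add_eql x y : ⟦y⟧ < ⟦x⟧ -> ⟦x + y⟧ = ⟦x⟧.
Proof.
move=> yx; apply/eqP; rewrite eq_le norm_add_le ?(ltW yx)//=.
rewrite leNgt; apply/negP => h; suff : ⟦x⟧ < ⟦x⟧ by rewrite ltxx.
by rewrite -{1}(addrK y x) norm_sub_lt.
Qed.

Lemma norm_sum_le (I : Type) (r : seq I) (P : pred I) (f : I -> E) c : 0 <= c ->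
  (forall i, P i -> ⟦f i⟧ <= c) -> ⟦\sum_(i <- r | P i) f i⟧ <= c.
Proof.
move=> c0 fc; elim/big_ind: _ => //; first by rewrite norm0.
by move=> x y; exact: norm_add_le.
Qed.

Lemma norm_le0 x : (forall e : R, 0 < e -> ⟦x⟧ < e) -> x = 0.
Proof.
move=> h; apply: contrapT => /norm_gt0 /[dup] /h; by rewrite ltxx.
Qed.

Definition ulim (u : nat -> E) (l : E) :=
  forall e : R, 0 < e -> exists N, forall m, (N <= m)%N -> ⟦u m - l⟧ < e.

Lemma ulimP u l : (u @ \oo --> norm_nbhs (@ub_norm R K E) l) <-> ulim u l.
Proof.
split.
  move=> ul e e0; have [N _ HN] := ul _ (ex_intro2 _ _ e e0 (fun _ => id)).
  by exists N => m /HN.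
move=> ul W [e /= e0 eW]; have [N HN] := ul e e0.
by exists N => // m /= Nm; apply: eW; exact: HN.
Qed.

Lemma ulim_unique u l l' : ulim u l -> ulim u l' -> l = l'.
Proof.
move=> ul ul'; apply/eqP; rewrite -subr_eq0; apply/eqP/norm_le0 => e e0.
have [N HN] := ul e e0; have [N' HN'] := ul' e e0.
apply: (@norm_dist_lt (u (maxn N N'))).
  by rewrite norm_distC HN ?leq_maxl.
by rewrite HN' ?leq_maxr.
Qed.

Lemma ulim_ext u v l : (forall m, u m = v m) -> ulim u l -> ulim v l.
Proof. by move=> /funext ->. Qed.

Lemma ulim_cst l : ulim (fun=> l) l.
Proof. by move=> e e0; exists 0 => m _; rewrite subrr norm0. Qed.

Lemma ulimD u v l l' : ulim u l -> ulim v l' -> ulim (fun m => u m + v m) (l + l').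
Proof.
move=> ul vl e e0; have [N HN] := ul e e0; have [N' HN'] := vl e e0.
exists (maxn N N') => m; rewrite geq_max => /andP[/HN ? /HN' ?].
by rewrite opprD addrACA norm_add_lt.
Qed.

Lemma ulimZ k u l : ulim u l -> ulim (fun m => k *: u m) (k *: l).
Proof.
move=> ul e e0; have [->|k0] := eqVneq k 0.
  by exists 0 => m _; rewrite !scale0r subrr norm0.
have [N HN] := ul (e / uf_abs k) (divr_gt0 e0 (abs_gt0 k0)).
exists N => m /HN; rewrite -scalerBr normZ.
by rewrite ltr_pdivlMr ?abs_gt0// mulrC.
Qed.

Lemma ulimN u l : ulim u l -> ulim (fun m => - u m) (- l).
Proof.
by move=> /(ulimZ (-1)); rewrite scaleN1r; apply: ulim_ext => m; rewrite scaleN1r.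
Qed.

Lemma ulimB u v l l' : ulim u l -> ulim v l' -> ulim (fun m => u m - v m) (l - l').
Proof. by move=> ul /ulimN; exact: ulimD. Qed.

Lemma ulim_shift k u l : ulim u l <-> ulim (fun m => u (m + k)%N) l.
Proof.
split=> ul e e0; have [N HN] := ul e e0.
  by exists N => m Nm; rewrite HN// (leq_trans Nm)// leq_addr.
exists (N + k)%N => m Nm; rewrite -(@subnK k m) ?HN//.
  by rewrite leq_subRL ?(leq_trans _ Nm) ?leq_addl// addnC.
by rewrite (leq_trans _ Nm) ?leq_addl.
Qed.

Lemma ulim_le u l y c N : ulim u l -> (forall m, (N <= m)%N -> ⟦u m - y⟧ <= c) ->
  ⟦l - y⟧ <= c.
Proof.
move=> ul uc; apply/ler_addgt0Pr => e e0; have [N' HN] := ul e e0.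
have c0 : 0 <= c by apply: le_trans (uc N (leqnn _)); exact: norm_ge0.
apply: (@norm_dist_le (u (maxn N N'))).
  rewrite norm_distC (le_trans (ltW (HN _ (leq_maxr _ _))))//; lra.
rewrite (le_trans (uc _ (leq_maxl _ _)))//; lra.
Qed.

Lemma ulim_le0 u l c : ulim u l -> (forall m, ⟦u m⟧ <= c) -> ⟦l⟧ <= c.
Proof.
move=> ul uc; rewrite -(subr0 l); apply: (ulim_le (N := 0) ul) => m _.
by rewrite subr0.
Qed.

Lemma ulim_squeeze u v l (C t : R) : 0 <= t < 1 -> ulim v l ->
  (forall m, ⟦u m - v m⟧ <= C * t ^+ m) -> ulim u l.
Proof.
move=> t01 vl uv e e0; have [N HN] := vl e e0.
have [N' HN'] := geometric_lt C t01 e0.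
exists (maxn N N') => m; rewrite geq_max => /andP[/HN ? /HN' ?].
by apply: (@norm_dist_lt (v m)) => //; rewrite (le_lt_trans (uv _)).
Qed.

(** A tail is bounded by its largest term, so the remainder carries no factor 1/(1 - t). *)
Lemma geometric_series_cvg (a : nat -> E) (C t : R) : 0 <= t < 1 ->
  (forall k, ⟦a k⟧ <= C * t ^+ k) ->
  exists l, ulim (fun m => \sum_(k < m) a k) l /\
    forall m, ⟦l - \sum_(k < m) a k⟧ <= C * t ^+ m.
Proof.
move=> /[dup] t01 /andP[t0 t1] aC.
have C0 : 0 <= C by apply: le_trans (norm_ge0 (a 0)) _; rewrite (le_trans (aC 0))// mulr1.
have tail m j : (m <= j)%N -> ⟦\sum_(k < j) a k - \sum_(k < m) a k⟧ <= C * t ^+ m.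
  move=> mj; rewrite -(big_mkord xpredT) -(big_mkord xpredT a).
  rewrite (big_cat_nat (n := m))//= addrAC subrr add0r big_nat.
  apply: norm_sum_le => [|i /andP[mi _]]; first by rewrite mulr_ge0 ?exprn_ge0.
  rewrite (le_trans (aC i))// ler_wpM2l// ler_wiXn2l//; exact: ltW.
have [e e0|l] := @ub_complete _ _ E (fun m => \sum_(k < m) a k).
  have [N HN] := geometric_lt C t01 e0; exists N => i j Ni Nj.
  apply: (@norm_dist_lt (\sum_(k < N) a k)).
    by rewrite (le_lt_trans (tail _ _ Ni)) ?HN.
  by rewrite norm_distC (le_lt_trans (tail _ _ Nj)) ?HN.
move/ulimP => ul; exists l; split=> // m; apply: (ulim_le (N := m) ul) => j.
exact: tail.
Qed.

(** If no absolute value lay strictly between 0 and 1, the open unit ball around 0 would be {0} and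
    the topology discrete. *)
Lemma exists_small_scalar : exists c : K, 0 < uf_abs c < 1.
Proof.
have : ~ norm_open (@uf_abs R K) [set 0] := @uf_nondiscrete R K.
apply: contra_notP => /forallNP h x ->; exists 1; first exact: ltr01.
move=> y; rewrite /norm_ball/= subr0 => y1.
apply: contrapT => /eqP y0; apply: (h y); by rewrite abs_gt0.
Qed.

(** Norms need not be values of the absolute value, so a vector cannot be normalised exactly; it can
    only be brought into a shell of ratio [uf_abs c]. *)
Lemma rescale (c : K) (t : R) : 0 < uf_abs c < 1 -> 0 < t ->
  exists2 l : K, l != 0 & uf_abs c <= uf_abs l * t < 1.
Proof.
move=> /andP[c0 c1] t0; have cn0 : c != 0.
  by apply/eqP => h; move: c0; rewrite h; case: (uf_absP K) => _ /(_ 0)[_ ->]//; rewrite ltxx.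
have c01 : 0 <= uf_abs c < 1 by rewrite (ltW c0) c1.
(* The factor c^-N lifts [t] above 1; the least power of [c] that brings it below 1 again leaves it
   at [uf_abs c] or more, by minimality. *)
have [N HN] : exists N, t^-1 * uf_abs c ^+ N < 1.
  by have [N /(_ N (leqnn _))] := geometric_lt t^-1 c01 ltr01; exists N.
have [N' HN'] : exists N', uf_abs (c ^- N) * t * uf_abs c ^+ N' < 1.
  by have [N' /(_ N' (leqnn _))] := geometric_lt (uf_abs (c ^- N) * t) c01 ltr01; exists N'.
have ex : exists n, uf_abs (c ^- N) * t * uf_abs c ^+ n < 1 by exists N'.
case: (ex_minnP ex) => n nP nmin; exists (c ^- N * c ^+ n).
  by rewrite mulf_neq0 ?invr_neq0 ?expf_neq0.
rewrite absM absX mulrAC nP andbT; case: n nP nmin => [|n] _ nmin.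
  rewrite mulr1 absV absX (le_trans (ltW c1))// mulrC ler_pdivlMr ?exprn_gt0// mul1r.
  by move: HN; rewrite mulrC ltr_pdivrMr// mul1r => /ltW.
rewrite exprS mulrCA -[leLHS]mulr1 ler_pM2l// leNgt; apply/negP => /nmin.
by rewrite ltnn.
Qed.

End Norm.

Lemma sum_recl2 (V : nmodType) m (u : nat -> V) :
  \sum_(k < m.+2) u k = u 0 + (u 1 + \sum_(k < m) u k.+2).
Proof. by rewrite 2!big_ord_recl. Qed.

Section LinearMaps.
Variables (R : realType) (K : ultraField R) (E F : ultraBanach K).
Implicit Types L : E -> F.

Lemma lin0 L : linear L -> L 0 = 0.
Proof. by move=> lL; have := lL (-1) 0 0; rewrite !scaleN1r oppr0 addr0 addNr. Qed.

Lemma linZ L k x : linear L -> L (k *: x) = k *: L x.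
Proof. by move=> lL; have := lL k x 0; rewrite lin0// !addr0. Qed.

Lemma linD L x y : linear L -> L (x + y) = L x + L y.
Proof. by move=> lL; have := lL 1 x y; rewrite !scale1r. Qed.

Lemma linN L x : linear L -> L (- x) = - L x.
Proof. by move=> lL; rewrite -scaleN1r linZ// scaleN1r. Qed.

Lemma linB L x y : linear L -> L (x - y) = L x - L y.
Proof. by move=> lL; rewrite linD// linN. Qed.

Lemma lin_sum L n (u : nat -> E) : linear L ->
  L (\sum_(k < n) u k) = \sum_(k < n) L (u k).
Proof.
move=> lL; elim: n => [|n IH]; first by rewrite !big_ord0 lin0.
by rewrite !big_ord_recr/= linD// IH.
Qed.

Definition blin L (D : R) :=
  [/\ linear L, 0 <= D & forall x, ⟦L x⟧ <= D * ⟦x⟧].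

Lemma blin_small L D e : blin L D -> 0 < e ->
  exists2 d, 0 < d & forall x, ⟦x⟧ < d -> ⟦L x⟧ < e.
Proof.
move=> [lL D0 LD] e0; have D1 : 0 < D + 1 by lra.
exists (e / (D + 1)) => [|x]; first by rewrite divr_gt0.
rewrite ltr_pdivlMr//; apply: le_lt_trans; rewrite (le_trans (LD x))// mulrC.
by rewrite ler_wpM2l ?norm_ge0// lerDl.
Qed.

Lemma blin_ulim L D u l : blin L D -> ulim u l -> ulim (fun m => L (u m)) (L l).
Proof.
move=> bL ul e e0; have [d d0 dL] := blin_small bL e0; have [N HN] := ul d d0.
by exists N => m /HN /dL; rewrite linB//; case: bL.
Qed.

End LinearMaps.

Lemma blin_comp (R : realType) (K : ultraField R) (E F G : ultraBanach K)
    (L : E -> F) (L' : F -> G) D D' : blin L D -> blin L' D' ->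
  blin (fun x => L' (L x)) (D' * D).
Proof.
move=> [lL D0 LD] [lL' D0' LD']; split; last 2 first.
- exact: mulr_ge0.
- by move=> x; rewrite (le_trans (LD' _))// -mulrA ler_wpM2l.
by move=> k x y; rewrite lL lL'.
Qed.

Lemma blin_id (R : realType) (K : ultraField R) (E : ultraBanach K) :
  blin (fun x : E => x) 1.
Proof. by split=> // x; rewrite mul1r. Qed.

(** * Power series and their composition *)

Section PowerSeries.
Variables (R : realType) (K : ultraField R) (E F : ultraBanach K).
Implicit Types (b : seq E -> F) (C M : R).

(* The coefficient of degree k of a power series is a k-linear map, and all of
   them are gathered in one function on sequences. *)
Definition mlin b := forall s t k x y,
  b (s ++ (k *: x + y) :: t) = k *: b (s ++ x :: t) + b (s ++ y :: t).

(** The bound is on the multilinear maps and not on their diagonals: passing from one to the other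
    by polarisation divides by k!, which may vanish in K. *)
Definition powser b C M := [/\ mlin b, 0 <= C, 0 <= M &
  forall s, ⟦b s⟧ <= C * \prod_(x <- s) (M * ⟦x⟧)].

Definition sums_to b (y : E) (l : F) := ulim (fun m => \sum_(k < m) b (nseq k y)) l.

Definition analytic_at (g : E -> F) (x : E) := exists b C M r,
  [/\ powser b C M, 0 < r & forall y, ⟦y⟧ < r -> sums_to b y (g (x + y))].

Lemma prod_ge0 M (s : seq E) : 0 <= M -> 0 <= \prod_(x <- s) (M * ⟦x⟧).
Proof. by move=> M0; apply: prodr_ge0 => x _; rewrite mulr_ge0 ?norm_ge0. Qed.

Lemma mlin_cons b x : mlin b -> mlin (fun s => b (x :: s)).
Proof. by move=> lb s t; exact: (lb (x :: s)). Qed.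

Lemma mlin_head b s : mlin b -> linear (fun x => b (x :: s)).
Proof. by move=> lb k x y; exact: (lb [::]). Qed.

Lemma mlinB_head b x y s : mlin b -> b ((x - y) :: s) = b (x :: s) - b (y :: s).
Proof. by move=> lb; exact: (linB (L := fun x => b (x :: s)) x y (mlin_head s lb)). Qed.

Lemma mlinD_head b x y s : mlin b -> b ((x + y) :: s) = b (x :: s) + b (y :: s).
Proof. by move=> lb; exact: (linD (L := fun x => b (x :: s)) x y (mlin_head s lb)). Qed.

Lemma powser_cons b C M x : powser b C M ->
  powser (fun s => b (x :: s)) (C * (M * ⟦x⟧)) M.
Proof.
move=> [lb C0 M0 bC]; split=> //.
- exact: mlin_cons.
- by rewrite !mulr_ge0 ?norm_ge0.
- by move=> s; rewrite (le_trans (bC _))// big_cons !mulrA.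
Qed.

Lemma powser_le b C M C' M' : C <= C' -> M <= M' -> powser b C M -> powser b C' M'.
Proof.
move=> CC MM [lb C0 M0 bC]; have M0' := le_trans M0 MM.
split=> //; first exact: le_trans CC.
move=> s; rewrite (le_trans (bC _))// ler_pM ?prod_ge0//.
elim: s => [|x s IH]; first by rewrite !big_nil.
by rewrite !big_cons ler_pM ?prod_ge0// ?mulr_ge0 ?norm_ge0// ler_wpM2r ?norm_ge0.
Qed.

Lemma powser_const (c : F) :
  powser (fun s => if s is [::] then c else 0) ⟦c⟧ 0.
Proof.
split=> //; last 2 first.
- exact: norm_ge0.
- by case=> [|x s]; rewrite ?big_nil ?mulr1// norm0 big_cons !mul0r mulr0.
by move=> [|z s] t k x y /=; rewrite scaler0 addr0.
Qed.

Lemma powser_lin (L : E -> F) D : blin L D ->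
  powser (fun s => if s is [:: x] then L x else 0) 1 D.
Proof.
move=> [lL D0 LD]; split=> //.
  by move=> [|z [|? s]] [|u t] k x y /=; rewrite ?scaler0 ?addr0 ?lL.
case=> [|x [|y s]]; rewrite ?norm0 ?mul1r ?prod_ge0//.
by rewrite big_cons big_nil mulr1.
Qed.

Lemma powserD b b' C C' M M' : powser b C M -> powser b' C' M' ->
  powser (fun s => b s + b' s) (C + C') (M + M').
Proof.
move=> Pb Pb'; have [_ C0 M0 _] := Pb; have [_ C0' M0' _] := Pb'.
have [lb _ _ bC] : powser b (C + C') (M + M') by apply: powser_le Pb; lra.
have [lb' _ _ bC'] : powser b' (C + C') (M + M') by apply: powser_le Pb'; lra.
split; rewrite ?addr_ge0//; last by move=> s; rewrite norm_add_le.
by move=> s t k x y; rewrite lb lb' scalerDr addrACA.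
Qed.

Lemma powser_tail b C M j : powser b C M ->
  powser (fun s => if (size s < j)%N then 0 else b s) C M.
Proof.
move=> [lb C0 M0 bC]; split=> // [s t k x y|s].
  rewrite !size_cat/=; case: ifP => _; first by rewrite scaler0 addr0.
  exact: lb.
by case: ifP => // _; rewrite norm0 mulr_ge0// prod_ge0.
Qed.

Lemma prod_nseq M k (y : E) : \prod_(x <- nseq k y) (M * ⟦x⟧) = (M * ⟦y⟧) ^+ k.
Proof. by elim: k => [|k IH]; rewrite ?big_nil// big_cons IH exprS. Qed.

Lemma powser_nseq b C M k y : powser b C M ->
  ⟦b (nseq k y)⟧ <= C * (M * ⟦y⟧) ^+ k.
Proof. by move=> [_ _ _ bC]; rewrite -prod_nseq. Qed.

Lemma sums_to_unique b y l l' : sums_to b y l -> sums_to b y l' -> l = l'.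
Proof. exact: ulim_unique. Qed.

Lemma powser_sum b C M y : powser b C M -> M * ⟦y⟧ < 1 ->
  exists l, sums_to b y l /\
    forall m, ⟦l - \sum_(k < m) b (nseq k y)⟧ <= C * (M * ⟦y⟧) ^+ m.
Proof.
move=> Pb My; have [_ _ M0 _] := Pb.
apply: (@geometric_series_cvg _ _ _ (fun k => b (nseq k y))); first by rewrite mulr_ge0 ?norm_ge0.
by move=> k; exact: powser_nseq.
Qed.

Lemma sums_to_bound b C M y l m : powser b C M -> M * ⟦y⟧ < 1 -> sums_to b y l ->
  ⟦l - \sum_(k < m) b (nseq k y)⟧ <= C * (M * ⟦y⟧) ^+ m.
Proof.
by move=> Pb My bl; have [l' [/(sums_to_unique bl) <-]] := powser_sum Pb My.
Qed.

Lemma sums_to0 b l : (forall s, s <> [::] -> (0 : E) \in s -> b s = 0) ->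
  sums_to b 0 l -> l = b [::].
Proof.
move=> b0 bl; apply: (ulim_unique bl) => e e0; exists 1 => m m1.
case: m m1 => // m _; rewrite big_ord_recl /= big1 ?addr0 ?subrr ?norm0// => i _.
by rewrite b0// inE eqxx.
Qed.

Lemma mlin0 b s t : mlin b -> b (s ++ 0 :: t) = 0.
Proof.
move=> lb; have := lb s t (-1) 0 0; rewrite scaler0 addr0 scaleN1r addNr; exact.
Qed.

Lemma sums_to_at0 b l : mlin b -> sums_to b 0 l -> l = b [::].
Proof.
move=> lb; apply: sums_to0 => s _ /splitPr[s1 s2]; exact: mlin0.
Qed.

Lemma sums_toD b b' y l l' : sums_to b y l -> sums_to b' y l' ->
  sums_to (fun s => b s + b' s) y (l + l').
Proof.
by move=> bl bl'; apply: ulim_ext (ulimD bl bl') => m; rewrite big_split.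
Qed.

Lemma sums_to_drop2 b y l : sums_to b y l ->
  sums_to (fun s => if (size s < 2)%N then 0 else b s) y (l - b [::] - b [:: y]).
Proof.
move=> bl; apply/(ulim_shift 2).
have bl2 := (iffLR (ulim_shift 2 _ _) bl).
apply: ulim_ext (ulimB (ulimB bl2 (ulim_cst (b [::]))) (ulim_cst (b [:: y]))) => m.
rewrite addn2 (sum_recl2 _ (fun k => b (nseq k y))) (sum_recl2 _ (fun k => if (size (nseq k y) < 2)%N then 0 else b (nseq k y))).
rewrite /= !add0r [b [::] + _]addrC addrK [b [:: y] + _]addrC addrK.
by apply: eq_bigr.
Qed.

(** The arguments are replaced one at a time; each replacement costs at most the right-hand side,
    and the total is a maximum instead of a sum. Distances are measured in units of [L], so that
    every replacement produces the same power of [M * L]. *)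
Lemma powser_diff b C M (s t : seq E) L (d : R) : powser b C M -> 0 <= L ->
  size s = size t -> (forall x, x \in s -> ⟦x⟧ <= L) ->
  (forall x, x \in t -> ⟦x⟧ <= L) ->
  (forall x y, (x, y) \in zip s t -> ⟦x - y⟧ <= d * L) -> 0 <= d ->
  ⟦b s - b t⟧ <= C * (M * L) ^+ size s * d.
Proof.
move=> Pb L0 st sL tL dL d0; elim: s t b C Pb st sL tL dL => [|x s IH] [|y t]//= b C Pb.
  by move=> *; rewrite subrr norm0; case: Pb => *; rewrite !mulr_ge0.
move=> [st] sL tL dL; have [lb C0 M0 bC] := Pb.
have yL : ⟦y⟧ <= L by rewrite tL ?inE ?eqxx.
have ML0 : 0 <= M * L by rewrite mulr_ge0.
apply: (@norm_dist_le _ _ _ (b (y :: s))).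
  rewrite -mlinB_head// (le_trans (bC _))// big_cons.
  rewrite exprS [leRHS]mulrC [leRHS]mulrCA ler_wpM2l// mulrA ler_pM//.
  - by rewrite mulr_ge0 ?norm_ge0.
  - exact: prod_ge0.
  - by rewrite mulrCA ler_wpM2l// dL ?inE ?eqxx.
  elim: s sL {st dL IH} => [|z s IH] sL; first by rewrite big_nil.
  rewrite big_cons exprS ler_pM ?mulr_ge0 ?norm_ge0 ?prod_ge0//.
    by rewrite ler_wpM2l// sL// !inE eqxx orbT.
  by apply: IH => w ws; apply: sL; move: ws; rewrite !inE orbA orbAC => ->.
have Pb' : powser (fun s => b (y :: s)) (C * (M * L)) M.
  by apply: powser_le (powser_cons y Pb) => //; rewrite !ler_wpM2l.
apply: le_trans (IH t _ _ Pb' st _ _ _) _.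
- by move=> z zs; rewrite sL// inE zs orbT.
- by move=> z zs; rewrite tL// inE zs orbT.
- by move=> z w zw; rewrite dL// inE zw orbT.
by rewrite exprS !mulrA.
Qed.

Lemma analytic_at_eq (g h : E -> F) x (r : R) : 0 < r ->
  (forall y, ⟦y⟧ < r -> g (x + y) = h (x + y)) -> analytic_at g x -> analytic_at h x.
Proof.
move=> r0 gh [b [C [M [r' [Pb r0' bg]]]]].
exists b, C, M, (Num.min r r'); split=> //; first by rewrite lt_min r0.
by move=> y; rewrite lt_min => /andP[yr yr']; rewrite -gh//; exact: bg.
Qed.

(** A total function is wanted, so the values of [g] outside the ball of convergence are
    arbitrary. *)
Lemma powser_extend b C M x : powser b C M ->
  exists2 g : E -> F, analytic_at g x &
    forall y, M * ⟦y⟧ < 1 -> sums_to b y (g (x + y)).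
Proof.
move=> Pb; have [_ _ M0 _] := Pb.
have /choice[g gP] : forall z, exists l, M * ⟦z - x⟧ < 1 -> sums_to b (z - x) l.
  move=> z; have [h|h] := boolP (M * ⟦z - x⟧ < 1); last by exists 0.
  by have [l []] := powser_sum Pb h; exists l.
have gs y : M * ⟦y⟧ < 1 -> sums_to b y (g (x + y)).
  by have := gP (x + y); rewrite addrAC subrr add0r.
exists g => //; exists b, C, M, (M + 1)^-1; split; rewrite ?invr_gt0 ?ltr_wpDl//.
by move=> y yM; apply: gs; exact: inv_succ_small (norm_ge0 y) yM.
Qed.

Lemma analytic_at_blin (L : E -> F) D x : blin L D -> analytic_at L x.
Proof.
move=> bL; have [lL D0 LD] := bL.
exists (fun s => (if s is [::] then L x else 0) + (if s is [:: x] then L x else 0)).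
exists (⟦L x⟧ + 1), (0 + D), 1; split=> //.
  exact: powserD (powser_const _) (powser_lin bL).
move=> y _ e e0; exists 2 => m; case: m => [|[|m]]// _.
rewrite (sum_recl2 _ (fun k => (if nseq k y is [::] then L x else 0) +
  (if nseq k y is [:: z] then L z else 0))) /= big1 => [|i _]; last by rewrite addr0.
by rewrite !addr0 add0r linD// subrr norm0.
Qed.

Lemma analytic_at_cst (c : F) x : analytic_at (fun=> c) x.
Proof.
exists (fun s => if s is [::] then c else 0), ⟦c⟧, 0, 1; split=> //.
  exact: powser_const.
move=> y _ e e0; exists 1 => -[|m]// _.
by rewrite big_ord_recl/= big1 ?addr0 ?subrr ?norm0// => i _.
Qed.

Lemma analytic_atD g h x : analytic_at g x -> analytic_at h x ->
  analytic_at (fun z => g z + h z) x.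
Proof.
move=> [b [C [M [r [Pb r0 bg]]]]] [b' [C' [M' [r' [Pb' r0' bg']]]]].
exists (fun s => b s + b' s), (C + C'), (M + M'), (Num.min r r').
split; first exact: powserD.
  by rewrite lt_min r0.
by move=> y; rewrite lt_min => /andP[/bg ? /bg' ?]; exact: sums_toD.
Qed.

End PowerSeries.

Section Substitution.
Variables (R : realType) (K : ultraField R) (E F G : ultraBanach K).

Lemma powser_post (b : seq E -> F) C M (L : F -> G) D :
  powser b C M -> blin L D -> powser (fun s => L (b s)) (D * C) M.
Proof.
move=> [lb C0 M0 bC] [lL D0 LD]; split; rewrite ?mulr_ge0//.
  by move=> s t k x y; rewrite lb lL.
by move=> s; rewrite (le_trans (LD _))// -mulrA ler_wpM2l.
Qed.

Lemma sums_to_post (b : seq E -> F) y l (L : F -> G) D :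
  blin L D -> sums_to b y l -> sums_to (fun s => L (b s)) y (L l).
Proof.
move=> bL /(blin_ulim bL); apply: ulim_ext => m.
by case: bL => lL _ _; exact: (lin_sum m (fun k => b (nseq k y)) lL).
Qed.

Lemma powser_pre (b : seq F -> G) C M (L : E -> F) D :
  powser b C M -> blin L D -> powser (fun s => b (map L s)) C (M * D).
Proof.
move=> [lb C0 M0 bC] [lL D0 LD]; split; rewrite ?mulr_ge0//.
  by move=> s t k x y; rewrite !map_cat/= lL lb.
move=> s; rewrite (le_trans (bC _))// ler_wpM2l// big_map.
elim: s => [|x s IH]; first by rewrite !big_nil.
rewrite !big_cons ler_pM ?mulr_ge0 ?norm_ge0//; last by rewrite -mulrA ler_wpM2l.
by apply: prodr_ge0 => z _; rewrite mulr_ge0 ?norm_ge0.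
Qed.

Lemma sums_to_pre (b : seq F -> G) y l (L : E -> F) :
  sums_to b (L y) l -> sums_to (fun s => b (map L s)) y l.
Proof. by apply: ulim_ext => m; apply: eq_bigr => i _; rewrite map_nseq. Qed.

End Substitution.

(** * Continuous linear and multilinear maps, and the two forms of analyticity *)

Notation nbh E := (norm_nbhs (@ub_norm _ _ E)).

Section ContinuousLinear.
Variables (R : realType) (K : ultraField R) (E F : ultraBanach K).

(** A vector can be scaled into the ball of radius [d] only up to the ratio [uf_abs c], which is why
    this factor appears in the bound. *)
Lemma bounded_of_small (L : E -> F) (d D : R) : linear L -> 0 < d -> 0 <= D ->
  (forall x, ⟦x⟧ < d -> ⟦L x⟧ <= D) -> exists D', blin L D'.
Proof.
move=> lL d0 D0 Ld; have [c /[dup] c01 /andP[c0 c1]] := exists_small_scalar K.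
exists (D / (d * uf_abs c)); split=> //.
  by rewrite divr_ge0// mulr_ge0// ltW.
move=> x; have [->|/eqP x0] := eqVneq x 0; first by rewrite lin0// norm0 norm0 mulr0.
have [l l0 /andP[cl l1]] := rescale c01 (divr_gt0 (norm_gt0 x0) d0).
have al := abs_gt0 l0.
have : ⟦L (l *: x)⟧ <= D by apply: Ld; rewrite normZ; move: l1; rewrite mulrA ltr_pdivrMr// mul1r.
rewrite linZ// normZ => LD.
rewrite mulrAC ler_pdivlMr ?mulr_gt0//.
have h : uf_abs c * d <= uf_abs l * ⟦x⟧ by move: cl; rewrite mulrA ler_pdivlMr.
rewrite -(ler_pM2l al).
have -> : uf_abs l * (⟦L x⟧ * (d * uf_abs c)) = uf_abs c * d * (uf_abs l * ⟦L x⟧) by ring.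
have -> : uf_abs l * (D * ⟦x⟧) = uf_abs l * ⟦x⟧ * D by ring.
by rewrite ler_pM// ?mulr_ge0 ?norm_ge0 ?abs_ge0// ltW.
Qed.

Lemma continuous_blin (L : E -> F) : linear L ->
  continuous_wrt (nbh E) (nbh F) L -> exists D, blin L D.
Proof.
move=> lL cL; have [|d d0 dL] := cL 0 (norm_ball (@ub_norm _ _ F) (L 0) 1).
  by exists 1 => //; exact: ltr01.
apply: (@bounded_of_small L d 1 lL d0 ler01) => x xd.
by have := dL x; rewrite /norm_ball/= lin0// !subr0 => /(_ xd)/ltW.
Qed.

Lemma blin_continuous (L : E -> F) D : blin L D -> continuous_wrt (nbh E) (nbh F) L.
Proof.
move=> bL x W [e /= e0 eW]; have [d d0 dL] := blin_small bL e0; have [lL _ _] := bL.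
by exists d => // y /dL; rewrite linB// => /eW.
Qed.

End ContinuousLinear.

Section MultilinearForms.
Variables (R : realType) (K : ultraField R) (E F : ultraBanach K).
Local Notation nE := (@ub_norm R K E).
Local Notation nF := (@ub_norm R K F).

Lemma subst_arg_id k (v : 'I_k -> E) i : subst_arg v i (v i) = v.
Proof. by apply/funext => j; rewrite /subst_arg; case: eqP => // ->. Qed.

Lemma multilinear_scale k (b : ('I_k -> E) -> F) (l : 'I_k -> K) v :
  multilinear b -> b (fun i => l i *: v i) = \prod_(i < k) l i *: b v.
Proof.
move=> lb.
have gen s : uniq s ->
    b (fun i => if i \in s then l i *: v i else v i) = \prod_(i <- s) l i *: b v.
  elim: s => [_|j s IH /= /andP[js us]].
    by rewrite big_nil scale1r; congr b; apply/funext => i; rewrite in_nil.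
  rewrite big_cons -scalerA -IH//.
  pose w i := if i \in s then l i *: v i else v i; rewrite -/w.
  have wj : w j = v j by rewrite /w (negbTE js).
  transitivity (b (subst_arg w j (l j *: w j))).
    congr b; apply/funext => i; rewrite /subst_arg /w inE; case: eqP => //= ->.
    by rewrite (negbTE js).
  by rewrite (linZ (L := fun x => b (subst_arg w j x)))// subst_arg_id.
have := gen (enum 'I_k) (enum_uniq _); rewrite big_enum/= => <-.
by congr b; apply/funext => i; rewrite mem_enum.
Qed.

(** Each argument is scaled separately into the shell between [d * uf_abs c] and [d], where
    continuity at the origin applies; if some argument is 0, the form vanishes. *)
Lemma multi_continuous_bounded k (b : ('I_k -> E) -> F) : multilinear b ->
  multi_continuous nE nF b ->
  exists C, 0 <= C /\ forall v, nF (b v) <= C * \prod_(i < k) nE (v i).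
Proof.
move=> lb cb; have [d d0 db] := cb (fun=> 0) 1 ltr01.
have [c /[dup] c01 /andP[c0 c1]] := exists_small_scalar K.
(* For [k = 0] the form is a constant, which need not vanish at the origin. *)
pose D := Num.max 1 ⟦b (fun=> 0)⟧.
have D0 : 0 <= D by rewrite le_max ler01.
have small w : (forall i, ⟦w i⟧ < d) -> ⟦b w⟧ <= D.
  move=> wd; rewrite -(subrK (b (fun=> 0)) (b w)) norm_add_le ?le_max ?lexx ?orbT//.
  by rewrite ltW// db// => i; rewrite subr0.
have dc0 : 0 < d * uf_abs c by rewrite mulr_gt0.
have C0 : 0 <= D * (d * uf_abs c) ^- k.
  by rewrite mulr_ge0// invr_ge0 exprn_ge0// ltW.
exists (D * (d * uf_abs c) ^- k); split => //.
move=> v; have [/existsP[i /eqP vi]|] := boolP [exists i, v i == 0].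
  have -> : b v = 0.
    by rewrite -(subst_arg_id v i) vi; exact: lin0 (lb v i).
  by rewrite norm0 mulr_ge0// prodr_ge0// => j _; exact: norm_ge0.
rewrite negb_exists => /forallP v0.
have /choice[l lP] i : exists l : K, l != 0 /\ uf_abs c <= uf_abs l * (⟦v i⟧ / d) < 1.
  have [|l l0 h] := rescale (t := ⟦v i⟧ / d) c01; last by exists l.
  by rewrite divr_gt0// norm_gt0//; exact/eqP/v0.
have := small (fun i => l i *: v i); rewrite multilinear_scale// normZ => h.
have prod_abs : uf_abs (\prod_(i < k) l i) = \prod_(i < k) uf_abs (l i).
  by apply: (big_morph (@uf_abs R K)) => [x y|]; rewrite ?absM ?abs1.
have pl0 : 0 < \prod_(i < k) uf_abs (l i).
  by apply: prodr_gt0 => i _; apply: abs_gt0; exact: (lP i).1.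
have ld i : ⟦l i *: v i⟧ < d.
  by have [_ /andP[_]] := lP i; rewrite normZ mulrA ltr_pdivrMr// mul1r.
have {h} := h ld; rewrite prod_abs -ler_pdivlMl// => /le_trans; apply.
rewrite mulrC -mulrA ler_wpM2l// -[leLHS]mul1r ler_pdivrMr// -mulrA.
rewrite ler_pdivlMl ?exprn_gt0// mulr1 -big_split/= -[k in _ ^+ k]card_ord -prodr_const.
apply: ler_prod => i _; rewrite (ltW dc0)/=.
have [_ /andP[+ _]] := lP i; rewrite mulrA ler_pdivlMr// mulrC => /le_trans; apply.
by rewrite mulrC.
Qed.

(** The empty set is covered by the convention [inf set0 = 0]. *)
Lemma inf_ge0 (A : set R) : (forall x, A x -> 0 <= x) -> 0 <= inf A.
Proof.
move=> A0; have [->|/set0P Ane] := eqVneq A set0; first by rewrite inf0.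
exact: lb_le_inf.
Qed.

Lemma multi_norm_ge0 k (b : ('I_k -> E) -> F) : 0 <= multi_norm nE nF b.
Proof. by apply: inf_ge0 => x []. Qed.

Lemma poly_norm_ge0 k p : 0 <= poly_norm nE nF k p.
Proof. by apply: inf_ge0 => _ [b _ <-]; exact: multi_norm_ge0. Qed.

(** The [+ 1] absorbs two infima that need not be attained, one over the forms and one over their
    constants, each approximated to within 1/2. *)
Lemma hom_poly_form k p : hom_poly nE nF k p -> exists b : ('I_k -> E) -> F,
  poly_form nE nF p b /\
  forall v, nF (b v) <= (poly_norm nE nF k p + 1) * \prod_(i < k) nE (v i).
Proof.
move=> [b0 pb0]; have h2 : (0 : R) < 2^-1 by lra.
have [|_ [b pb <-] bn] := @inf_adherent R
    [set multi_norm nE nF b | b in [set b : ('I_k -> E) -> F | poly_form nE nF p b]] _ h2.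
  split; first by exists (multi_norm nE nF b0), b0.
  by exists 0 => _ [b _ <-]; exact: multi_norm_ge0.
have [lb cb _] := pb.
have [|C [C0 CP] Cn] := @inf_adherent R
    [set C : R | 0 <= C /\ forall v, nF (b v) <= C * \prod_(i < k) nE (v i)] _ h2.
  split; first exact: multi_continuous_bounded.
  by exists 0 => C [].
exists b; split=> // v; rewrite (le_trans (CP v))// ler_wpM2r//.
  by apply: prodr_ge0 => i _; exact: norm_ge0.
by rewrite /multi_norm in bn; rewrite /poly_norm; lra.
Qed.

Lemma nth_subst_arg (s t : seq E) k x : (size s + (size t).+1)%N = k ->
  forall i : 'I_k, size s = i :> nat ->
  (fun j : 'I_k => nth 0 (s ++ x :: t) j) =
  subst_arg (fun j : 'I_k => nth 0 (s ++ 0 :: t) j) i x.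
Proof.
move=> kst i si; apply/funext => j; rewrite /subst_arg; case: eqP => [->|/eqP ji].
  by rewrite -si nth_cat ltnn subnn.
rewrite !nth_cat; case: ltnP => // sj.
case: (j - size s)%N (subnKC sj) => [|//]; rewrite addn0 si => ij.
by case/eqP: ji; apply/val_inj.
Qed.

Lemma powser_of_forms (bb : forall k, ('I_k -> E) -> F) C M : 0 <= C -> 0 <= M ->
  (forall k, multilinear (bb k)) ->
  (forall k v, nF (bb k v) <= C * M ^+ k * \prod_(i < k) nE (v i)) ->
  exists2 b, powser b C M & forall k y, b (nseq k y) = bb k (fun=> y).
Proof.
(* The degree is an argument of [G] separate from the list, so that [size] can be rewritten without
   disturbing the type ['I_k]. *)
move=> C0 M0 lb bC; pose G k (s : seq E) := bb k (fun i : 'I_k => nth 0 s i).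
exists (fun s => G (size s) s); last first.
  move=> k y; rewrite size_nseq /G; congr (bb k); apply/funext => i.
  by rewrite nth_nseq ltn_ord.
split=> //.
  move=> s t a x y; rewrite !size_cat.
  have [k kE] : exists k, (size s + (size t).+1)%N = k by eexists.
  have sk : (size s < k)%N by rewrite -kE addnS ltnS leq_addr.
  have Gz z : G k (s ++ z :: t) =
      bb k (subst_arg (fun j : 'I_k => nth 0 (s ++ 0 :: t) j) (Ordinal sk) z).
    by congr (bb k); exact: nth_subst_arg.
  by rewrite [size (_ :: _)]/= [size (x :: _)]/= [size (y :: _)]/= kE !Gz lb.
move=> s; rewrite (le_trans (bC _ _))//.
have -> : \prod_(x <- s) (M * ⟦x⟧) = M ^+ size s * \prod_(i < size s) ⟦nth 0 s i⟧.
  rewrite (big_nth 0) big_mkord big_split/= prodr_const card_ord; congr (_ * _).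
by rewrite mulrA.
Qed.

Lemma form_of_powser b C M k : powser b C M ->
  poly_form nE nF (fun y => b (nseq k y)) (fun v : 'I_k -> E => b [seq v i | i <- enum 'I_k]) /\
  forall v, nF (b [seq v i | i <- enum 'I_k]) <= C * M ^+ k * \prod_(i < k) nE (v i).
Proof.
move=> Pb; have [lb C0 M0 bC] := Pb.
have prodE (v : 'I_k -> E) : \prod_(x <- [seq v i | i <- enum 'I_k]) (M * ⟦x⟧) =
    M ^+ k * \prod_(i < k) ⟦v i⟧.
  by rewrite big_map big_enum/= big_split/= prodr_const card_ord.
split; last by move=> v; rewrite -mulrA -prodE.
split; last 1 first.
  move=> x; congr b; rewrite -[in LHS](size_enum_ord k).
  by elim: (enum 'I_k) => //= i s ->.
- move=> v i a x y.
  have ek : enum 'I_k = take i (enum 'I_k) ++ i :: drop i.+1 (enum 'I_k).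
    by rewrite -{1}(cat_take_drop i (enum 'I_k)) (drop_nth i) ?size_enum_ord// nth_ord_enum.
  have : uniq (take i (enum 'I_k) ++ i :: drop i.+1 (enum 'I_k)) by rewrite -ek enum_uniq.
  rewrite cat_uniq /= => /and3P[_ /norP[it _] /andP[id _]].
  have sz z : [seq subst_arg v i z j | j <- enum 'I_k] =
      [seq v j | j <- take i (enum 'I_k)] ++ z :: [seq v j | j <- drop i.+1 (enum 'I_k)].
    rewrite {1}ek map_cat /= {2}/subst_arg eqxx; congr (_ ++ _ :: _).
      apply/eq_in_map => j jt; rewrite /subst_arg; case: eqP => // ji.
      by move: it jt; rewrite ji => /negbTE ->.
    apply/eq_in_map => j jt; rewrite /subst_arg; case: eqP => // ji.
    by move: id jt; rewrite ji => /negbTE ->.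
  by rewrite /= !sz lb.
move=> v e e0.
(* [L] bounds the entries of [v] and of every [w] within distance 1 of it, and [Q] bounds the
   Lipschitz constant of the form on such arguments. *)
pose L := 1 + \sum_(i < k) ⟦v i⟧.
have L1 : 1 <= L by rewrite lerDl sumr_ge0// => i _; exact: norm_ge0.
have vL i : ⟦v i⟧ <= L.
  rewrite /L (bigD1 i)//= addrCA lerDl addr_ge0 ?ler01// sumr_ge0// => j _; exact: norm_ge0.
have L0 : 0 < L by lra.
pose Q := C * (M * L) ^+ k + 1.
have Q0 : 0 <= C * (M * L) ^+ k by rewrite mulr_ge0// exprn_ge0// mulr_ge0// ltW.
have Q1 : 0 < Q by rewrite /Q; lra.
pose d := Num.min 1 (e / Q).
have d0 : 0 < d by rewrite lt_min ltr01 divr_gt0.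
have d1 : d <= 1 by rewrite ge_min lexx.
have dQ : d * Q <= e by rewrite -ler_pdivlMr// ge_min lexx orbT.
exists d => // w wv.
have wL i : ⟦w i⟧ <= L.
  rewrite -(subrK (v i) (w i)) norm_add_le// (le_trans (ltW (wv i)))//; lra.
(* [powser_diff] gives a weak inequality; replacing [d] by the largest distance [d'], which is below
   [d], makes the final one strict. *)
have ds : {d' : R | 0 <= d' < d & forall i, ⟦w i - v i⟧ <= d'}.
  exists (\big[Num.max/0]_(i < k) ⟦w i - v i⟧).
    apply/andP; split; first by rewrite bigmax_ge_id.
    by apply/bigmax_ltP; split.
  by move=> i; exact: le_bigmax.
case: ds => d' /andP[d'0 d'd] wd'.
apply: le_lt_trans (powser_diff (L := L) (d := d' / L) Pb (ltW L0) _ _ _ _ _) _.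
- by rewrite !size_map.
- by move=> _ /mapP[i _ ->].
- by move=> _ /mapP[i _ ->].
- move=> x y; rewrite zip_map => /mapP[i _ [-> ->]].
  by rewrite divfK// lt0r_neq0.
- by rewrite divr_ge0// ltW.
rewrite size_map size_enum_ord; apply: lt_le_trans dQ.
apply: (@le_lt_trans _ _ (C * (M * L) ^+ k * d')).
  by rewrite ler_wpM2l// ler_pdivrMr// ler_peMr.
rewrite mulrC; apply: (@le_lt_trans _ _ (d' * Q)); first by rewrite ler_wpM2l// /Q; lra.
by rewrite ltr_pM2r.
Qed.

(** A radius q at which the products of the polynomial norms with q^k tend to 0 bounds the
    coefficients by D q^-k. Conversely, coefficients bounded by C M^k have a radius of convergence
    of at least 1/(M + 1). *)
Lemma analytic_onP (U : set E) (g : E -> F) : analytic_on nE nF U g <->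
  norm_open nE U /\ forall x, U x -> analytic_at g x.
Proof.
split=> [aU|[oU aU] x Ux].
  split=> x /aU[p [hp cr] [r [r0 rcr rU gr]]]; first by exists r.
  have [_ [q [q0 qcv] <-] qpos] : exists2 y : \bar R,
      [set r%:E | r in [set r : R | 0 <= r /\
      (fun k => poly_norm nE nF k (p k) * r ^+ k) @ \oo --> (0 : R)]] y & (0 < y)%E.
    by have [y] := ereal_sup_gt cr; exists y.
  rewrite lte_fin in qpos.
  have [D D0 Dp] : exists2 D : R, 0 <= D & forall k, poly_norm nE nF k (p k) * q ^+ k <= D.
    have /cvgrPdist_lt /(_ 1 ltr01) [N _ HN] := qcv.
    pose a k := poly_norm nE nF k (p k) * q ^+ k.
    have a0 k : 0 <= a k by rewrite mulr_ge0 ?poly_norm_ge0 ?exprn_ge0.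
    exists (1 + \sum_(k < N) a k); first by rewrite addr_ge0 ?ler01 ?sumr_ge0.
    move=> k; have [Nk|kN] := leqP N k.
      have := HN k Nk; rewrite /= sub0r normrN ger0_norm ?a0// => /ltW h.
      by rewrite (le_trans h)// lerDl sumr_ge0.
    rewrite (bigD1 (Ordinal kN))//= addrCA lerDl addr_ge0 ?ler01// sumr_ge0//.
  pose bb k := projT1 (cid (hom_poly_form (hp k))).
  have bbP k : poly_form nE nF (p k) (bb k) /\
      forall v, nF (bb k v) <= (poly_norm nE nF k (p k) + 1) * \prod_(i < k) nE (v i).
    exact: projT2 (cid (hom_poly_form (hp k))).
  (* [hom_poly_form] adds 1 to the polynomial norm; since [q^-1 + 1] is at least 1, its powers
     absorb this. *)
  have qi : 0 <= q^-1 by rewrite invr_ge0.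
  have ltq : 1 <= q^-1 + 1 by rewrite lerDr.
  have [|||k v|b Pb bE] := @powser_of_forms bb (D + 1) (q^-1 + 1).
  - by rewrite addr_ge0.
  - by rewrite addr_ge0.
  - by move=> k; have [[]] := bbP k.
  - apply: le_trans ((bbP k).2 v) _; rewrite ler_wpM2r//.
      by apply: prodr_ge0 => i _; exact: norm_ge0.
    rewrite mulrDl mul1r lerD// ?exprn_ege1//.
    have := Dp k; rewrite -ler_pdivlMr ?exprn_gt0// => /le_trans; apply.
    by rewrite ler_wpM2l// -exprVn lerXn2r ?nnegrE ?addr_ge0// lerDl.
  exists b, (D + 1), (q^-1 + 1), r; split=> // y yr.
  have /ulimP := gr y yr; apply: ulim_ext => m; apply: eq_bigr => k _.
  by have [[_ _ ->] _] := bbP k; rewrite bE.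
have [b [C [M [r [Pb r0 bg]]]]] := aU x Ux; have [_ C0 M0 _] := Pb.
have [r' r'0 r'U] := oU x Ux.
pose q := (M + 1)^-1; have q0 : 0 < q by rewrite invr_gt0; lra.
have Mq : M * q < 1 by rewrite ltr_pdivrMr; lra.
have qcr : (q%:E <= conv_radius nE nF (fun k y => b (nseq k y)))%E.
  apply: ereal_sup_ubound; exists q => //; split; first exact: ltW.
  apply: (@squeeze_cvgr _ _ _ _ (fun=> 0) (fun k => C * (M * q) ^+ k)).
  - near=> k; have qk : 0 <= q ^+ k by rewrite exprn_ge0// ltW.
    rewrite mulr_ge0 ?poly_norm_ge0//= exprMn mulrA ler_wpM2r//.
    have [pf pC] := form_of_powser k Pb.
    apply: (@le_trans _ _ (multi_norm nE nF (fun v : 'I_k -> E => b [seq v i | i <- enum 'I_k]))).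
      apply: ge_inf; first by exists 0 => _ [? _ <-]; exact: multi_norm_ge0.
      by exists (fun v : 'I_k -> E => b [seq v i | i <- enum 'I_k]).
    apply: ge_inf; first by exists 0 => ? [].
    by split=> //; rewrite mulr_ge0 ?exprn_ge0.
  - exact: cvg_cst.
  - rewrite -(mulr0 C); apply: cvgMr; apply: cvg_expr.
    by rewrite ger0_norm// mulr_ge0// ltW.
exists (fun k y => b (nseq k y)).
  split; last by apply: lt_le_trans qcr; rewrite lte_fin.
  move=> k; exists (fun v : 'I_k -> E => b [seq v i | i <- enum 'I_k]).
  exact: (form_of_powser k Pb).1.
exists (Num.min r (Num.min r' q)); split.
- by rewrite !lt_min r0 r'0.
- by apply: le_trans qcr; rewrite lee_fin !ge_min lexx !orbT.
- move=> y; rewrite /norm_ball/= !lt_min => /and3P[_ yr' _]; exact: r'U.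
- by move=> y; rewrite !lt_min => /and3P[yr _ _]; apply/ulimP/bg.
Unshelve. all: by end_near.
Qed.

End MultilinearForms.

Section Composition.
Variables (R : realType) (K : ultraField R) (E F G : ultraBanach K).
Implicit Types (u : seq E -> F) (b : seq F -> G) (s : seq E).

(* [comp_blocks u m b s] sums [b [:: u s1; ...; u sm]] over the decompositions of
   [s] into [m] nonempty consecutive blocks; [comp_series] is thus the power
   series of the composition, [u [::]] being the base point. *)
Fixpoint comp_blocks u (m : nat) b s : G :=
  if m is m'.+1 then \sum_(0 <= i < size s)
    comp_blocks u m' (fun t => b (u (take i.+1 s) :: t)) (drop i.+1 s)
  else if s is [::] then b [::] else 0.

Definition comp_series u b s : G := \sum_(m < (size s).+1) comp_blocks u m b s.

Lemma comp_blocksS u m b s : comp_blocks u m.+1 b s = \sum_(0 <= i < size s)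
  comp_blocks u m (fun t => b (u (take i.+1 s) :: t)) (drop i.+1 s).
Proof. by []. Qed.

Lemma comp_blocks_lin u m k b b' s :
  comp_blocks u m (fun t => k *: b t + b' t) s =
  k *: comp_blocks u m b s + comp_blocks u m b' s.
Proof.
elim: m b b' s => [|m IH] b b' s /=; first by case: s => [|*]//; rewrite scaler0 addr0.
by rewrite scaler_sumr -big_split; apply: eq_bigr => i _; rewrite IH.
Qed.

Lemma take_cat_le (T : Type) n (s t : seq T) x : (n.+1 <= size s)%N ->
  take n.+1 (s ++ x :: t) = take n.+1 s /\
  drop n.+1 (s ++ x :: t) = drop n.+1 s ++ x :: t.
Proof.
move=> ns; split; first by rewrite takel_cat.
rewrite drop_cat; case: ltnP => // sn.
have -> : n.+1 = size s by apply/eqP; rewrite eqn_leq ns.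
by rewrite subnn drop0 drop_size.
Qed.

Lemma take_cat_gt (T : Type) n (s t : seq T) x : (size s <= n)%N ->
  take n.+1 (s ++ x :: t) = s ++ x :: take (n - size s) t /\
  drop n.+1 (s ++ x :: t) = drop (n - size s) t.
Proof. by move=> sn; rewrite take_cat drop_cat ltnNge leqW//= subSn. Qed.

(** The varied entry lies either beyond the first block, where induction applies, or inside it,
    where [u] and the first slot of [b] are linear. *)
Lemma comp_blocks_mlin u m b : mlin u -> mlin b -> mlin (comp_blocks u m b).
Proof.
move=> lu; elim: m b => [|m IH] b lb s t k x y /=.
  by case: s => [|? ?]; rewrite scaler0 addr0.
rewrite !size_cat/= scaler_sumr -big_split /= !big_mkord; apply: eq_bigr => -[i ilt] _ /=.
have [si|si] := leqP i.+1 (size s).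
  have tc z := take_cat_le t z si.
  by rewrite !(tc _).1 !(tc _).2 IH//; exact: mlin_cons.
have tc z := take_cat_gt t z si.
rewrite !(tc _).1 !(tc _).2 -comp_blocks_lin; congr (comp_blocks u m _ _).
by apply/funext => v; rewrite lu (mlin_head v lb).
Qed.

(** The number of decompositions of [s] does not enter, since a sum is bounded by its largest term.
    Each of the [m] blocks contributes a factor [M * A]. *)
Lemma comp_blocks_bound u m b s A B C M : powser u A B -> powser b C M ->
  ⟦comp_blocks u m b s⟧ <= C * (M * A) ^+ m * \prod_(x <- s) (B * ⟦x⟧).
Proof.
move=> [_ A0 B0 uA]; elim: m b C s => [|m IH] b C s Pb /=; have [_ C0 M0 bC] := Pb.
  rewrite mulr1; case: s => [|x s]; last by rewrite norm0 mulr_ge0// prod_ge0.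
  by rewrite big_nil; have := bC [::]; rewrite big_nil.
apply: norm_sum_le => [|i _].
  by rewrite mulr_ge0 ?prod_ge0// mulr_ge0// exprn_ge0// mulr_ge0.
rewrite (le_trans (IH _ _ _ (powser_cons _ Pb)))//.
rewrite -[in leRHS](cat_take_drop i.+1 s) big_cat/= exprS.
set P := \prod_(x <- take _ _) _; set D := \prod_(x <- drop _ _) _.
have -> : C * (M * A * (M * A) ^+ m) * (P * D) = C * (M * (A * P)) * (M * A) ^+ m * D by ring.
rewrite ler_wpM2r ?prod_ge0// ler_wpM2r ?exprn_ge0 ?mulr_ge0// ler_wpM2l// ler_wpM2l//.
Qed.

Lemma comp_blocks_gt u m b s : (size s < m)%N -> comp_blocks u m b s = 0.
Proof.
elim: m b s => [|m IH] b s //= sm; rewrite big_nat big1// => i /andP[_ si].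
by rewrite IH// size_drop; lia.
Qed.

Lemma comp_series_mlin u b : mlin u -> mlin b -> mlin (comp_series u b).
Proof.
move=> lu lb s t k x y; rewrite /comp_series !size_cat/= scaler_sumr -big_split/=.
by apply: eq_bigr => i _; exact: comp_blocks_mlin.
Qed.

(** There are at most [size s] nonempty blocks, so [(M * A) ^+ m] is absorbed by
    [(1 + M * A) ^+ size s]. *)
Lemma powser_comp u b A B C M : powser u A B -> powser b C M ->
  powser (comp_series u b) C ((1 + M * A) * B).
Proof.
move=> Pu Pb; have [lu A0 B0 _] := Pu; have [lb C0 M0 _] := Pb.
have MA0 : 0 <= M * A by rewrite mulr_ge0.
split=> //; first 2 last.
- move=> s; apply: norm_sum_le => [|[m ms] _ /=].
    by rewrite mulr_ge0 ?prod_ge0// mulr_ge0//; lra.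
  rewrite (le_trans (comp_blocks_bound m s Pu Pb))//.
  have -> : \prod_(x <- s) ((1 + M * A) * B * ⟦x⟧) =
      (1 + M * A) ^+ size s * \prod_(x <- s) (B * ⟦x⟧).
    elim: s {ms} => [|x s IH]; first by rewrite !big_nil mulr1.
    by rewrite !big_cons IH /= exprS; ring.
  rewrite mulrA ler_wpM2r ?prod_ge0// ler_wpM2l//.
  apply: (@le_trans _ _ ((1 + M * A) ^+ m)); first by rewrite lerXn2r ?nnegrE//; lra.
  by rewrite ler_weXn2l//; lra.
- exact: comp_series_mlin.
- by rewrite mulr_ge0//; lra.
Qed.

Lemma triangular_sum (V : nmodType) (T : nat -> nat -> V) n :
  \sum_(k < n) \sum_(0 <= i < k) T i (k - i.+1)%N =
  \sum_(i < n) \sum_(j < n - i.+1) T i j.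
Proof.
elim: n => [|n IH]; first by rewrite !big_ord0.
rewrite big_ord_recr/= IH [RHS]big_ord_recr/= subnn (big_ord0 _ _ _ (T n)) addr0.
rewrite big_mkord -big_split/=; apply: eq_bigr => -[i ilt] _ /=.
by rewrite subSS -(subnSK ilt) big_ord_recr.
Qed.

(* The error is bounded uniformly in the number [m] of blocks, which makes it
   possible to exchange the sums over [m] and over the degree. *)
Lemma comp_blocks_eval u m b C M y U (t : R) n : 0 <= t < 1 -> powser b C M ->
  (forall i, M * ⟦u (nseq i.+1 y)⟧ <= t ^+ i.+1) ->
  (forall k, M * ⟦U - \sum_(i < k) u (nseq i.+1 y)⟧ <= t ^+ k) ->
  ⟦b (nseq m U) - \sum_(k < n) comp_blocks u m b (nseq k y)⟧ <= C * t ^+ n.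
Proof.
move=> /andP[t0 t1] Pb ut Ut; elim: m b C n Pb => [|m IH] b C n Pb.
  have [_ C0 M0 bC] := Pb; case: n => [|n].
    by rewrite big_ord0 subr0 mulr1; have := bC [::]; rewrite big_nil mulr1.
  rewrite big_ord_recl/= big1 ?addr0 ?subrr ?norm0; last by [].
  by rewrite mulr_ge0 ?exprn_ge0.
have [lb C0 M0 bC] := Pb.
have tn0 k : 0 <= C * t ^+ k by rewrite mulr_ge0 ?exprn_ge0.
pose bi i (v : seq F) := b (u (nseq i.+1 y) :: v).
have -> : \sum_(k < n) comp_blocks u m.+1 b (nseq k y) =
    \sum_(i < n) \sum_(j < n - i.+1) comp_blocks u m (bi i) (nseq j y).
  rewrite -(triangular_sum (fun i j => comp_blocks u m (bi i) (nseq j y))).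
  apply: eq_bigr => -[k kn] _ /=; rewrite size_nseq; apply: eq_big_nat => i /andP[_ ik].
  have -> : nseq k y = nseq i.+1 y ++ nseq (k - i.+1) y by rewrite -nseqD subnKC.
  by rewrite take_size_cat ?size_nseq// drop_size_cat ?size_nseq.
(* [U] is a partial sum plus a remainder. The remainder, in one slot, costs [t ^+ n]; the term of
   degree [i.+1] costs [t ^+ i.+1] and leaves [n - i.+1] degrees to the induction. *)
rewrite /= -[X in b (X :: _)](subrK (\sum_(i < n) u (nseq i.+1 y))) mlinD_head//.
rewrite (lin_sum n (fun i => u (nseq i.+1 y)) (mlin_head _ lb)) -addrA -sumrB.
apply: norm_add_le.
  rewrite (le_trans (bC _))// big_cons mulrA prod_nseq -[leRHS]mulr1 ler_pM//.
  - by rewrite mulr_ge0// mulr_ge0// norm_ge0.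
  - by rewrite exprn_ge0// mulr_ge0// norm_ge0.
  - by rewrite ler_wpM2l.
  rewrite exprn_ile1 ?mulr_ge0 ?norm_ge0//.
  by have := Ut 0; rewrite big_ord0 subr0.
apply: norm_sum_le => // -[i ilt] _ /=.
have Pbi : powser (bi i) (C * t ^+ i.+1) M.
  by apply: powser_le (powser_cons _ Pb) => //; rewrite ler_wpM2l.
apply: le_trans (IH _ _ (n - i.+1)%N Pbi) _.
by rewrite -mulrA -exprD subnKC.
Qed.

(** The smallness condition makes every error at most C 2^-n, uniformly in the number of blocks, so
    the partial sums of the composed series and those of [b] at [U] have the same limit. *)
Lemma sums_to_comp u b A B C M y U l : powser u A B -> powser b C M ->
  (1 + M * A) * (B * ⟦y⟧) <= 2^-1 -> sums_to u y (u [::] + U) -> sums_to b U l ->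
  sums_to (comp_series u b) y l.
Proof.
move=> Pu Pb ysmall uU bl; have [lu A0 B0 uA] := Pu; have [lb C0 M0 bC] := Pb.
have By0 : 0 <= B * ⟦y⟧ by rewrite mulr_ge0 ?norm_ge0.
have MA0 : 0 <= M * A by rewrite mulr_ge0.
have h2 : 0 <= (2^-1 : R) < 1 by lra.
have By : B * ⟦y⟧ <= 2^-1 by apply: le_trans ysmall; rewrite ler_peMl//; lra.
have MABy : M * A * (B * ⟦y⟧) <= 2^-1.
  by apply: le_trans ysmall; rewrite ler_wpM2r//; lra.
have ut i : M * ⟦u (nseq i.+1 y)⟧ <= 1 * 2^-1 ^+ i.+1.
  rewrite (le_trans (ler_wpM2l M0 (powser_nseq i.+1 y Pu)))// mul1r.
  rewrite [_ ^+ i.+1 in leLHS]exprS [leRHS]exprS !mulrA -[in leLHS](mulrA (M * A)).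
  apply: ler_pM => //; first by rewrite mulr_ge0.
    by rewrite exprn_ge0.
  by rewrite lerXn2r ?nnegrE//; lra.
have uU' : ulim (fun k => \sum_(i < k) u (nseq i.+1 y)) U.
  have /(iffLR (ulim_shift 1 _ _)) /ulimB /(_ (ulim_cst (u [::]))) := uU.
  rewrite addrC addKr; apply: ulim_ext => k.
  by rewrite addn1 big_ord_recl/= addrC addKr.
have Ut k : M * ⟦U - \sum_(i < k) u (nseq i.+1 y)⟧ <= 2^-1 ^+ k.
  have [->|M1] := eqVneq M 0; first by rewrite mul0r exprn_ge0//; lra.
  have Mp : 0 < M by rewrite lt_neqAle eq_sym M1.
  have vt i : ⟦u (nseq i.+1 y)⟧ <= M^-1 * 2^-1 ^+ i.
    rewrite ler_pdivlMl// (le_trans (ut i))// mul1r exprS ler_piMl ?exprn_ge0//; lra.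
  have [l' [/(ulim_unique uU') <- h]] := geometric_series_cvg h2 vt.
  by rewrite -ler_pdivlMl.
apply: (ulim_squeeze (C := C) h2 bl) => n; rewrite norm_distC.
(* In degree [k < n] there are at most [k] blocks, so the sum over [m] may run up to [n] in every
   degree. *)
have -> : \sum_(k < n) comp_series u b (nseq k y) =
    \sum_(m < n) \sum_(k < n) comp_blocks u m b (nseq k y).
  rewrite exchange_big/=; apply: eq_bigr => -[k kn] _ /=.
  rewrite /comp_series size_nseq -[in RHS](subnKC kn) [RHS]big_split_ord.
  rewrite [X in _ = _ + X]big1 ?addr0// => i _.
  by rewrite comp_blocks_gt// size_nseq ltn_addr.
rewrite -sumrB; apply: norm_sum_le => [|i _].
  by rewrite mulr_ge0// exprn_ge0//; lra.
apply: (comp_blocks_eval i n h2 Pb _ Ut) => i'; by rewrite -[leRHS]mul1r.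
Qed.

Lemma analytic_at_comp (g : E -> F) (h : F -> G) x :
  analytic_at g x -> analytic_at h (g x) -> analytic_at (fun z => h (g z)) x.
Proof.
move=> [u [A [B [r [Pu r0 ug]]]]] [b [C [M [r' [Pb r0' bh]]]]].
have [lu A0 B0 uA] := Pu; have [_ C0 M0 _] := Pb.
have gx : g x = u [::].
  by have := ug 0; rewrite norm0 addr0 => /(_ r0) /(sums_to_at0 lu).
have MA0 : 0 <= M * A by rewrite mulr_ge0.
(* The first summand yields the smallness condition of [sums_to_comp], the second keeps the
   increment of [g] below [r'], and 1 makes [N] positive. *)
pose N := 2 * (1 + M * A) * B + A * B / r' + 1.
have N1 : 2 * (1 + M * A) * B + A * B / r' + 1 <= N by [].
have Q0 : 0 <= 2 * (1 + M * A) * B by rewrite !mulr_ge0//; lra.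
have Q1 : 0 <= A * B / r' by rewrite divr_ge0 ?mulr_ge0// ltW.
have N0 : 0 < N by rewrite /N; lra.
exists (comp_series u b), C, ((1 + M * A) * B), (Num.min r N^-1); split.
- exact: powser_comp.
- by rewrite lt_min r0 invr_gt0.
move=> y; rewrite lt_min => /andP[yr yN].
have yN1 : N * ⟦y⟧ < 1 by rewrite mulrC -ltr_pdivlMr// mul1r.
have y0 := norm_ge0 y.
have c1 : 2 * (1 + M * A) * B * ⟦y⟧ <= 1.
  by apply: le_trans (ltW yN1); rewrite ler_wpM2r//; rewrite /N; lra.
have c2 : A * B / r' * ⟦y⟧ < 1.
  by apply: le_lt_trans yN1; rewrite ler_wpM2r//; rewrite /N; lra.
have By0 : 0 <= B * ⟦y⟧ by rewrite mulr_ge0.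
have MABy := mulr_ge0 MA0 By0.
have By1 : B * ⟦y⟧ <= 1 by lra.
have ug' := ug y yr.
have -> : g (x + y) = g x + (g (x + y) - g x) by rewrite addrCA subrr addr0.
apply: (sums_to_comp Pu Pb (U := g (x + y) - g x)).
- lra.
- by rewrite -gx addrCA subrr addr0.
apply: bh; have ABy : A * (B * ⟦y⟧) < r'.
  by move: c2; rewrite mulrAC ltr_pdivrMr// mul1r -mulrA.
apply: le_lt_trans ABy; apply: (ulim_le (N := 1)) ug' _ => -[//|m] _.
rewrite gx big_ord_recl/= addrC addKr; apply: norm_sum_le => [|i _].
  by rewrite !mulr_ge0.
rewrite (le_trans (powser_nseq (lift ord0 i) y Pu))// ler_wpM2l//.
by rewrite exprS ler_piMr// exprn_ile1.
Qed.

End Composition.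

Section Lipschitz.
Variables (R : realType) (K : ultraField R) (E F : ultraBanach K).

(** On the ball of radius [L] with [M * L <= 1], a term of degree at least 2 has Lipschitz constant
    at most [C * M ^+ 2 * L]; a small [L] makes this at most [e]. *)
Lemma powser_lipschitz (h : seq E -> F) C M (e : R) : powser h C M -> 0 < e ->
  (forall s, (size s < 2)%N -> h s = 0) ->
  exists2 r, 0 < r & forall x y l l', ⟦x⟧ <= r -> ⟦y⟧ <= r ->
    sums_to h x l -> sums_to h y l' -> ⟦l - l'⟧ <= e * ⟦x - y⟧.
Proof.
move=> Ph e0 h2; have [_ C0 M0 _] := Ph.
pose L := (M + C * M ^+ 2 / e + 1)^-1.
have CM0 : 0 <= C * M ^+ 2 / e by rewrite divr_ge0 ?mulr_ge0 ?exprn_ge0// ltW.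
have D0 : 0 < M + C * M ^+ 2 / e + 1 by lra.
have L0 : 0 < L by rewrite invr_gt0.
have ML : M * L <= 1 by rewrite /L ler_pdivrMr//; lra.
have CL : C * M ^+ 2 * L <= e.
  rewrite /L ler_pdivrMr// mulrDr mulrDr -[leLHS](mulfVK (lt0r_neq0 e0)) mulrC mulr1.
  by have := mulr_ge0 (ltW e0) M0; lra.
exists L => // x y l l' xL yL hx hy.
apply: (ulim_le0 (ulimB hx hy)) => n; rewrite -sumrB.
have d0 : 0 <= ⟦x - y⟧ / L by rewrite divr_ge0 ?norm_ge0// ltW.
apply: norm_sum_le => [|[k kn] _ /=]; first by rewrite mulr_ge0 ?norm_ge0// ltW.
case: k kn => [|[|k]] _; try by rewrite !h2// subrr norm0 mulr_ge0 ?norm_ge0// ltW.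
have inn j (z w : E) : z \in nseq j w -> z = w by rewrite mem_nseq => /andP[_ /eqP].
apply: le_trans (powser_diff (L := L) (d := ⟦x - y⟧ / L) Ph (ltW L0) _ _ _ _ _) _ => //.
- by rewrite !size_nseq.
- by move=> z /inn ->.
- by move=> z /inn ->.
- have zipn j : zip (nseq j x) (nseq j y) = nseq j (x, y).
    by elim: j => //= j ->.
  move=> z w; rewrite zipn mem_nseq => /andP[_ /eqP[-> ->]].
  by rewrite divfK// lt0r_neq0.
rewrite size_nseq 2!exprS; set t := (M * L) ^+ k.
have -> : C * (M * L * (M * L * t)) * (⟦x - y⟧ / L) = C * M ^+ 2 * L * t * ⟦x - y⟧.
  by field; rewrite lt0r_neq0.
rewrite ler_wpM2r ?norm_ge0// -[e]mulr1 ler_pM// ?exprn_ge0 ?exprn_ile1 ?mulr_ge0//; exact: ltW.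
Qed.

End Lipschitz.

(** * Inversion and re-expansion *)

Section InverseSeries.
Variables (R : realType) (K : ultraField R) (E : ultraBanach K).
Implicit Types (u h b : seq E -> E) (s : seq E).

Lemma comp_blocks_eq u u' m b s :
  (forall t, (size t <= size s)%N -> u t = u' t) ->
  comp_blocks u m b s = comp_blocks u' m b s.
Proof.
elim: m b s => [//|m IH] b s uu' /=; apply: eq_big_nat => i /andP[_ si].
rewrite IH => [|t]; last by rewrite size_drop => ts; apply: uu'; lia.
by rewrite uu'// size_take; case: ifP.
Qed.

Lemma comp_blocks1 u h s : (forall x, h [:: x] = 0) -> comp_blocks u 1 h s = 0.
Proof.
by move=> h1 /=; rewrite big1// => i _; case: drop => [|? ?]; rewrite ?h1.
Qed.

(** Decompositions into one block are killed by the absence of a linear term in [h]; in those with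
    two or more, every block is strictly shorter than [s]. This is what makes the equation for the
    inverse recursive in the degree. *)
Lemma comp_series_eq u u' h s : (forall x, h [:: x] = 0) ->
  (forall t, (size t < size s)%N -> u t = u' t) ->
  comp_series u h s = comp_series u' h s.
Proof.
move=> h1 uu'; apply: eq_bigr => -[[|[|m]] ms] _ //; first by rewrite !comp_blocks1.
rewrite !(comp_blocksS _ m.+1).
apply: eq_big_nat => i /andP[_ si].
have [si1|si1] := ltnP i.+1 (size s); last first.
  by rewrite drop_oversize// !(@comp_blocks_gt _ _ _ _ _ _ m.+1).
rewrite uu'; last by rewrite size_take si1.
by apply: comp_blocks_eq => t; rewrite size_drop => ts; apply: uu'; lia.
Qed.

Definition linear_term s : E := if s is [:: x] then x else 0.

(* Iterates of the equation [u = id + h o u]; the value at [s] only depends on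
   the values at shorter sequences, so it is stationary. *)
Fixpoint solve_iter h n s : E :=
  if n is n'.+1 then linear_term s + comp_series (solve_iter h n') h s else 0.

Definition solve h s := solve_iter h (size s) s.

Lemma solve_iter_stable h n m s : h [::] = 0 -> (forall x, h [:: x] = 0) ->
  (size s <= n)%N -> solve_iter h (n + m) s = solve_iter h n s.
Proof.
move=> h0 h1 sn.
have step k t : (size t <= k)%N -> solve_iter h k.+1 t = solve_iter h k t.
  elim: k t => [|k IH] t tk.
    rewrite leqn0 size_eq0 in tk; rewrite (eqP tk) /=.
    by rewrite /comp_series big_ord_recl big_ord0/= h0 !addr0.
  rewrite [LHS]/= [RHS]/=; congr (_ + _); apply: comp_series_eq => // v vt.
  by apply: IH; lia.
by elim: m => [|m <-]; rewrite ?addn0// addnS step//; lia.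
Qed.

Lemma solveE h s : h [::] = 0 -> (forall x, h [:: x] = 0) ->
  solve h s = linear_term s + comp_series (solve h) h s.
Proof.
move=> h0 h1; rewrite /solve -(solve_iter_stable 1 h0 h1 (leqnn (size s))) addn1 /=.
congr (_ + _); apply: comp_series_eq => // t ts; rewrite -/(solve h t) /solve.
by rewrite -(subnKC (ltnW ts)) solve_iter_stable.
Qed.

(** With [A * B = 1] the bound in degree 1 is exactly the norm; this later yields a solution whose
    norm is at most that of its datum. *)
Lemma powser_linear_term A B : 0 < A -> A * B = 1 -> powser linear_term A B.
Proof.
move=> A0 AB; have B0 : 0 < B by rewrite -(pmulr_rgt0 _ A0) AB.
have [l1 _ _ b1] := powser_lin (blin_id E); split; [exact: l1|exact: ltW|exact: ltW|].
have z s : 0 <= A * \prod_(x <- s) (B * ⟦x : E⟧).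
  by rewrite mulr_ge0 ?prod_ge0// ltW.
case=> [|x [|y s]]; [rewrite /= norm0; exact: z| |rewrite /= norm0; exact: z].
by rewrite big_cons big_nil mulr1 mulrA AB mul1r.
Qed.

Lemma powser_solve h C M : powser h C M -> h [::] = 0 -> (forall x, h [:: x] = 0) ->
  exists A B, [/\ A * B = 1, 0 < A & powser (solve h) A B].
Proof.
move=> Ph h0 h1; have [lh C0 M0 hC] := Ph.
have CM0 : 0 <= C * M ^+ 2 by rewrite mulr_ge0 ?exprn_ge0.
(* [M / B] and [C * M ^+ 2 / B] are at most 1, so a term with at least two blocks is again bounded
   with the constant [B^-1]: the bound passes unchanged from one iterate to the next. *)
pose B := 1 + M + C * M ^+ 2; have B0 : 0 < B by rewrite /B; lra.
have A0 : 0 < B^-1 by rewrite invr_gt0.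
have AB : B^-1 * B = 1 by rewrite mulVf ?lt0r_neq0.
have MA : M * B^-1 <= 1 by rewrite ler_pdivrMr// /B; lra.
have CA : C * M ^+ 2 * B^-1 <= 1 by rewrite ler_pdivrMr// /B; lra.
have Pn n : powser (solve_iter h n) B^-1 B.
  elim: n => [|n IH] /=.
    split; [|exact: ltW|exact: ltW|].
      by move=> *; rewrite scaler0 addr0.
    by move=> s; rewrite norm0 mulr_ge0 ?prod_ge0 ?ltW.
  have [l1 _ _ b1] := powser_linear_term A0 AB; have [ln _ _ bn] := IH.
  split; [|exact: ltW|exact: ltW|].
    by move=> s t k x y; rewrite l1 comp_series_mlin// scalerDr addrACA.
  move=> s; apply: norm_add_le => //; apply: norm_sum_le => [|i _].
    by rewrite mulr_ge0 ?prod_ge0 ?ltW.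
  case: {i}(nat_of_ord i) => [|[|m]].
  - by rewrite [comp_blocks _ _ _ _]/=; case: s => [|? ?]; rewrite ?h0 norm0 mulr_ge0 ?prod_ge0 ?ltW.
  - by rewrite (comp_blocks1 _ s h1) norm0 mulr_ge0 ?prod_ge0 ?ltW.
  apply: le_trans (comp_blocks_bound m.+2 s IH Ph) _.
  rewrite ler_wpM2r ?prod_ge0 ?(ltW B0)// 2!exprS.
  have -> : C * (M / B * (M / B * (M / B) ^+ m)) =
    (C * M ^+ 2 * B^-1) * B^-1 * (M / B) ^+ m by ring.
  have MB0 : 0 <= M / B by rewrite mulr_ge0// ltW.
  rewrite [leLHS]mulrAC ler_piMl ?(ltW A0)// mulr_ile1 ?exprn_ge0 ?exprn_ile1//.
  by rewrite mulr_ge0// ltW.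
exists B^-1, B; split=> //; split; [|exact: ltW|exact: ltW|].
  move=> s t k x y; rewrite /solve !size_cat/=.
  by have [ln _ _ _] := Pn (size s + (size t).+1)%N; rewrite ln.
by move=> s; have [_ _ _] := Pn (size s); exact.
Qed.

Lemma solve0 h : solve h [::] = 0.
Proof. by []. Qed.

Lemma solve1 h x : h [::] = 0 -> (forall x, h [:: x] = 0) -> solve h [:: x] = x.
Proof.
move=> h0 h1; rewrite solveE// /comp_series.
rewrite (sum_recl2 _ (fun m => comp_blocks (solve h) m h [:: x])) comp_blocks1//.
by rewrite big_ord0 !addr0.
Qed.

(** The sum [l] of [solve h] satisfies l = y + h(l). The bound by the norm of [y] keeps [l] where
    the series [h] converges. *)
Lemma inverse_series h C M : powser h C M -> h [::] = 0 -> (forall x, h [:: x] = 0) ->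
  exists r, 0 < r /\ forall y, ⟦y⟧ < r ->
    exists l, [/\ sums_to (solve h) y l, ⟦l⟧ <= ⟦y⟧ & sums_to h l (l - y)].
Proof.
move=> Ph h0 h1; have [A [B [AB A0 Pu]]] := powser_solve Ph h0 h1.
have [lh C0 M0 hC] := Ph.
have B0 : 0 < B by rewrite -(pmulr_rgt0 _ A0) AB.
have MA0 : 0 <= M * A by rewrite mulr_ge0// ltW.
pose N := 2 * (1 + M * A) * B + M + 1.
have MAB0 := mulr_ge0 MA0 (ltW B0).
have N0 : 0 < N by rewrite /N; lra.
exists N^-1; split; first by rewrite invr_gt0.
move=> y yN; have yN1 : N * ⟦y⟧ < 1 by rewrite mulrC -ltr_pdivlMr// mul1r.
have y0 := norm_ge0 y; have By0 := mulr_ge0 (ltW B0) y0.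
have My0 := mulr_ge0 M0 y0; have MABy0 := mulr_ge0 MA0 By0.
have By : B * ⟦y⟧ < 1 by move: yN1; rewrite /N; lra.
have My : M * ⟦y⟧ < 1 by move: yN1; rewrite /N; lra.
have ysmall : (1 + M * A) * (B * ⟦y⟧) <= 2^-1 by move: yN1; rewrite /N; lra.
have [l [ul _]] := powser_sum Pu By; exists l.
have ly : ⟦l⟧ <= ⟦y⟧.
  apply: (ulim_le0 ul) => m; apply: norm_sum_le => // -[[|k] km] _ /=.
    by rewrite norm0.
  rewrite (le_trans (powser_nseq k.+1 y Pu))// exprS 2!mulrA AB mul1r ler_piMr//.
  by rewrite exprn_ile1// ltW.
have [|l2 [hl2 _]] := powser_sum (y := l) Ph.
  by apply: le_lt_trans My; rewrite ler_wpM2l.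
have cl2 : sums_to (comp_series (solve h) h) y l2.
  by apply: (sums_to_comp Pu Ph ysmall _ hl2); rewrite add0r.
have sy : sums_to linear_term y y.
  move=> e e0; exists 2 => -[|[|m]]// _.
  by rewrite (sum_recl2 _ (fun k => linear_term (nseq k y)))/= big1// add0r addr0 subrr norm0.
have : sums_to (solve h) y (y + l2).
  by apply: ulim_ext (sums_toD sy cl2) => m; apply: eq_bigr => i _; rewrite -solveE.
move=> /(sums_to_unique ul) ly2; have -> : l - y = l2 by rewrite ly2 addrAC subrr add0r.
by [].
Qed.

(** With -h the part of degree at least 2 of the series, theta(l) = y reads l = y + h(l), which
    [solve] solves. The difference of identity and [theta] is 1/2-Lipschitz, so [theta] preserves
    norms by the isosceles property, is injective on a small ball, and never leaves it. *)
Lemma local_inverse (theta : E -> E) b C M r0 :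
  powser b C M -> b [::] = 0 -> (forall x, b [:: x] = x) -> 0 < r0 ->
  (forall y, ⟦y⟧ < r0 -> sums_to b y (theta y)) ->
  exists v r, [/\ 0 < r <= r0, analytic_at v 0 &
    forall y, ⟦y⟧ < r -> [/\ ⟦v y⟧ = ⟦y⟧, theta (v y) = y, v (theta y) = y & ⟦theta y⟧ = ⟦y⟧]].
Proof.
move=> Pb b0 b1 r00 bt.
pose h s := - (if (size s < 2)%N then 0 else b s).
have oppb : blin (fun x : E => - x) 1.
  by split=> [k x y||x]; rewrite ?ler01// ?mul1r ?normN// opprD scalerN.
have Ph : powser h (1 * C) M by exact: powser_post (powser_tail 2 Pb) oppb.
have h0 : h [::] = 0 by rewrite /h oppr0.
have h1 x : h [:: x] = 0 by rewrite /h oppr0.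
have hl l : ⟦l⟧ < r0 -> sums_to h l (l - theta l).
  move=> /bt /sums_to_drop2 /(sums_to_post oppb).
  by rewrite b0 b1 subr0 opprB.
have h2 s : (size s < 2)%N -> h s = 0 by rewrite /h => ->; rewrite oppr0.
have [r1 [r10 inv]] := inverse_series Ph h0 h1.
have e0 : (0 : R) < 2^-1 by lra.
have [r2 r20 lip] := powser_lipschitz Ph e0 h2.
have [A [B [AB A0 Pu]]] := powser_solve Ph h0 h1.
have [v an_v vs] := powser_extend 0 Pu.
have B0 : 0 < B by rewrite -(pmulr_rgt0 _ A0) AB.
have Bi0 : 0 < B^-1 by rewrite invr_gt0.
pose r := Num.min (Num.min r0 r1) (Num.min r2 B^-1).
have rlt y : (⟦y⟧ < r) = [&& ⟦y⟧ < r0, ⟦y⟧ < r1, ⟦y⟧ < r2 & ⟦y⟧ < B^-1].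
  by rewrite !lt_min !andbA.
have inj x y : ⟦x⟧ < r -> ⟦y⟧ < r -> ⟦(x - theta x) - (y - theta y)⟧ <= 2^-1 * ⟦x - y⟧.
  rewrite !rlt => /and4P[x0 _ x2 _] /and4P[y0 _ y2 _].
  by apply: lip; rewrite ?ltW//; exact: hl.
have t0 : theta 0 = 0.
  have := bt 0; rewrite norm0 => /(_ r00) /sums_to_at0 -> //; by case: Pb.
exists v, r; split=> //.
  by rewrite /r !lt_min r00 r10 r20 Bi0 !ge_min lexx.
move=> y yr; have := yr; rewrite rlt => /and4P[y0 y1 y2 yB].
have r_gt0 : 0 < r by apply: le_lt_trans yr; exact: norm_ge0.
have nt z : ⟦z⟧ < r -> ⟦theta z⟧ = ⟦z⟧.
  move=> zr; have := inj z 0 zr; rewrite norm0 t0 !subr0 => /(_ r_gt0) h3.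
  have [->|/eqP z0] := eqVneq z 0; first by rewrite t0.
  have z_gt0 := norm_gt0 z0.
  have -> : theta z = z + (- (z - theta z)) by rewrite opprB addrC subrK.
  rewrite norm_add_eql// normN; lra.
have vP z : ⟦z⟧ < r -> [/\ ⟦v z⟧ <= ⟦z⟧ & theta (v z) = z].
  move=> zr; have := zr; rewrite rlt => /and4P[z0 z1 _ zB].
  have [l [ul lz hll]] := inv z z1.
  have -> : v z = l.
    apply: sums_to_unique ul; have := vs z; rewrite add0r; apply.
    by rewrite mulrC -ltr_pdivlMr// mul1r.
  split=> //; have /(sums_to_unique hll) := hl l (le_lt_trans lz z0).
  by move=> /(congr1 (fun w => l - w)); rewrite !opprB ![l + _]addrC !subrK.
have [vy tvy] := vP y yr.
have vyr := le_lt_trans vy yr.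
have tyr : ⟦theta y⟧ < r by rewrite nt.
have [vty tvty] := vP _ tyr.
have vtyr := le_lt_trans vty tyr.
split=> //; [by rewrite -{2}tvy nt | | exact: nt].
apply/eqP; rewrite -subr_eq0; apply/eqP; apply: contrapT => /norm_gt0.
have := inj _ _ vtyr yr; rewrite tvty opprB addrA subrK.
by move=> h3 h4; have : ⟦v (theta y) - y⟧ < ⟦v (theta y) - y⟧; [lra|rewrite ltxx].
Qed.

End InverseSeries.

Section Reexpansion.
Variables (R : realType) (K : ultraField R) (E F : ultraBanach K).
Implicit Types (b : seq E -> F) (s : seq E).

(* Sum of [b t] over the sequences [t] of length [k] that are obtained from [s]
   by inserting copies of [x]. *)
Fixpoint insertions (x : E) b (k : nat) s : F :=
  if k is k'.+1 then insertions x (fun t => b (x :: t)) k' s +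
    (if s is y :: s' then insertions x (fun t => b (y :: t)) k' s' else 0)
  else if s is [::] then b [::] else 0.

Lemma insertions_lin x a b b' k s :
  insertions x (fun t => a *: b t + b' t) k s =
  a *: insertions x b k s + insertions x b' k s.
Proof.
elim: k b b' s => [|k IH] b b' s /=; first by case: s => [|*]//; rewrite scaler0 addr0.
by case: s => [|y s]; rewrite ?addr0 IH// IH scalerDr addrACA.
Qed.

Lemma insertions_mlin x b k : mlin b -> mlin (insertions x b k).
Proof.
elim: k b => [|k IH] b lb s t a y z /=.
  by case: s => [|? ?]; rewrite scaler0 addr0.
rewrite (IH _ (mlin_cons x lb)) scalerDr [RHS]addrACA; congr (_ + _).
case: s => [|w s] /=; last by rewrite IH//; exact: mlin_cons.
rewrite -insertions_lin; congr (insertions x _ k t).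
by apply/funext => v; rewrite (mlin_head v lb).
Qed.

Lemma insertions_gt x b k s : (k < size s)%N -> insertions x b k s = 0.
Proof.
elim: k b s => [|k IH] b [|y s] //= ks.
by rewrite IH ?add0r ?IH//= ltnW.
Qed.

(** A slot filled by [x] contributes at most [M * q]; one filled by an entry y of [s] contributes M
    ⟦y⟧, written as (M q) times (q^-1 ⟦y⟧). *)
Lemma insertions_bound x b C M (q : R) k s : powser b C M -> 0 < q -> ⟦x⟧ <= q ->
  ⟦insertions x b k s⟧ <= C * (M * q) ^+ k * \prod_(y <- s) (q^-1 * ⟦y⟧).
Proof.
move=> Pb q0 xq; elim: k b C s Pb => [|k IH] b C s Pb /=.
  have [_ C0 M0 bC] := Pb; rewrite mulr1; case: s => [|y s].
    by rewrite big_nil; have := bC [::]; rewrite big_nil.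
  by rewrite norm0 mulr_ge0// prod_ge0// invr_ge0 ltW.
have [_ C0 M0 bC] := Pb; have Mq0 : 0 <= M * q by rewrite mulr_ge0// ltW.
have P0 t : 0 <= \prod_(y <- t) (q^-1 * ⟦y : E⟧) by rewrite prod_ge0// invr_ge0 ltW.
apply: norm_add_le.
  rewrite (le_trans (IH _ _ _ (powser_cons x Pb)))// ler_wpM2r// exprS [leRHS]mulrA.
  by rewrite ler_wpM2r ?exprn_ge0// ler_wpM2l// ler_wpM2l.
case: s => [|y s]; first by rewrite norm0 !mulr_ge0 ?exprn_ge0.
rewrite (le_trans (IH _ _ _ (powser_cons y Pb)))// big_cons exprS.
have -> : C * (M * q * (M * q) ^+ k) * (q^-1 * ⟦y⟧ * \prod_(j <- s) (q^-1 * ⟦j⟧)) =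
  C * (M * ⟦y⟧) * (M * q) ^+ k * \prod_(j <- s) (q^-1 * ⟦j⟧).
  by field; rewrite lt0r_neq0.
by [].
Qed.

(** This is the binomial expansion without symmetry: each slot receives [x] or [y], and the terms
    are grouped by the number [j] of slots holding [y]. No binomial coefficients arise. *)
Lemma insertions_binomial x y b k : mlin b ->
  b (nseq k (x + y)) = \sum_(j < k.+1) insertions x b k (nseq j y).
Proof.
elim: k b => [|k IH] b lb; first by rewrite big_ord_recl big_ord0 addr0.
rewrite [LHS]/= mlinD_head//.
rewrite (IH _ (mlin_cons x lb)) (IH _ (mlin_cons y lb)) [in RHS]/=.
rewrite [RHS]big_split/=; congr (_ + _); last by rewrite [RHS]big_ord_recl add0r.
have top : insertions x (fun t => b (x :: t)) k (nseq k.+1 y) = 0.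
  by rewrite insertions_gt// size_nseq.
by rewrite [RHS]big_ord_recr/= -[y :: nseq k y]/(nseq k.+1 y) top addr0.
Qed.

(** Every point of an ultrametric ball is a centre of it, so re-expansion at [x] keeps the radius
    [q]. The new coefficients are infinite sums over the number of inserted [x], and the common
    ratio [M * q] allows the exchange of the two sums. *)
Lemma powser_recenter b C M (q : R) x : powser b C M -> 0 < q -> M * q < 1 ->
  ⟦x⟧ <= q -> exists2 b', powser b' C q^-1 &
    forall y l, ⟦y⟧ <= q -> sums_to b (x + y) l -> sums_to b' y l.
Proof.
move=> Pb q0 Mq xq; have [lb C0 M0 bC] := Pb.
have Mq01 : 0 <= M * q < 1 by rewrite Mq mulr_ge0// ltW.
have P0 t : 0 <= \prod_(y <- t) (q^-1 * ⟦y : E⟧) by rewrite prod_ge0// invr_ge0 ltW.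
have bnd s k : ⟦insertions x b k s⟧ <= (C * \prod_(y <- s) (q^-1 * ⟦y⟧)) * (M * q) ^+ k.
  by rewrite mulrAC insertions_bound.
have /choice[b' b'P] s : exists l, ulim (fun n => \sum_(k < n) insertions x b k s) l /\
    forall n, ⟦l - \sum_(k < n) insertions x b k s⟧ <=
      (C * \prod_(y <- s) (q^-1 * ⟦y⟧)) * (M * q) ^+ n.
  exact: geometric_series_cvg Mq01 (bnd s).
exists b'; first split => //.
- move=> s t a y z; apply: (ulim_unique (b'P _).1).
  apply: ulim_ext (ulimD (ulimZ a (b'P _).1) (b'P _).1) => n.
  rewrite scaler_sumr -big_split/=; apply: eq_bigr => k _.
  by rewrite insertions_mlin.
- by rewrite invr_ge0 ltW.
- move=> s; have := (b'P s).2 0; rewrite big_ord0 subr0 mulr1; exact.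
move=> y l yq bl; apply: (ulim_squeeze (C := C) Mq01 bl) => n.
have -> : \sum_(k < n) b (nseq k (x + y)) =
    \sum_(j < n) \sum_(k < n) insertions x b k (nseq j y).
  rewrite exchange_big/=; apply: eq_bigr => -[k kn] _ /=.
  rewrite insertions_binomial// -[in RHS](subnKC kn) [RHS]big_split_ord.
  rewrite [X in _ = _ + X]big1 ?addr0// => i _.
  by rewrite insertions_gt// size_nseq ltn_addr.
rewrite -sumrB; apply: norm_sum_le => [|[j jn] _ /=].
  by rewrite mulr_ge0// exprn_ge0//; case/andP: Mq01.
apply: le_trans ((b'P _).2 n) _; rewrite ler_wpM2r ?exprn_ge0 //; first by case/andP: Mq01.
rewrite -[leRHS]mulr1 ler_wpM2l// prod_nseq exprn_ile1//.
  by rewrite mulr_ge0 ?norm_ge0// invr_ge0 ltW.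
by rewrite ler_pdivrMl// mulr1.
Qed.

Lemma analytic_at_near (g : E -> F) x : analytic_at g x ->
  exists2 r, 0 < r & forall y, ⟦y⟧ < r -> analytic_at g (x + y).
Proof.
move=> [b [C [M [r [Pb r0 bg]]]]]; have [_ C0 M0 _] := Pb.
pose q := Num.min r (M + 1)^-1.
have q0 : 0 < q by rewrite lt_min r0 invr_gt0; lra.
have Mq : M * q < 1.
  have h : M / (M + 1) < 1 by rewrite ltr_pdivrMr; lra.
  by apply: le_lt_trans h; rewrite ler_wpM2l// ge_min lexx orbT.
have qr : q <= r by rewrite ge_min lexx.
exists q => // y yq; have [b' Pb' b'P] := powser_recenter Pb q0 Mq (ltW yq).
exists b', C, q^-1, q; split=> // z zq.
rewrite -addrA; apply: b'P; first exact: ltW.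
apply: bg; apply: lt_le_trans qr; exact: norm_add_lt.
Qed.

End Reexpansion.

(** * The open mapping theorem *)

Section OpenMapping.
Variables (R : realType) (K : ultraField R) (E F : ultraBanach K).

(** Baire's argument. Otherwise there are nested balls, one for each m, on which the image of the
    ball of radius m is avoided; their common point would have no preimage. *)
Lemma open_mapping_ball (A : E -> F) : (forall y, exists x, A x = y) ->
  exists (m : nat) (y0 : F) (e : R), 0 < e /\ forall y, ⟦y - y0⟧ < e ->
    forall d, 0 < d -> exists2 x, ⟦x⟧ <= m%:R & ⟦A x - y⟧ < d.
Proof.
move=> surjA; apply: contrapT => nex.
have bad (m : nat) (q : F * R) : exists q' : F * R, 0 < q.2 ->
    [/\ 0 < q'.2, q'.2 <= q.2 / 2, ⟦q'.1 - q.1⟧ < q.2 &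
    forall x, ⟦x⟧ <= m%:R -> q'.2 < ⟦A x - q'.1⟧].
  have [q0|q0] := boolP (0 < q.2); last by exists q => h; case/negP: q0.
  apply: contrapT => nbad; apply: nex; exists m, q.1, q.2; split=> // y yq d d0.
  apply: contrapT => nx; apply: nbad; exists (y, Num.min d q.2 / 2) => _.
  have dq : 0 < Num.min d q.2 by rewrite lt_min d0.
  split=> /=; [by rewrite divr_gt0| |by []|].
    by rewrite ler_pM2r// ge_min lexx orbT.
  move=> x xm; rewrite ltNge; apply/negP => h; apply: nx; exists x => //.
  apply: le_lt_trans h _; apply: (@lt_le_trans _ _ (Num.min d q.2)); first lra.
  by rewrite ge_min lexx.
have /choice[step stepP] (mq : nat * (F * R)) := bad mq.1 mq.2.
pose q := fix q (m : nat) : F * R := if m is m'.+1 then step (m', q m') else (0, 1).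
have q0 m : 0 < (q m).2.
  by elim: m => [|m IH] /=; [exact: ltr01|have [] := stepP (m, q m) IH].
have qS m := stepP (m, q m) (q0 m).
have half m : (q m).2 <= 1 * 2^-1 ^+ m.
  elim: m => [|m IH]; first by rewrite mulr1.
  have [_ h _ _] := qS m; rewrite (le_trans h)//= exprS; lra.
have nested m j : ⟦(q (m + j)%N).1 - (q m).1⟧ < (q m).2 /\ (q (m + j)%N).2 <= (q m).2.
  elim: j => [|j [IH1 IH2]]; first by rewrite addn0 subrr norm0.
  have [h0 h1 h2 _] := qS (m + j)%N; rewrite addnS; split.
    by apply: norm_dist_lt IH1; apply: lt_le_trans h2 IH2.
  apply: le_trans h1 _; apply: le_trans IH2; have := q0 (m + j)%N; lra.
have h2 : 0 <= (2^-1 : R) < 1 by lra.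
have [|l] := @ub_complete _ _ F (fun m => (q m).1).
  move=> e e0; have [N HN] := geometric_lt 1 h2 e0; exists N => i j Ni Nj.
  have eN : (q N).2 <= e by rewrite (le_trans (half N))// ltW// HN.
  apply: (@norm_dist_lt _ _ _ (q N).1).
    by rewrite -(subnKC Ni); apply: lt_le_trans eN; exact: (nested _ _).1.
  by rewrite norm_distC -(subnKC Nj); apply: lt_le_trans eN; exact: (nested _ _).1.
move/ulimP => ql; have [x xl] := surjA l.
have [m xm] : exists m : nat, ⟦x⟧ <= m%:R.
  by exists (Num.bound ⟦x⟧); rewrite ltW// archi_boundP// norm_ge0.
have [_ _ _ /(_ x xm)] := qS m; rewrite ltNge => /negP; apply.
rewrite xl; apply: (ulim_le (N := m.+1) ql) => j mj.
by rewrite -(subnKC mj) ltW//; exact: (nested m.+1 _).1.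
Qed.

(** Approximate solutions are corrected successively. Multiplication by a small scalar [c] plays the
    part of halving, and completeness sums the corrections. *)
Lemma open_mapping (A : E -> F) D : blin A D -> (forall y, exists x, A x = y) ->
  exists2 C, 0 < C & forall y, exists2 x, A x = y & ⟦x⟧ <= C * ⟦y⟧.
Proof.
move=> bA surjA; have [lA _ _] := bA.
have [m [y0 [e [e0 dense]]]] := open_mapping_ball surjA.
have [c /[dup] c01 /andP[c0 c1]] := exists_small_scalar K.
have cn0 : c != 0.
  by apply/eqP => h; move: c0; rewrite h; case: (uf_absP K) => _ /(_ 0)[_ ->]//; rewrite ltxx.
have /choice[phi phiP] y : exists x, ⟦y⟧ < e -> ⟦x⟧ <= m%:R /\ ⟦y - A x⟧ < uf_abs c * e.
  have [ye|ye] := boolP (⟦y⟧ < e); last by exists 0.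
  have d0 : 0 < uf_abs c * e by rewrite mulr_gt0.
  have [|x1 x1m x1e] := dense (y0 + y) _ _ d0; first by rewrite addrAC subrr add0r.
  have [|x0 x0m x0e] := dense y0 _ _ d0; first by rewrite subrr norm0.
  (* Subtracting approximate preimages of [y0 + y] and of [y0] moves the centre from [y0] to 0. *)
  exists (x1 - x0) => _; split; first exact: norm_sub_le.
  rewrite linB// norm_distC; have -> : A x1 - A x0 - y = (A x1 - (y0 + y)) - (A x0 - y0).
    by rewrite opprB opprD addrACA -!addrA addNKr [- y + _]addrC.
  exact: norm_sub_lt.
have small y : ⟦y⟧ < e -> exists2 x, A x = y & ⟦x⟧ <= m%:R.
  (* [c ^+ n *: z n] is the error left after [n] corrections; rescaling by [c^-1] keeps [z n] in the
     ball of radius [e], where [phi] applies. *)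
  move=> ye; pose z := fix z n : F := if n is n'.+1 then c^-1 *: (z n' - A (phi (z n'))) else y.
  have ze n : ⟦z n⟧ < e.
    elim: n => [//|n IH] /=; have [_ h] := phiP _ IH.
    by rewrite normZ absV ltr_pdivrMl.
  have xb n : ⟦c ^+ n *: phi (z n)⟧ <= m%:R * uf_abs c ^+ n.
    rewrite normZ absX mulrC ler_wpM2r ?exprn_ge0 ?abs_ge0//.
    exact: (phiP _ (ze n)).1.
  have c01' : 0 <= uf_abs c < 1 by rewrite (ltW c0).
  have [x [xl xb']] := geometric_series_cvg c01' xb.
  exists x; last by have := xb' 0; rewrite big_ord0 subr0 mulr1.
  apply: (ulim_unique (blin_ulim bA xl)) => d d0.
  have [N HN] := geometric_lt e c01' d0; exists N => n /HN; apply: le_lt_trans.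
  have -> : A (\sum_(k < n) c ^+ k *: phi (z k)) - y = - (c ^+ n *: z n).
    rewrite (lin_sum n (fun k => c ^+ k *: phi (z k)) lA).
    elim: n => [|n IH]; first by rewrite big_ord0 sub0r expr0 scale1r.
    rewrite big_ord_recr/= addrAC IH exprSr scalerA -mulrA divff// mulr1 (linZ (L := A))//.
    by rewrite scalerBr opprB addrC.
  by rewrite normN normZ absX mulrC ler_wpM2r ?exprn_ge0 ?abs_ge0// ltW.
have m0 : (0 : R) <= m%:R := ler0n _ m.
have ec : 0 < e * uf_abs c by rewrite mulr_gt0.
exists ((m%:R + 1) / (e * uf_abs c)); first by rewrite divr_gt0// ltr_wpDl.
move=> y; have [->|/eqP y0'] := eqVneq y 0.
  by exists 0; rewrite ?lin0// !norm0 mulr0.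
have [l l0 /andP[cl l1]] := rescale c01 (divr_gt0 (norm_gt0 y0') e0).
have al := abs_gt0 l0.
have [|x xy xm] := small (l *: y); first by rewrite normZ; move: l1; rewrite mulrA ltr_pdivrMr// mul1r.
exists (l^-1 *: x); first by rewrite linZ// xy scalerA mulVf// scale1r.
have h : uf_abs c * e <= uf_abs l * ⟦y⟧ by move: cl; rewrite mulrA ler_pdivlMr.
rewrite normZ absV mulrC ler_pdivrMr// (le_trans xm)//.
rewrite (@le_trans _ _ (m%:R + 1))// ?lerDl// -!mulrA ler_peMr ?addr_ge0//.
by rewrite ler_pdivlMl// mulr1 [leLHS]mulrC [leRHS]mulrC.
Qed.

End OpenMapping.

(** * Complemented subspaces as Banach spaces *)

Section Subspace.
Variables (R : realType) (K : ultraField R) (X : ultraBanach K).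

Section SubspaceModule.
Variables (S : set X) (hS : subspace_set S).

(** The proof of [subspace_set S] is an argument, so that the type built on the predicate determines
    its submodule structure. *)
Definition subspace_pred of subspace_set S : {pred X} := [pred v | `[< S v >]].

Record subspace_type := SubspaceElt {
  subspace_val :> X;
  subspace_valP : subspace_val \in subspace_pred hS }.

HB.instance Definition _ := [isSub for subspace_val].
HB.instance Definition _ := [Choice of subspace_type by <:].

Lemma subspace_submod_closed : submod_closed (subspace_pred hS).
Proof.
case: hS => S0 SL; split=> [|k u v]; first exact/asboolP.
by move=> /asboolP Su /asboolP Sv; apply/asboolP; exact: SL.
Qed.

HB.instance Definition _ :=
  GRing.isSubmodClosed.Build _ _ (subspace_pred hS) subspace_submod_closed.
HB.instance Definition _ := [SubChoice_isSubLmodule of subspace_type by <:].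

Lemma subspace_mem (v : subspace_type) : S v.
Proof. exact/asboolP/(subspace_valP v). Qed.

Definition subspace_norm (v : subspace_type) : R := ⟦subspace_val v⟧.

Lemma subspace_normP : ultrametric_norm subspace_norm.
Proof.
split=> [x|x|k x|x y]; rewrite /subspace_norm.
- exact: norm_ge0.
- split=> [/norm_eq0 x0|->]; last exact: norm0.
  exact: val_inj.
- exact: normZ.
- exact: norm_add.
Qed.

(** The fixed set of a bounded projection is closed: [P] fixes every limit of points of [S]. *)
Lemma subspace_complete (P : X -> X) D : blin P D -> (forall x, S (P x)) ->
  (forall x, S x -> P x = x) -> norm_complete subspace_norm.
Proof.
move=> bP PS PE u cu.
have [l /ulimP ul] := @ub_complete _ _ X (fun n => subspace_val (u n)) cu.
have Sl : S l.
  suff -> : l = P l by [].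
  apply: (ulim_unique ul); apply: ulim_ext (blin_ulim bP ul) => n.
  by rewrite PE//; exact: subspace_mem.
have lP : l \in subspace_pred hS by exact/asboolP.
exists (SubspaceElt lP) => W [e /= e0 eW]; have [N HN] := ul e e0.
by exists N => // n /= Nn; apply: eW; exact: HN.
Qed.

End SubspaceModule.

Lemma subspace_banach (S : set X) (P : X -> X) D : subspace_set S ->
  blin P D -> (forall x, S (P x)) -> (forall x, S x -> P x = x) ->
  exists (F : ultraBanach K) (j : F -> X) (q : X -> F),
  [/\ blin j 1, blin q D, forall v, ⟦j v⟧ = ⟦v⟧, forall x, j (q x) = P x &
      (forall v, S (j v)) /\ (forall v, q (j v) = v)].
Proof.
move=> hS bP PS PE; have [lP D0 PD] := bP.
pose F := UltraBanach (subspace_normP hS) (subspace_complete bP PS PE).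
have qP x : P x \in subspace_pred hS by exact/asboolP.
exists F, (fun v : F => subspace_val (v : subspace_type hS)), (fun x => SubspaceElt (qP x) : F).
split=> //.
- by split=> // v; rewrite mul1r.
- by split=> // k x y; apply: val_inj => /=; rewrite lP.
- split=> [v|v]; first exact: subspace_mem.
  by apply: val_inj; rewrite /= PE//; exact: subspace_mem.
Qed.

End Subspace.

(** * Irwin's method *)

Section WeightedSequences.
Variables (R : realType) (K : ultraField R) (X : ultraBanach K) (a : R).
Hypothesis a0 : 0 < a.

Section Module.

Definition weighted_pred of 0 < a : {pred nat -> X} :=
  [pred z | `[< exists C, forall n, ⟦z n⟧ <= C * a ^+ n >]].

Record weighted := Weighted {
  wval :> nat -> X;
  wvalP : wval \in weighted_pred a0 }.

HB.instance Definition _ := [isSub for wval].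
HB.instance Definition _ := [Choice of weighted by <:].

Lemma weighted_submod_closed : submod_closed (weighted_pred a0).
Proof.
have an n : 0 < a ^+ n by rewrite exprn_gt0.
split=> [|k u v].
  by apply/asboolP; exists 0 => n; rewrite mul0r norm0.
move=> /asboolP[C uC] /asboolP[D vD]; apply/asboolP.
exists (Num.max (uf_abs k * C) D) => n; apply: norm_add_le.
  have /le_trans : ⟦k *: u n⟧ <= uf_abs k * C * a ^+ n.
    by rewrite normZ -mulrA ler_wpM2l ?abs_ge0.
  by apply; rewrite ler_pM2r// le_max lexx.
by apply: le_trans (vD n) _; rewrite ler_pM2r// le_max lexx orbT.
Qed.

HB.instance Definition _ :=
  GRing.isSubmodClosed.Build _ _ (weighted_pred a0) weighted_submod_closed.
HB.instance Definition _ := [SubChoice_isSubLmodule of weighted by <:].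

(** This is the supremum of the quotients of ⟦z n⟧ by a^n. *)
Definition weighted_norm (z : weighted) : R :=
  inf [set C : R | forall n, ⟦z n⟧ <= C * a ^+ n].

Lemma weighted_norm_ub (z : weighted) n : ⟦z n⟧ <= weighted_norm z * a ^+ n.
Proof.
have an : 0 < a ^+ n by rewrite exprn_gt0.
rewrite -ler_pdivrMr//; apply: lb_le_inf; first by have /asboolP := wvalP z.
by move=> C zC; rewrite ler_pdivrMr.
Qed.

Lemma weighted_norm_le (z : weighted) C :
  (forall n, ⟦z n⟧ <= C * a ^+ n) -> weighted_norm z <= C.
Proof.
move=> zC; apply: ge_inf => //; exists 0 => D /(_ 0); rewrite mulr1.
by apply: le_trans; exact: norm_ge0.
Qed.

Lemma weighted_norm_ge0 z : 0 <= weighted_norm z.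
Proof. by have := weighted_norm_ub z 0; rewrite mulr1; apply: le_trans; exact: norm_ge0. Qed.

Lemma weighted_normP : ultrametric_norm weighted_norm.
Proof.
have an n : 0 < a ^+ n by rewrite exprn_gt0.
have nZ k x : weighted_norm (k *: x) <= uf_abs k * weighted_norm x.
  apply: weighted_norm_le => n; have -> : (k *: x) n = k *: x n by [].
  by rewrite normZ -mulrA ler_wpM2l ?abs_ge0// weighted_norm_ub.
split=> [x|x|k x|x y].
- exact: weighted_norm_ge0.
- split=> [x0|->].
    apply: val_inj; apply/funext => n; apply: norm_eq0.
    by apply/eqP; rewrite eq_le norm_ge0 andbT (le_trans (weighted_norm_ub x n))// x0 mul0r.
  apply/eqP; rewrite eq_le weighted_norm_ge0 andbT; apply: weighted_norm_le => n.
  by rewrite mul0r (_ : (0 : weighted) n = 0)// norm0.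
- apply/eqP; rewrite eq_le nZ/=; have [->|k0] := eqVneq k 0.
    by case: (uf_absP K) => _ /(_ 0)[_ ->]// _ _; rewrite mul0r weighted_norm_ge0.
  have := nZ k^-1 (k *: x); rewrite scalerA mulVf// scale1r absV.
  by rewrite ler_pdivlMl// abs_gt0.
- apply: weighted_norm_le => n; rewrite (le_trans (norm_add _ _))// ge_max.
  rewrite (le_trans (weighted_norm_ub x n)) ?ler_pM2r ?le_max ?lexx//=.
  by rewrite (le_trans (weighted_norm_ub y n))// ler_pM2r// le_max lexx orbT.
Qed.

Lemma weighted_complete : norm_complete weighted_norm.
Proof.
have an n : 0 < a ^+ n by rewrite exprn_gt0.
move=> u cu.
have /choice[l lP] n : exists l, ulim (fun i => u i n) l.
  have [e e0|l /ulimP ul] := @ub_complete _ _ X (fun i => u i n); last by exists l.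
  have [N HN] := cu _ (divr_gt0 e0 (an n)); exists N => i j Ni Nj.
  by rewrite (le_lt_trans (weighted_norm_ub (u i - u j) n))// -ltr_pdivlMr// HN.
have lb e : 0 < e -> exists N, forall i, (N <= i)%N -> forall n, ⟦u i n - l n⟧ <= e * a ^+ n.
  move=> e0; have [N HN] := cu e e0; exists N => i Ni n; rewrite norm_distC.
  apply: (ulim_le (N := N) (lP n)) => j Nj.
  apply: le_trans (weighted_norm_ub (u j - u i) n) _.
  by rewrite ler_pM2r// ltW// HN.
have lw : l \in weighted_pred a0.
  apply/asboolP; have [N HN] := lb 1 ltr01.
  exists (Num.max 1 (weighted_norm (u N))) => n.
  rewrite -(subrK (u N n) (l n)); apply: norm_add_le.
    by rewrite norm_distC (le_trans (HN N (leqnn _) n))// ler_pM2r// le_max lexx.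
  by rewrite (le_trans (weighted_norm_ub _ n))// ler_pM2r// le_max lexx orbT.
exists (Weighted lw) => W [e /= e0 eW].
have e2 : 0 < e / 2 by rewrite divr_gt0.
have [N HN] := lb _ e2; exists N => // i /= Ni; apply: eW.
rewrite /norm_ball/=; apply: (@le_lt_trans _ _ (e / 2)); last by rewrite ltr_pdivrMr//; lra.
by apply: weighted_norm_le => n; exact: HN.
Qed.

End Module.

(** These four properties are the interface through which Irwin's method uses the sequence space. *)
Lemma weighted_sequences : exists (S : ultraBanach K) (at_ : nat -> S -> X),
  [/\ forall n, blin (at_ n) (a ^+ n),
      forall z C, (forall n, ⟦at_ n z⟧ <= C * a ^+ n) -> ⟦z⟧ <= C,
      forall z z', (forall n, at_ n z = at_ n z') -> z = z' &
      forall w C, (forall n, ⟦w n⟧ <= C * a ^+ n) -> exists z, forall n, at_ n z = w n].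
Proof.
exists (UltraBanach weighted_normP weighted_complete).
exists (fun n z => (z : weighted) n); split.
- move=> n; split=> // [|z]; first by rewrite exprn_ge0// ltW.
  by rewrite mulrC weighted_norm_ub.
- exact: weighted_norm_le.
- by move=> z z' zz'; apply: val_inj; apply/funext.
- move=> w C wC; have wP : w \in weighted_pred a0 by apply/asboolP; exists C.
  by exists (Weighted wP).
Qed.

End WeightedSequences.

(* [P] projects onto the centre-stable subspace; [beta] is the inverse of [alpha]
   on the unstable subspace, extended by 0 on the centre-stable one. *)
Record splitting (R : realType) (K : ultraField R) (X : ultraBanach K)
    (alpha P beta : X -> X) (a q : R) : Prop := Splitting {
  spl_P : linear P;
  spl_PP : forall x, P (P x) = P x;
  spl_max : forall x, ⟦x⟧ = Num.max ⟦P x⟧ ⟦x - P x⟧;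
  spl_alpha : exists D, blin alpha D;
  spl_comm : forall x, alpha (P x) = P (alpha x);
  spl_stable : forall x, ⟦alpha (P x)⟧ <= a * ⟦P x⟧;
  spl_beta : linear beta;
  spl_Pbeta : forall x, P (beta x) = 0;
  spl_betaP : forall x, beta (P x) = 0;
  spl_alphabeta : forall x, alpha (beta x) = x - P x;
  spl_betaalpha : forall x, beta (alpha x) = x - P x;
  spl_unstable : forall x, ⟦beta x⟧ <= q * ⟦x⟧;
  spl_a : 0 < a <= 1;
  spl_q : 0 <= q;
  spl_aq : a * q < 1 }.

Section Irwin.
Variables (R : realType) (K : ultraField R) (X : ultraBanach K).
Variables (alpha P beta : X -> X) (a q : R).
Hypothesis spl : splitting alpha P beta a q.
Local Notation Q x := (x - P x).

Let a0 : 0 < a. Proof. by case: spl => ? ? ? ? ? ? ? ? ? ? ? ? /andP[]. Qed.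
Let a1 : a <= 1. Proof. by case: spl => ? ? ? ? ? ? ? ? ? ? ? ? /andP[]. Qed.
Let lP := spl_P spl.
Let lA : linear alpha. Proof. by have [D []] := spl_alpha spl. Qed.
Let an0 n : 0 < a ^+ n. Proof. by rewrite exprn_gt0. Qed.
Let an1 n : a ^+ n <= 1. Proof. by rewrite exprn_ile1// ltW. Qed.

Lemma norm_proj x : ⟦P x⟧ <= ⟦x⟧.
Proof. by rewrite [leRHS](spl_max spl) le_max lexx. Qed.

Lemma norm_coproj x : ⟦Q x⟧ <= ⟦x⟧.
Proof. by rewrite [leRHS](spl_max spl) le_max lexx orbT. Qed.

Lemma blin_proj : blin P 1.
Proof. by split=> // x; rewrite mul1r norm_proj. Qed.

Lemma proj_coproj x : P (Q x) = 0.
Proof. by rewrite linB// (spl_PP spl) subrr. Qed.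

Lemma blin_coproj : blin (fun x => Q x) 1.
Proof.
split=> // [k x y|x]; last by rewrite mul1r norm_coproj.
by rewrite lP opprD addrACA scalerBr.
Qed.

Lemma expanding x : ⟦Q x⟧ <= q * ⟦Q (alpha x)⟧.
Proof.
rewrite -(spl_betaalpha spl) (_ : beta (alpha x) = beta (Q (alpha x))).
  exact: (spl_unstable spl).
by rewrite (linB _ _ (spl_beta spl)) (spl_betaP spl) subr0.
Qed.

(** The difference d of two orbits with equal centre-stable components at time 0 starts in the cone
    where the unstable part dominates. It stays there with ⟦Q (d 0)⟧ <= q^n ⟦Q (d n)⟧, while ⟦d n⟧
    <= C a^n; since a q < 1, d 0 vanishes. *)
Lemma cone_escape (f : X -> X) (r : R) (z w : nat -> X) C :
  (forall x y, ⟦x⟧ < r -> ⟦y⟧ < r ->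
    ⟦(f x - alpha x) - (f y - alpha y)⟧ <= a * ⟦x - y⟧) ->
  (forall n, ⟦z n⟧ < r) -> (forall n, ⟦w n⟧ < r) ->
  (forall n, z n.+1 = f (z n)) -> (forall n, w n.+1 = f (w n)) ->
  (forall n, ⟦z n⟧ <= C * a ^+ n) -> (forall n, ⟦w n⟧ <= C * a ^+ n) ->
  P (z 0) = P (w 0) -> z 0 = w 0.
Proof.
move=> lip zr wr zf wf zC wC P0; pose d n := z n - w n.
have dC n : ⟦d n⟧ <= C * a ^+ n by exact: norm_sub_le.
have q0 := spl_q spl.
have step n : ⟦P (d n)⟧ <= ⟦Q (d n)⟧ ->
    ⟦P (d n.+1)⟧ <= ⟦Q (d n.+1)⟧ /\ ⟦Q (d n)⟧ <= q * ⟦Q (d n.+1)⟧.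
  move=> PQ; have dn : ⟦d n⟧ = ⟦Q (d n)⟧ by rewrite (spl_max spl) max_r.
  pose e := (f (z n) - alpha (z n)) - (f (w n) - alpha (w n)).
  have en : ⟦e⟧ <= a * ⟦d n⟧ by apply: lip.
  have dS : d n.+1 = alpha (d n) + e.
    have -> : e = (f (z n) - f (w n)) - (alpha (z n) - alpha (w n)).
      by rewrite /e !opprD !opprK [LHS]addrACA.
    by rewrite /d zf wf (linB _ _ lA) [RHS]addrC subrK.
  have PdS : ⟦P (d n.+1)⟧ <= a * ⟦d n⟧.
    rewrite dS linD//; apply: norm_add_le; last by rewrite (le_trans (norm_proj _)).
    by rewrite -(spl_comm spl) (le_trans (spl_stable spl _))// ler_pM2l// norm_proj.
  have QdS : Q (d n.+1) = Q (alpha (d n)) + Q e.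
    by rewrite dS linD// opprD addrACA.
  have ex := expanding (d n).
  have [d0|/eqP dn0] := eqVneq (d n) 0.
    rewrite d0 norm0 mulr0 in PdS; rewrite d0 (lin0 lP) subr0 norm0.
    by rewrite (le_trans PdS) ?norm_ge0// mulr_ge0// norm_ge0.
  have dn_gt0 := norm_gt0 dn0.
  (* The perturbation is at most [a * ⟦d n⟧], strictly less than the unstable part of the linear
     term, so it does not change the norm of that part. *)
  have aex : a * ⟦d n⟧ < ⟦Q (alpha (d n))⟧.
    have h1 : a * ⟦d n⟧ <= a * q * ⟦Q (alpha (d n))⟧ by rewrite -mulrA ler_pM2l// dn.
    have ad0 : 0 < a * ⟦d n⟧ by rewrite mulr_gt0.
    have h2 : 0 < ⟦Q (alpha (d n))⟧.
      rewrite lt_neqAle norm_ge0 andbT; apply/eqP => h; rewrite -h mulr0 in h1.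
      by have := lt_le_trans ad0 h1; rewrite ltxx.
    apply: le_lt_trans h1 _; rewrite -[ltRHS]mul1r ltr_pM2r//; exact: (spl_aq spl).
  have Qn : ⟦Q (d n.+1)⟧ = ⟦Q (alpha (d n))⟧.
    by rewrite QdS norm_add_eql// (le_lt_trans (norm_coproj _))// (le_lt_trans en).
  by rewrite Qn (le_trans PdS (ltW aex)).
have cone n : ⟦P (d n)⟧ <= ⟦Q (d n)⟧ /\ ⟦Q (d 0)⟧ <= q ^+ n * ⟦Q (d n)⟧.
  elim: n => [|n [IH1 IH2]].
    by rewrite mul1r lexx; split=> //; rewrite /d linB// P0 subrr norm0 norm_ge0.
  have [h1 h2] := step n IH1; split=> //; apply: le_trans IH2 _.
  by rewrite exprSr -mulrA ler_wpM2l// exprn_ge0.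
have aq01 : 0 <= a * q < 1 by rewrite mulr_ge0 ?(ltW a0)//; exact: (spl_aq spl).
apply/eqP; rewrite -subr_eq0; apply/eqP/norm_le0 => e e0; rewrite -/(d 0).
have -> : ⟦d 0⟧ = ⟦Q (d 0)⟧ by rewrite (spl_max spl) max_r//; case: (cone 0).
have [n /(_ n (leqnn _)) nP] := geometric_lt C aq01 e0.
have [_ h] := cone n; apply: le_lt_trans h _; apply: le_lt_trans nP.
rewrite exprMn mulrA mulrC ler_wpM2r ?exprn_ge0//.
exact: le_trans (norm_coproj _) (dC n).
Qed.

Variables (S : ultraBanach K) (at_ : nat -> S -> X).
Hypothesis at_blin : forall n, blin (at_ n) (a ^+ n).
Hypothesis at_le : forall z C, (forall n, ⟦at_ n z⟧ <= C * a ^+ n) -> ⟦z⟧ <= C.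
Hypothesis at_inj : forall z z', (forall n, at_ n z = at_ n z') -> z = z'.
Hypothesis at_surj : forall w C, (forall n, ⟦w n⟧ <= C * a ^+ n) ->
  exists z, forall n, at_ n z = w n.

Let at_lin n : linear (at_ n). Proof. by case: (at_blin n). Qed.
Let at_norm n z : ⟦at_ n z⟧ <= ⟦z⟧ * a ^+ n.
Proof. by rewrite mulrC; case: (at_blin n). Qed.

Lemma linear_orbit : exists2 H : X -> S, blin H 1 &
  (forall x n, at_ n (H x) = iter n alpha (P x)) /\ (forall x, ⟦H x⟧ <= ⟦P x⟧).
Proof.
have itP x n : P (iter n alpha (P x)) = iter n alpha (P x).
  by elim: n => [|n IH] /=; rewrite ?(spl_PP spl)// -(spl_comm spl) IH.
have bnd x n : ⟦iter n alpha (P x)⟧ <= ⟦P x⟧ * a ^+ n.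
  elim: n => [|n IH]; first by rewrite mulr1.
  rewrite iterS -itP (le_trans (spl_stable spl _))// itP exprS mulrCA.
  by rewrite ler_pM2l.
have /choice[H HP] x := at_surj (bnd x); exists H; last first.
  by split=> // x; apply: at_le => n; rewrite HP.
split=> // [k x y|x].
  apply: at_inj => n; rewrite at_lin !HP lP.
  by elim: n => [//|n IH]; rewrite !iterS IH lA.
by rewrite mul1r (le_trans _ (norm_proj x))//; apply: at_le => n; rewrite HP.
Qed.

(* Solves the inhomogeneous equation z_(n+1) = alpha z_n + w_n: forward on the
   centre-stable component starting from 0, backward from infinity on the
   unstable one. *)
Lemma inhomogeneous : exists (G : S -> S) D, blin G D /\
  forall w, P (at_ 0 (G w)) = 0 /\
    forall n, at_ n.+1 (G w) = alpha (at_ n (G w)) + at_ n w.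
Proof.
have q0 := spl_q spl.
pose s := fix s (w : S) n := if n is n'.+1 then alpha (s w n') + P (at_ n' w) else 0.
have sP w n : P (s w n) = s w n.
  elim: n => [|n IH] /=; first by rewrite lin0.
  by rewrite linD// (spl_PP spl) -(spl_comm spl) IH.
have s_bnd w n : ⟦s w n⟧ <= (a^-1 * ⟦w⟧) * a ^+ n.
  have ai : 0 <= a^-1 * ⟦w⟧ by rewrite mulr_ge0 ?norm_ge0// invr_ge0 ltW.
  elim: n => [|n IH] /=; first by rewrite norm0 mulr1.
  apply: norm_add_le.
    rewrite -sP (le_trans (spl_stable spl _))// sP exprS mulrCA ler_pM2l//.
  rewrite (le_trans (norm_proj _))// (le_trans (at_norm _ _))// exprS.
  by rewrite mulrACA mulVf ?mul1r ?lt0r_neq0.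
have b_iter n x : ⟦iter n.+1 beta x⟧ <= q ^+ n.+1 * ⟦x⟧.
  elim: n => [|n IH] /=; first exact: (spl_unstable spl).
  by rewrite (le_trans (spl_unstable spl _))// exprS -mulrA ler_wpM2l.
have lbi n : linear (iter n beta).
  by elim: n => [//|n IH] k x y; rewrite !iterS IH (spl_beta spl).
have aq01 : 0 <= a * q < 1 by rewrite mulr_ge0 ?(ltW a0)//; exact: (spl_aq spl).
(* The unstable component is minus the sum over j of beta^(j+1) w_(n+j), a series of geometric ratio
   a q. *)
have t_bnd w n j : ⟦iter j.+1 beta (at_ (n + j) w)⟧ <= (q * ⟦w⟧ * a ^+ n) * (a * q) ^+ j.
  rewrite (le_trans (b_iter _ _))//.
  have -> : q * ⟦w⟧ * a ^+ n * (a * q) ^+ j = q ^+ j.+1 * (⟦w⟧ * a ^+ (n + j)).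
    by rewrite exprMn exprS exprD; ring.
  by rewrite ler_wpM2l// exprn_ge0.
have /choice[t tP] (wn : S * nat) := geometric_series_cvg aq01 (t_bnd wn.1 wn.2).
have tl w n : ulim (fun m => \sum_(j < m) iter j.+1 beta (at_ (n + j) w)) (t (w, n)).
  by case: (tP (w, n)).
have t_le w n : ⟦t (w, n)⟧ <= q * ⟦w⟧ * a ^+ n.
  by have [_ /(_ 0)] := tP (w, n); rewrite big_ord0 subr0 mulr1.
have Pt w n : P (t (w, n)) = 0.
  apply: (ulim_unique (blin_ulim blin_proj (tl w n))).
  apply: ulim_ext (ulim_cst 0) => m.
  rewrite (lin_sum m (fun j => iter j.+1 beta (at_ (n + j) w)) lP).
  by rewrite big1// => j _; rewrite iterS (spl_Pbeta spl).
have tS w n : alpha (t (w, n)) = Q (at_ n w) + t (w, n.+1).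
  have [D bA] := spl_alpha spl.
  have /(iffLR (ulim_shift 1 _ _)) := blin_ulim bA (tl w n).
  move/ulim_unique; apply; apply: ulim_ext (ulimD (ulim_cst (Q (at_ n w))) (tl w n.+1)) => m.
  rewrite (lin_sum _ (fun j => iter j.+1 beta (at_ (n + j) w)) lA).
  rewrite addn1 big_ord_recl/= addn0 (spl_alphabeta spl); congr (_ + _).
  apply: eq_bigr => j _; rewrite (spl_alphabeta spl) (spl_Pbeta spl) subr0.
  by rewrite addSn -addnS.
have tlin k w w' n : t (k *: w + w', n) = k *: t (w, n) + t (w', n).
  apply: (ulim_unique (tl _ n)); apply: ulim_ext (ulimD (ulimZ k (tl w n)) (tl w' n)) => m.
  rewrite scaler_sumr -big_split/=; apply: eq_bigr => j _; rewrite at_lin.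
  exact: esym (lbi j.+1 _ _ _).
have slin k w w' n : s (k *: w + w') n = k *: s w n + s w' n.
  elim: n => [|n IH] /=; first by rewrite scaler0 addr0.
  by rewrite IH at_lin lA lP scalerDr addrACA.
pose D := Num.max a^-1 q.
have D0 : 0 <= D by rewrite le_max q0 orbT.
have bnd w n : ⟦s w n - t (w, n)⟧ <= (D * ⟦w⟧) * a ^+ n.
  apply: norm_sub_le; [apply: le_trans (s_bnd w n) _|apply: le_trans (t_le w n) _].
    by rewrite ler_pM2r// ler_wpM2r ?norm_ge0// le_max lexx.
  by rewrite ler_pM2r// ler_wpM2r ?norm_ge0// le_max lexx orbT.
have /choice[G GP] w := at_surj (bnd w); exists G, D; split.
  split=> // [k w w'|w]; last by apply: at_le => n; rewrite GP.
  by apply: at_inj => n; rewrite at_lin !GP tlin slin opprD addrACA scalerBr.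
move=> w; split=> [|n]; first by rewrite GP linB// Pt subr0 lin0.
rewrite !GP (linB _ _ lA) tS /= opprD opprB -[RHS]addrA.
by rewrite -[LHS]addrA [X in _ = _ + (X + _)]addrAC subrK.
Qed.

End Irwin.

Theorem local_centre_stable (R : realType) (K : ultraField R) (X : ultraBanach K)
    (alpha P beta f : X -> X) (a q r1 C M : R) (b : seq X -> X) :
  splitting alpha P beta a q -> powser b C M -> b [::] = 0 ->
  (forall x, b [:: x] = alpha x) -> 0 < r1 ->
  (forall y, ⟦y⟧ < r1 -> sums_to b y (f y)) ->
  exists (phi : X -> X) (r : R), [/\ 0 < r <= r1 /\ (forall x, phi (P x) = phi x),
    forall x, ⟦x⟧ < r -> analytic_at phi x,
    (forall x, P (phi x) = 0) /\
      exists2 D, 0 <= D & forall x, ⟦x⟧ < r -> ⟦phi x⟧ <= D * ⟦x⟧ ^+ 2,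
    forall x, ⟦x⟧ < r -> [/\ ⟦phi x⟧ <= ⟦P x⟧, ⟦P (f (P x + phi x))⟧ <= a * ⟦P x⟧ &
      f (P x + phi x) = P (f (P x + phi x)) + phi (f (P x + phi x))] &
    forall z D, (forall n, ⟦z n⟧ < r) -> (forall n, z n.+1 = f (z n)) ->
      (forall n, ⟦z n⟧ <= D * a ^+ n) -> z 0 = P (z 0) + phi (z 0)].
Proof.
move=> spl Pb b0 b1 r10 bf; have [lb C0 M0 bC] := Pb.
have /andP[a0 a1] := spl_a spl.
have an0 n : 0 < a ^+ n by rewrite exprn_gt0.
have an1 n : a ^+ n <= 1 by rewrite exprn_ile1// ltW.
have lP := spl_P spl; have bP := blin_proj spl; have bQ := blin_coproj spl.
have [S [at_ [at_blin at_le at_inj at_surj]]] := weighted_sequences X a0.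
have at_lin n : linear (at_ n) by case: (at_blin n).
have at_norm n z : ⟦at_ n z⟧ <= ⟦z⟧ * a ^+ n by rewrite mulrC; case: (at_blin n).
have [H bH [HE Hle]] := linear_orbit spl at_blin at_le at_inj at_surj.
have [G [DG [bG GP]]] := inhomogeneous spl at_blin at_le at_inj at_surj.
pose eta s := if (size s < 2)%N then 0 else b s.
have Peta : powser eta C M := powser_tail 2 Pb.
have eta_lim y : ⟦y⟧ < r1 -> sums_to eta y (f y - alpha y).
  by move=> /bf /sums_to_drop2; rewrite b0 b1 subr0.
(* [eta] acts entrywise on weighted sequences with the same constants: in degree k >= 2 the
   resulting weight (a^n)^k is at most a^n. *)
have eta_bnd s n : ⟦eta (map (at_ n) s)⟧ <= (C * \prod_(z <- s) (M * ⟦z⟧)) * a ^+ n.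
  rewrite /eta size_map; case: ifP => s2.
    by rewrite norm0 mulr_ge0 ?(ltW (an0 n))// mulr_ge0// prod_ge0.
  rewrite (le_trans (bC _))// -mulrA ler_wpM2l// big_map.
  have -> : \prod_(z <- s) (M * ⟦z⟧) * a ^+ n = \prod_(z <- s) (M * ⟦z⟧) * (a ^+ n) ^+ 1 by [].
  apply: (@le_trans _ _ (\prod_(z <- s) (M * ⟦z⟧) * (a ^+ n) ^+ size s)); last first.
    rewrite ler_wpM2l ?prod_ge0// ler_wiXn2l// ?(ltW (an0 n))//.
    by case: (size s) s2 => // -[].
  elim: s {s2} => [|z s IH]; first by rewrite !big_nil mulr1.
  rewrite !big_cons exprS mulrACA ler_pM ?mulr_ge0 ?norm_ge0//; last by rewrite -mulrA ler_wpM2l.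
  by apply: prodr_ge0 => w _; rewrite mulr_ge0 ?norm_ge0.
have /choice[etaS etaSE] s := at_surj _ _ (eta_bnd s).
have PetaS : powser etaS C M.
  split=> // [s t k x y|s]; last by apply: at_le => n; rewrite etaSE.
  apply: at_inj => n; rewrite at_lin !etaSE !map_cat/= at_lin.
  by case: Peta => leta _ _ _; exact: leta.
have etaS0 s : (size s < 2)%N -> etaS s = 0.
  move=> s2; apply: at_inj => n.
  by rewrite etaSE /eta size_map s2 (lin0 (at_lin n)).
have Ph : powser (fun s => G (etaS s)) (DG * C) M := powser_post PetaS bG.
have lG : linear G by case: bG.
have h0 : G (etaS [::]) = 0 by rewrite etaS0// lin0.
have h1 x : G (etaS [:: x]) = 0 by rewrite etaS0// lin0.
have [rs [rs0 inv]] := inverse_series Ph h0 h1.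
have [A [B [AB A0 Pu]]] := powser_solve Ph h0 h1.
have eta2 s : (size s < 2)%N -> eta s = 0 by rewrite /eta => ->.
(* [cone_escape] asks for the Lipschitz constant [a]. *)
have [rl rl0 lip] := powser_lipschitz Peta a0 eta2.
pose QL (z : S) := at_ 0 z - P (at_ 0 z).
have bQL : blin QL (1 * a ^+ 0) by exact: blin_comp (at_blin 0) bQ.
have Pphi := powser_pre (powser_post Pu bQL) bH.
set C' := 1 * _ * A in Pphi; set M' := B * 1 in Pphi.
have [phi0 g0 phi0E] := powser_extend 0 Pphi.
have M'0 : 0 <= M' by case: Pphi.
(* Composing with both projections makes [phi (P x) = phi x] and [P (phi x) = 0] hold everywhere,
   also where the values of [phi0] are arbitrary. *)
pose phi x := phi0 (P x) - P (phi0 (P x)).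
have [rn rn0 an_phi0] : exists2 r, 0 < r & forall y, ⟦y⟧ < r -> analytic_at phi0 y.
  by have [r r0 rP] := analytic_at_near g0; exists r => // y /rP; rewrite add0r.
pose r := Num.min (Num.min (Num.min r1 rs) (Num.min rl rn)) (Num.min (M' + 1)^-1 (M + 1)^-1).
have Mi0 m : 0 <= m -> 0 < (m + 1)^-1 by move=> m0; rewrite invr_gt0 ltr_wpDl.
have r0 : 0 < r by rewrite !lt_min r10 rs0 rl0 rn0 !Mi0.
have rlt (y : X) : ⟦y⟧ < r -> [/\ ⟦y⟧ < r1, ⟦y⟧ < rs, ⟦y⟧ < rl & ⟦y⟧ < rn].
  by rewrite !lt_min => /andP[/andP[/andP[-> ->] /andP[-> ->]]].
have rlt' (y : X) : ⟦y⟧ < r -> M' * ⟦y⟧ < 1 /\ M * ⟦y⟧ < 1.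
  by rewrite !lt_min => /andP[_ /andP[h2 h3]]; rewrite !inv_succ_small ?norm_ge0.
have Pr x : ⟦x⟧ < r -> ⟦P x⟧ < r by apply: le_lt_trans; exact: (norm_proj spl).
have orbit x : ⟦x⟧ < r -> exists l : S, [/\ ⟦l⟧ <= ⟦P x⟧, at_ 0 l = P x + phi x &
    forall n, at_ n.+1 l = f (at_ n l)].
  move=> xr; have Pxr := Pr x xr; have [_ xrs _ _] := rlt _ Pxr.
  have HPx : H (P x) = H x by apply: at_inj => n; rewrite !HE (spl_PP spl).
  have [|l [ul lH hl]] := inv (H x); first exact: le_lt_trans (Hle x) xrs.
  have lx : ⟦l⟧ <= ⟦P x⟧ := le_trans lH (Hle x).
  have lr : ⟦l⟧ < r := le_lt_trans lx Pxr.
  have lnr n : ⟦at_ n l⟧ < r.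
    apply: le_lt_trans lr; rewrite (le_trans (at_norm n l))// ler_piMr ?norm_ge0//.
  have Ml : M * ⟦l⟧ < 1.
    by have [_] := rlt' _ Pxr; apply: le_lt_trans; rewrite ler_wpM2l.
  have [w [wl _]] := powser_sum PetaS Ml.
  have lE : l - H x = G w := sums_to_unique hl (sums_to_post bG wl).
  have wn n : at_ n w = f (at_ n l) - alpha (at_ n l).
    have [lr1 _ _ _] := rlt _ (lnr n).
    have := sums_to_post (at_blin n) wl; move/sums_to_unique; apply.
    apply: ulim_ext (eta_lim _ lr1) => m; apply: eq_bigr => k _.
    by rewrite etaSE map_nseq.
  have lE' : l = H x + G w by rewrite -lE addrC subrK.
  have [G0 GS] := GP w.
  have step n : at_ n.+1 l = f (at_ n l).
    have -> : at_ n.+1 l = alpha (at_ n l) + at_ n w.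
      rewrite {1 2}lE' !(linD _ _ (at_lin _)) GS !HE iterS.
      by have [D [lA _ _]] := spl_alpha spl; rewrite (linD _ _ lA) addrA.
    by rewrite wn addrC subrK.
  exists l; split=> //.
  have P0 : P (at_ 0 l) = P x.
    by rewrite lE' (linD _ _ (at_lin 0)) (linD _ _ lP) G0 HE (spl_PP spl) addr0.
  have phi0x : phi0 (P x) = at_ 0 l - P x.
    have [M'x _] := rlt' _ Pxr; have := phi0E _ M'x; rewrite add0r => /sums_to_unique; apply.
    have -> : at_ 0 l - P x = QL l by rewrite /QL P0.
    apply: (@sums_to_pre _ _ _ _ _ (fun s => QL (solve (fun s => G (etaS s)) s)) (P x) (QL l) H).
    by rewrite HPx; exact: sums_to_post bQL ul.
  by rewrite /phi phi0x (linB _ _ lP) P0 (spl_PP spl) subrr subr0 addrC subrK.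
have r_r1 : r <= r1 by rewrite !ge_min lexx.
have lipf x y : ⟦x⟧ < r -> ⟦y⟧ < r ->
    ⟦(f x - alpha x) - (f y - alpha y)⟧ <= a * ⟦x - y⟧.
  move=> /rlt[x1 _ xl _] /rlt[y1 _ yl _].
  by apply: lip; rewrite ?ltW//; exact: eta_lim.
have phiP x : phi (P x) = phi x by rewrite /phi (spl_PP spl).
have uniq (z : nat -> X) D : (forall n, ⟦z n⟧ < r) -> (forall n, z n.+1 = f (z n)) ->
    (forall n, ⟦z n⟧ <= D * a ^+ n) -> z 0 = P (z 0) + phi (z 0).
  (* [z] is compared with the orbit that starts on the graph with the same centre-stable
     component. *)
  move=> zr zf zD; have [l [lz l0 lf]] := orbit _ (zr 0); rewrite -l0.
  have lnr n : ⟦at_ n l⟧ < r.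
    apply: le_lt_trans (Pr _ (zr 0)); apply: le_trans lz.
    by rewrite (le_trans (at_norm n l))// ler_piMr ?norm_ge0.
  apply: (cone_escape spl (z := z) (w := fun n => at_ n l) (C := Num.max D ⟦l⟧) lipf zr lnr zf lf).
  - by move=> n; rewrite (le_trans (zD n))// ler_pM2r// le_max lexx.
  - by move=> n; rewrite (le_trans (at_norm n l))// ler_pM2r// le_max lexx orbT.
  - by rewrite l0 (linD _ _ lP) (spl_PP spl) (proj_coproj spl) addr0.
have Pphi0 x : P (phi x) = 0 by exact: (proj_coproj spl).
exists phi, r; split=> //.
- by rewrite r0 r_r1.
- move=> x xr; have [_ _ _ xrn] := rlt _ (Pr x xr).
  apply: (analytic_at_comp (g := fun x => phi0 (P x)) (h := fun x => x - P x)).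
    apply: analytic_at_comp; [exact: analytic_at_blin bP|exact: an_phi0].
  exact: analytic_at_blin bQ.
(* The coefficients of degree 0 and 1 vanish: [solve] has no constant term and starts with the
   identity, and the entry of index 0 of [H x] is fixed by [P]. *)
- split=> //; exists (C' * M' ^+ 2) => [|x xr].
    by have [_ C'0 _ _] := Pphi; rewrite mulr_ge0 ?exprn_ge0.
  have [M'x _] := rlt' _ (Pr x xr).
  have := phi0E _ M'x; rewrite add0r => h.
  have := sums_to_bound 2 Pphi M'x h.
  rewrite (sum_recl2 0 (fun k => QL (solve (fun s => G (etaS s)) (map H (nseq k (P x)))))).
  rewrite /= solve0 (solve1 _ h0 h1) big_ord0 addr0 /QL !(lin0 (at_lin 0)) !(lin0 lP) subr0 add0r.
  rewrite HE !(spl_PP spl) subrr subr0 => h2.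
  rewrite /phi (le_trans (norm_coproj spl _))// (le_trans h2)// exprMn -mulrA.
  rewrite ler_wpM2l ?ler_wpM2l ?exprn_ge0//; first by case: Pphi.
  by rewrite lerXn2r ?nnegrE ?norm_ge0// (norm_proj spl).
- move=> x xr; have [l [lx l0 lf]] := orbit x xr; rewrite -l0 -lf.
  have Px : P x = P (at_ 0 l) by rewrite l0 (linD _ _ lP) (spl_PP spl) Pphi0 addr0.
  have lnr n : ⟦at_ n l⟧ < r.
    apply: le_lt_trans (Pr _ xr); apply: le_trans lx.
    by rewrite (le_trans (at_norm n l))// ler_piMr ?norm_ge0.
  split.
  + have -> : phi x = at_ 0 l - P (at_ 0 l) by rewrite -Px l0 addrC addKr.
    rewrite (le_trans (norm_coproj spl _))// (le_trans (at_norm 0 l))//.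
    by rewrite expr0 mulr1.
  + rewrite (le_trans (norm_proj spl _))// (le_trans (at_norm 1 l))// expr1 mulrC.
    by rewrite ler_pM2l.
  (* The shifted sequence is again an orbit with weight a^n, so its first point lies on the
     graph. *)
  + apply: (uniq (fun n => at_ n.+1 l) (⟦l⟧ * a)) => // n.
    by rewrite (le_trans (at_norm n.+1 l))// exprS mulrA.
Qed.

Notation has_deriv := (is_deriv (@ub_norm _ _ _) (@ub_norm _ _ _)).

(** * Derivatives and tangent maps *)

Section Derivative.
Variables (R : realType) (K : ultraField R).

Lemma is_deriv_near (E F : ultraBanach K) (g : E -> F) x A :
  has_deriv g x A ->
  (exists D, blin A D) /\ forall e : R, 0 < e -> exists2 d, 0 < d &
    forall h, ⟦h⟧ < d -> ⟦g (x + h) - g x - A h⟧ <= e * ⟦h⟧.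
Proof.
move=> [lA cA gA]; split; first exact: continuous_blin.
move=> e /gA[d d0 dg]; exists d => // h hd.
have := dg (x + h); rewrite /norm_ball/= addrAC subrr add0r; exact.
Qed.

Lemma is_deriv_intro (E F : ultraBanach K) (g : E -> F) x A D : blin A D ->
  (forall e : R, 0 < e -> exists2 d, 0 < d &
    forall h, ⟦h⟧ < d -> ⟦g (x + h) - g x - A h⟧ <= e * ⟦h⟧) ->
  has_deriv g x A.
Proof.
move=> bA gA; split; [by case: bA|exact: blin_continuous bA|].
move=> e /gA[d d0 dg]; exists d => // y; rewrite /norm_ball/= => yd.
by have := dg _ yd; rewrite [x + _]addrC subrK.
Qed.

(** A direction is scaled by [l] into a small ball; both derivatives are linear, so the factor
    [uf_abs l] cancels from the estimate. *)
Lemma is_deriv_unique (E F : ultraBanach K) (g g' : E -> F) x A A' (r : R) : 0 < r ->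
  (forall h, ⟦h⟧ < r -> g (x + h) = g' (x + h)) ->
  has_deriv g x A ->
  has_deriv g' x A' -> A = A'.
Proof.
move=> r0 gg' /is_deriv_near[[D [lA _ _]] gA] /is_deriv_near[[D' [lA' _ _]] gA'].
apply/funext => h; apply/eqP; rewrite -subr_eq0; apply/eqP/norm_le0 => e e0.
have [->|/eqP h0] := eqVneq h 0; first by rewrite (lin0 lA) (lin0 lA') subr0 norm0.
have hn := norm_gt0 h0; pose e1 := e / 2 / ⟦h⟧.
have e10 : 0 < e1 by rewrite !divr_gt0.
have [d d0 dA] := gA _ e10; have [d' d'0 dA'] := gA' _ e10.
pose m := Num.min r (Num.min d d').
have m0 : 0 < m by rewrite !lt_min r0 d0.
have [c c01] := exists_small_scalar K.
have [l l0 /andP[_ l1]] := rescale c01 (divr_gt0 hn m0).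
have al := abs_gt0 l0.
have : ⟦l *: h⟧ < m by rewrite normZ; move: l1; rewrite mulrA ltr_pdivrMr// mul1r.
rewrite !lt_min => /and3P[lr ld ld'].
have g0 : g x = g' x by have := gg' 0; rewrite norm0 addr0; exact.
have : ⟦A (l *: h) - A' (l *: h)⟧ <= e1 * ⟦l *: h⟧.
  have -> : A (l *: h) - A' (l *: h) = (g' (x + l *: h) - g' x - A' (l *: h)) -
      (g (x + l *: h) - g x - A (l *: h)).
    rewrite gg'// g0; set W := g' (x + l *: h) - g' x.
    by rewrite opprB (addrC W) addrACA subrr addr0 addrC.
  by apply: norm_sub_le; [exact: dA'|exact: dA].
rewrite (linZ _ _ lA) (linZ _ _ lA') -scalerBr !normZ mulrCA ler_pM2l// => h1.
apply: le_lt_trans h1 _; rewrite /e1 divfK ?lt0r_neq0// ltr_pdivrMr//.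
by rewrite mulr_natr mulr2n ltrDl.
Qed.

Lemma is_deriv_comp (E F G : ultraBanach K) (g : E -> F) (h : F -> G) x A B :
  has_deriv g x A ->
  has_deriv h (g x) B ->
  has_deriv (fun y => h (g y)) x (fun y => B (A y)).
Proof.
move=> /is_deriv_near[[D bA] gA] /is_deriv_near[[D' bB] hB].
have [lA D0 AD] := bA; have [lB D'0 BD] := bB.
apply: is_deriv_intro (blin_comp bA bB) _ => e e0.
have D1 : 0 < D + 1 by rewrite ltr_wpDl.
have D'1 : 0 < D' + 1 by rewrite ltr_wpDl.
have [d d0 dh] := hB _ (divr_gt0 e0 D1).
pose e1 := Num.min 1 (e / (D' + 1)).
have e10 : 0 < e1 by rewrite lt_min ltr01 divr_gt0.
have [d' d'0 dg] := gA _ e10.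
have e11 : e1 <= 1 by rewrite ge_min lexx.
have e1e : e1 <= e / (D' + 1) by rewrite ge_min lexx orbT.
exists (Num.min d' (d / (D + 1))) => [|k]; first by rewrite lt_min d'0 divr_gt0.
rewrite lt_min => /andP[/dg kg]; rewrite ltr_pdivlMr// => kd.
have k0 := norm_ge0 k.
have gk : ⟦g (x + k) - g x⟧ <= (D + 1) * ⟦k⟧.
  rewrite -(subrK (A k) (_ - _)); apply: norm_add_le.
    by rewrite (le_trans kg)// ler_wpM2r// (le_trans e11)// lerDr.
  by rewrite (le_trans (AD k))// ler_wpM2r// lerDl.
have := dh (g (x + k) - g x); rewrite [g x + _]addrC subrK => hk.
have -> : h (g (x + k)) - h (g x) - B (A k) =
    (h (g (x + k)) - h (g x) - B (g (x + k) - g x)) + B (g (x + k) - g x - A k).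
  by rewrite (linB (g (x + k) - g x) (A k) lB) addrA subrK.
apply: norm_add_le.
  rewrite (le_trans (hk _))//; first by rewrite (le_lt_trans gk)// mulrC.
  rewrite (le_trans (ler_wpM2l _ gk))//; first by rewrite divr_ge0// ltW.
  by rewrite mulrA divfK// lt0r_neq0.
rewrite (le_trans (BD _))// (le_trans (ler_wpM2l D'0 kg))// mulrA ler_wpM2r//.
rewrite (le_trans (ler_wpM2l D'0 e1e))// mulrCA ler_piMr ?(ltW e0)//.
by rewrite ler_pdivrMr// mul1r lerDl.
Qed.

Lemma powser_deriv (E F : ultraBanach K) (g : E -> F) x b C M (r : R) : powser b C M ->
  0 < r -> (forall y, ⟦y⟧ < r -> sums_to b y (g (x + y))) ->
  has_deriv g x (fun y => b [:: y]).
Proof.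
move=> Pb r0 bg; have [lb C0 M0 bC] := Pb.
apply: (@is_deriv_intro _ _ _ _ _ (C * M)) => [|e e0].
  split; [exact: mlin_head|exact: mulr_ge0|].
  by move=> y; rewrite (le_trans (bC _))// big_cons big_nil mulr1 mulrA.
have Q0 : 0 <= C * M ^+ 2 by rewrite mulr_ge0 ?exprn_ge0.
pose N := M + C * M ^+ 2 / e + 1.
have N0 : 0 < N by rewrite ltr_wpDl// addr_ge0// divr_ge0// ltW.
exists (Num.min r N^-1) => [|h]; first by rewrite lt_min r0 invr_gt0.
rewrite lt_min => /andP[hr hN]; have h0 := norm_ge0 h.
have hN1 : N * ⟦h⟧ < 1 by rewrite mulrC -ltr_pdivlMr// mul1r.
have Mh : M * ⟦h⟧ < 1.
  apply: le_lt_trans hN1; rewrite ler_wpM2r// /N -addrA lerDl addr_ge0// divr_ge0//; exact: ltW.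
have Ch : C * M ^+ 2 * ⟦h⟧ <= e.
  have h1 : C * M ^+ 2 / e * ⟦h⟧ <= 1.
    apply: le_trans (ltW hN1); rewrite ler_wpM2r// /N.
    by rewrite -addrA addrC -addrA lerDl addr_ge0.
  by move: h1; rewrite mulrAC ler_pdivrMr// mul1r.
have g0 : g x = b [::].
  by have := bg 0; rewrite norm0 addr0 => /(_ r0) /(sums_to_at0 lb).
have := sums_to_bound 2 Pb Mh (bg h hr).
rewrite (sum_recl2 0 (fun k => b (nseq k h))) big_ord0 addr0 opprD addrA -g0 => /le_trans; apply.
by rewrite exprMn mulrA [_ ^+ 2 as X in _ * X]expr2 mulrA ler_wpM2r.
Qed.

Lemma analytic_deriv (E F : ultraBanach K) (g : E -> F) x : analytic_at g x ->
  exists A, has_deriv g x A.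
Proof.
by move=> [b [C [M [r [Pb r0 bg]]]]]; exists (fun y => b [:: y]); exact: powser_deriv Pb r0 bg.
Qed.

Lemma is_deriv_affine (E F : ultraBanach K) (L : E -> F) D e x : blin L D ->
  has_deriv (fun y => L y + e) x L.
Proof.
move=> bL; have [lL _ _] := bL; apply: is_deriv_intro bL _ => d d0; exists 1 => // h _.
rewrite (linD _ _ lL) opprD addrACA subrr addr0 [L x + _]addrC addrK subrr norm0.
by rewrite mulr_ge0 ?norm_ge0// ltW.
Qed.

Lemma analytic_series (E F : ultraBanach K) (g : E -> F) x A : analytic_at g x ->
  has_deriv g x A -> exists b C M r, [/\ powser b C M, b [::] = g x,
    forall y, b [:: y] = A y, 0 < r & forall y, ⟦y⟧ < r -> sums_to b y (g (x + y))].
Proof.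
move=> [b [C [M [r [Pb r0 bg]]]]] gA; have [lb _ _ _] := Pb.
exists b, C, M, r; split=> //.
  by have := bg 0; rewrite norm0 addr0 => /(_ r0) /(sums_to_at0 lb).
move=> y; have := is_deriv_unique r0 (fun h _ => erefl) (powser_deriv Pb r0 bg) gA.
by move=> /(congr1 (fun h => h y)).
Qed.

(** Serves to centre at 0 both the map [f] and, later, the inclusion of an immersed submanifold. *)
Lemma affine_conjugate (E F G H : ultraBanach K) (g : F -> G) (k : E -> F) (L : G -> H)
    D D' e e' A : blin k D -> blin L D' -> analytic_at g e -> has_deriv g e A ->
  analytic_at (fun x => L (g (e + k x) - e')) 0 /\
  has_deriv (fun x => L (g (e + k x) - e')) 0 (fun x => L (A (k x))).
Proof.
move=> bk bL ag gA; have [lk _ _] := bk; have [lL _ _] := bL.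
have ek0 : e + k 0 = e by rewrite lin0// addr0.
have -> : (fun x => L (g (e + k x) - e')) = fun x => L (g (k x + e)) + - L e'.
  by apply/funext => x; rewrite linB// [e + _]addrC.
split.
  apply: analytic_atD; last exact: analytic_at_cst.
  apply: analytic_at_comp (analytic_at_blin _ bL).
  apply: (analytic_at_comp (g := fun x => k x + e)); last by rewrite addrC ek0.
  by apply: analytic_atD; [exact: analytic_at_blin bk|exact: analytic_at_cst].
apply: is_deriv_comp (is_deriv_affine _ _ bL).
by apply: is_deriv_comp (is_deriv_affine e 0 bk) _; rewrite addrC ek0.
Qed.

End Derivative.

(** * Charts, tangent spaces and tangent maps *)

Section Charts.
Variables (R : realType) (K : ultraField R).

(** This is analyticity in coordinates at one point. Since [c] and [d] are plain functions,
    coordinates may take values in a Banach space other than the model. *)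
Definition rep_at (M N : topologicalType) (X Y : ultraBanach K) (f : M -> N) (x : M)
    (c : M -> X) (d : N -> Y) :=
  exists2 g : X -> Y, \forall y \near x, g (c y) = d (f y) & analytic_at g (c x).

Lemma rep_at_comp (M N L : topologicalType) (X Y Z : ultraBanach K) (f : M -> N)
    (h : N -> L) x (c : M -> X) (d : N -> Y) (e : L -> Z) :
  {for x, continuous f} -> rep_at f x c d -> rep_at h (f x) d e ->
  rep_at (fun y => h (f y)) x c e.
Proof.
move=> cf [g gf ag] [k kh ak]; exists (fun v => k (g v)).
  have kf : \forall y \near x, k (d (f y)) = e (h (f y)) := cf _ kh.
  by near=> y; rewrite (near gf y)// (near kf y).
by apply: analytic_at_comp => //; rewrite (nbhs_singleton gf).
Unshelve. all: by end_near.
Qed.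

Lemma rep_at_id (M : topologicalType) (X : ultraBanach K) (x : M) (c : M -> X) :
  rep_at id x c c.
Proof.
exists (fun v => v); first exact: nearW.
exact: analytic_at_blin (blin_id X).
Qed.

Lemma rep_at_fun (M : topologicalType) (X Y : ultraBanach K) x (c : M -> X) (g : X -> Y) :
  analytic_at g (c x) -> rep_at id x c (fun y => g (c y)).
Proof. by move=> ag; exists g => //; exact: nearW. Qed.

Section OneModel.
Variable E : ultraBanach K.
Local Notation nE := (@ub_norm R K E).

Lemma is_chart_param (T : topologicalType) (D : set T) (c : T -> E) (V : set E) (s : E -> T) :
  open D -> norm_open nE V -> (forall x, D x -> V (c x) /\ s (c x) = x) ->
  (forall v, V v -> D (s v) /\ c (s v) = v) ->
  (forall x, D x -> c @ x --> norm_nbhs nE (c x)) ->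
  (forall x, D x -> forall W, nbhs x W -> norm_nbhs nE (c x) (s @^-1` W)) ->
  is_chart (Chart D c).
Proof.
move=> oD oV cV sD cc cs.
have imV : c @` D = V.
  apply/seteqP; split=> [_ [x Dx <-]|v Vv]; first by case: (cV x Dx).
  by have [Ds cs'] := sD v Vv; exists (s v).
split=> //=; first by rewrite imV.
  move=> x y /set_mem Dx /set_mem Dy cxy.
  by rewrite -(cV x Dx).2 -(cV y Dy).2 cxy.
move=> x W Dx xW; have [e e0 eW] := cs x Dx _ xW.
have [e' e'0 eV] := oV _ (cV x Dx).1.
exists (Num.min e e') => [|v]; first by rewrite /= lt_min; apply/andP.
rewrite /norm_ball/= lt_min => /andP[ve ve'].
have [Ds cs'] := sD v (eV _ ve'); exists (s v) => //; split=> //.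
exact: eW ve.
Qed.

Lemma chart_inverse (T : topologicalType) (c : chart T E) x0 : is_chart c -> cdom c x0 ->
  exists s : E -> T, [/\ forall x, cdom c x -> s (c x) = x,
    forall v, (c @` cdom c) v -> cdom c (s v) /\ c (s v) = v &
    forall x, cdom c x -> forall W, nbhs x W -> norm_nbhs nE (c x) (s @^-1` W)].
Proof.
move=> [oD oV inj cc co] Dx0; pose s v := xget x0 [set y | cdom c y /\ c y = v].
have sP v : (c @` cdom c) v -> cdom c (s v) /\ c (s v) = v.
  by move=> [x Dx cx]; apply: (@xgetPex _ x0 [set y | cdom c y /\ c y = v]); exists x.
have sK x : cdom c x -> s (c x) = x.
  move=> Dx; have [|Ds cs] := sP (c x); first by exists x.
  by apply: inj => //; exact/mem_set.
exists s; split=> // x Dx W xW; have [e e0 eW] := co x W Dx xW.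
exists e => // v /eW[y [Wy Dy] <-]; rewrite /preimage/= sK//.
Qed.

Lemma chart_image_open (T : topologicalType) (c : chart T E) (A : set T) : is_chart c ->
  open A -> A `<=` cdom c -> norm_open nE (c @` A).
Proof.
move=> [oD oV inj cc co] oA AD _ [x Ax <-].
have [|e e0 eA] := co x A (AD x Ax); first exact: open_nbhs_nbhs.
by exists e => // v /eA[y [Ay _] <-]; exists y.
Qed.

Lemma chart_near (T : topologicalType) (c : chart T E) x : is_chart c -> cdom c x ->
  \forall y \near x, cdom c y.
Proof. by move=> [oD _ _ _ _] Dx; apply: open_nbhs_nbhs. Qed.

Lemma rep_at_inverse (T N : topologicalType) (Y : ultraBanach K) (c : chart T E)
    (d : N -> Y) (f : T -> N) (s : E -> T) x : is_chart c -> cdom c x ->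
  (forall y, cdom c y -> s (c y) = y) -> rep_at f x c d ->
  analytic_at (fun v => d (f (s v))) (c x).
Proof.
move=> hc cx sK [g gf ag]; have [_ _ _ _ co] := hc.
have [e e0 eW] := co x _ cx gf.
apply: (@analytic_at_eq _ _ _ _ g _ _ e) => // v ve.
have [|y [gy Dy] yv] := eW (c x + v); first by rewrite /norm_ball/= addrAC subrr add0r.
by rewrite -yv sK.
Qed.

Section OneManifold.
Variable M : manifold E.
Hypothesis hM : analytic_manifold M.

Lemma atlas_chart (c : chart M E) : atlas c -> is_chart c.
Proof. by case: hM => _ + _ _ _; exact. Qed.

Lemma atlas_rep (x : M) c d : chart_at x c -> chart_at x d -> rep_at id x c d.
Proof.
move=> [ac cx] [ad dx]; have [_ hc _ ht _] := hM; have [g ag gE] := ht c d ac ad.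
exists g.
  have nc := chart_near (hc c ac) cx; have nd := chart_near (hc d ad) dx.
  by near=> y; apply: gE; [exact: (near nc y)|exact: (near nd y)].
by have [_] := (analytic_onP _ _).1 ag; apply; exists x.
Unshelve. all: by end_near.
Qed.

Lemma chart_exists (x : M) : exists c, chart_at x c.
Proof. by case: hM => _ _ /(_ x)[c ac cx] _ _; exists c. Qed.

Lemma transition_of_rep (c d : chart M E) : is_chart c -> is_chart d ->
  (forall x, cdom c x -> cdom d x -> rep_at id x c d) -> analytic_transition c d.
Proof.
move=> hc hd cd; have [[x0 Dx0]|nD] := pselect (exists x, cdom c x); last first.
  exists (fun=> 0); last by move=> x Dx; case: nD; exists x.
  by apply/analytic_onP; split=> [? [x [Dx _] _]|? [x [Dx _] _]]; case: nD; exists x.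
have [s [sK sD sc]] := chart_inverse hc Dx0.
exists (fun v => d (s v)); last by move=> x Dx _; rewrite sK.
apply/analytic_onP; split.
  apply: (chart_image_open hc) => [|x []//].
  have [oc _ _ _ _] := hc; have [od _ _ _ _] := hd.
  exact: openI.
by move=> _ [x [cx dx] <-]; apply: (rep_at_inverse (f := id) hc cx sK); exact: cd.
Qed.

(** By maximality of the atlas, compatibility has to be checked against one chart at each point; the
    others follow by composing with transition maps. *)
Lemma atlas_criterion (c : chart M E) : is_chart c ->
  (forall x, cdom c x -> exists c1, [/\ chart_at x c1, rep_at id x c c1 & rep_at id x c1 c]) ->
  atlas c.
Proof.
move=> hc cP; have [_ _ _ _] := hM; apply => // d ad; have hd := atlas_chart ad.
have ci (x : M) : {for x, continuous id} by exact: cvg_id.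
split; apply: transition_of_rep => // x.
  move=> cx dx; have [c1 [[ac1 c1x] r1 _]] := cP x cx.
  exact: (rep_at_comp (f := id) (h := id) (ci x) r1 (atlas_rep (conj ac1 c1x) (conj ad dx))).
move=> dx cx; have [c1 [[ac1 c1x] _ r1]] := cP x cx.
exact: (rep_at_comp (f := id) (h := id) (ci x) (atlas_rep (conj ad dx) (conj ac1 c1x)) r1).
Qed.

End OneManifold.

Lemma is_chart_restrict (T : topologicalType) (c : chart T E) (D : set T) : is_chart c ->
  open D -> D `<=` cdom c -> is_chart (Chart D c).
Proof.
move=> hc oD Dc; have [_ oV inj cc co] := hc; split=> //=.
- exact: chart_image_open.
- by move=> x y /set_mem Dx /set_mem Dy; apply: inj; apply/mem_set; exact: Dc.
- by move=> x Dx; exact: cc (Dc x Dx).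
- move=> x W Dx xW; have [|e e0 eW] := co x (W `&` D) (Dc x Dx).
    by apply: filterI => //; exact: open_nbhs_nbhs.
  by exists e => // v /eW[y [[Wy Dy] _] <-]; exists y.
Qed.

Lemma atlas_restrict (M : manifold E) (c : chart M E) (D : set M) : analytic_manifold M ->
  atlas c -> open D -> D `<=` cdom c -> atlas (Chart D c).
Proof.
move=> hM ac oD Dc; apply: (atlas_criterion hM).
  exact: is_chart_restrict (atlas_chart hM ac) oD Dc.
move=> x Dx; exists c; split; [by split=> //; exact: Dc| |]; exact: rep_at_id.
Qed.

End OneModel.

Lemma rep_of_transition (E : ultraBanach K) (T : topologicalType) (c d : chart T E) x :
  is_chart c -> is_chart d -> cdom c x -> cdom d x -> analytic_transition c d ->
  rep_at id x c d.
Proof.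
move=> hc hd cx dx [g ag gE]; exists g.
  by apply: filterS (filterI (chart_near hc cx) (chart_near hd dx)) => y [cy dy]; exact: gE.
by have [_] := (analytic_onP _ _).1 ag; apply; exists x.
Qed.

Section AnalyticMap.
Variables (E F : ultraBanach K) (M : manifold E) (N : manifold F).
Hypotheses (hM : analytic_manifold M) (hN : analytic_manifold N).

Lemma open_nbhsP (T : topologicalType) (A : set T) : (forall x, A x -> nbhs x A) -> open A.
Proof. by rewrite openE. Qed.

Lemma analytic_mapP (U : set M) (f : M -> N) : open U ->
  (forall x, U x -> {for x, continuous f}) ->
  (forall x, U x -> exists c d, [/\ chart_at x c, chart_at (f x) d & rep_at f x c d]) ->
  analytic_map U f.
Proof.
move=> oU cf rf; split=> // c d ac ad A.
have hc := atlas_chart hM ac; have hd := atlas_chart hN ad.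
have [[x0 Dx0]|nD] := pselect (exists x, cdom c x); last first.
  exists (fun=> 0); last by move=> x [[_ Dx] _]; case: nD; exists x.
  by apply/analytic_onP; split=> [? [x [[_ Dx] _] _]|? [x [[_ Dx] _] _]]; case: nD; exists x.
have [s [sK sD sc]] := chart_inverse hc Dx0.
exists (fun v => d (f (s v))); last by move=> x [[_ Dx] _]; rewrite sK.
apply/analytic_onP; split.
  apply: (chart_image_open hc) => [|x [[]]//].
  apply: open_nbhsP => x [[Ux cx] dfx]; apply: filterI; first apply: filterI.
  - exact: open_nbhs_nbhs.
  - exact: chart_near.
  - by apply: cf => //; exact: chart_near.
move=> _ [x [[Ux cx] dx] <-]; apply: (rep_at_inverse hc cx sK).
have [c1 [d1 [c1x d1x r1]]] := rf x Ux.
apply: (rep_at_comp (f := id) (h := f)) (atlas_rep hM (conj ac cx) c1x) _.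
  exact: cvg_id.
apply: (rep_at_comp (f := f) (h := id)) r1 (atlas_rep hN d1x (conj ad dx)).
exact: cf.
Qed.

Lemma analytic_map_rep (U : set M) (f : M -> N) x c d : analytic_map U f -> U x ->
  chart_at x c -> chart_at (f x) d -> rep_at f x c d.
Proof.
move=> [oU cf af] Ux [ac cx] [ad dx]; have [g ag gE] := af c d ac ad.
exists g; last by have [_] := (analytic_onP _ _).1 ag; apply; exists x.
have nc := chart_near (atlas_chart hM ac) cx.
have nd : \forall y \near x, cdom d (f y).
  by apply: cf => //; exact: chart_near (atlas_chart hN ad) dx.
have nU : \forall y \near x, U y by exact: open_nbhs_nbhs.
by near=> y; apply: gE; split; [split|]; [exact: (near nU y)|exact: (near nc y)|exact: (near nd y)].
Unshelve. all: by end_near.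
Qed.

End AnalyticMap.

Section ChartDerivative.
Variables (E F G : ultraBanach K) (M N L : topologicalType).
Implicit Types (c : chart M E) (d : chart N F) (e : chart L G).

Lemma chart_deriv_rep f x c d : rep_at f x c d -> exists A, chart_deriv f x c d A.
Proof. by move=> [g gf /analytic_deriv[A gA]]; exists A, g. Qed.

Lemma chart_deriv_blin f x c d A : chart_deriv f x c d A -> exists D, blin A D.
Proof. by move=> [g _ /is_deriv_near[]]. Qed.

Lemma chart_deriv_unique f x c d A A' : is_chart c -> cdom c x ->
  chart_deriv f x c d A -> chart_deriv f x c d A' -> A = A'.
Proof.
move=> [_ _ _ _ co] cx [g gf gA] [g' gf' gA'].
have [|r r0 rW] := co x [set y | g (c y) = g' (c y)] cx.
  by near=> y; rewrite /= (near gf y)// (near gf' y).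
apply: (is_deriv_unique r0 _ gA gA') => h hr.
have [|y [gy _] <-//] := rW (c x + h).
by rewrite /norm_ball/= addrAC subrr add0r.
Unshelve. all: by end_near.
Qed.

Lemma chart_deriv_comp f h x c d e A B : {for x, continuous f} ->
  chart_deriv f x c d A -> chart_deriv h (f x) d e B ->
  chart_deriv (fun y => h (f y)) x c e (fun v => B (A v)).
Proof.
move=> cf [g gf gA] [k kh kB]; exists (fun v => k (g v)).
  have kf : \forall y \near x, k (d (f y)) = e (h (f y)) := cf _ kh.
  by near=> y; rewrite (near gf y)// (near kf y).
by apply: is_deriv_comp => //; rewrite (nbhs_singleton gf).
Unshelve. all: by end_near.
Qed.

End ChartDerivative.

Section TangentSpaces.

Section OneTangent.
Variables (E : ultraBanach K) (M : manifold E) (x : M).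
Hypothesis hM : analytic_manifold M.
Implicit Types (v w : tangent x) (c d : chart M E).

Lemma tangent_change v c d A : chart_at x c -> chart_at x d ->
  chart_deriv id x c d A -> v d = A (v c).
Proof. by have /asboolP[_] := tcoordP v; exact. Qed.

Lemma transition_deriv c d : chart_at x c -> chart_at x d ->
  exists A, chart_deriv id x c d A.
Proof. by move=> cx dx; apply: chart_deriv_rep; exact: atlas_rep. Qed.

Lemma tangent_inj c v w : chart_at x c -> v c = w c -> v = w.
Proof.
move=> cx vw; apply: val_inj; apply/funext => d.
have [dx|dx] := pselect (chart_at x d).
  have [A dA] := transition_deriv cx dx.
  by rewrite /= (tangent_change v cx dx dA) vw -(tangent_change w cx dx dA).
have /asboolP[v0 _] := tcoordP v; have /asboolP[w0 _] := tcoordP w.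
by rewrite /= v0// w0.
Qed.

(** The value in one chart is carried to the others by the derivatives of the transition maps; the
    chain rule and uniqueness of derivatives make the family coherent. *)
Lemma tangent_exists c u : chart_at x c -> exists v, v c = u.
Proof.
move=> cx; have /choice[T TP] d : exists A : E -> E, chart_at x d -> chart_deriv id x c d A.
  have [dx|dx] := pselect (chart_at x d); last by exists id.
  by have [A dA] := transition_deriv cx dx; exists A.
pose v d := if `[< chart_at x d >] then T d u else 0.
have vE d : chart_at x d -> v d = T d u by move=> /asboolP; rewrite /v => ->.
have ci : {for x, continuous (@id M)} by exact: cvg_id.
have vP : v \in tangent_pred x.
  apply/asboolP; split=> [d dx|d e A dx ex dA]; first by rewrite /v asboolF.
  rewrite !vE//; have [ac cx'] := cx.
  have := chart_deriv_comp ci (TP d dx) dA.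
  by move=> /(chart_deriv_unique (atlas_chart hM ac) cx' (TP e ex)) ->.
exists (Tangent vP); rewrite /= vE//; have [ac cx'] := cx.
have idd : chart_deriv id x c c id.
  exists id; first exact: nearW.
  apply: (is_deriv_intro (D := 1)) (blin_id E) _ => e e0; exists 1 => // h _.
  by rewrite /= [c x + h]addrC addrK subrr norm0 mulr_ge0 ?norm_ge0// ltW.
by rewrite (chart_deriv_unique (atlas_chart hM ac) cx' (TP c cx) idd).
Qed.

Lemma tcoordL k v w c : (k *: v + w) c = k *: v c + w c.
Proof. by []. Qed.

Lemma tangent_nbhsP c v W : chart_at x c -> tangent_nbhs x v W <->
  exists2 r : R, 0 < r & forall u : tangent x, ⟦u c - v c⟧ < r -> W u.
Proof.
move=> cx; split=> [[d dx [r r0 rW]]|[r r0 rW]]; last first.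
  by exists c => //; exists r => // u; rewrite /norm_ball/= => /rW.
have [A dA] := transition_deriv cx dx; have [D bA] := chart_deriv_blin dA.
have [d' d'0 dP] := blin_small bA r0; exists d' => // u /dP h; apply: rW.
change (⟦u d - v d⟧ < r); rewrite !(tangent_change _ cx dx dA) -linB//.
by case: bA.
Qed.

End OneTangent.

(** [tangent_map] is selected by [xget], so an admissible vector has to be exhibited: its value in
    one chart determines it, and the chain rule gives the condition in all other pairs of charts. *)
Lemma tangent_mapE (E F : ultraBanach K) (M : manifold E) (N : manifold F)
    (f : M -> N) (x : M) (y : N) (v : tangent x) c d A :
  analytic_manifold M -> analytic_manifold N -> f x = y -> {for x, continuous f} ->
  chart_at x c -> chart_at y d -> chart_deriv f x c d A ->
  tangent_map f x y v d = A (v c).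
Proof.
move=> hM hN fx cf cx dy dA; rewrite -fx in dy *.
have ci : {for x, continuous (@id M)} by exact: cvg_id.
have [w wd] := tangent_exists hN (A (v c)) dy.
rewrite /tangent_map; case: xgetP => [u _ uP|/(_ w)].
  by rewrite (uP c d A).
case=> c' d' A' cx' dy' dA'.
have [B cB] := transition_deriv hM cx' cx.
have [C dC] := transition_deriv hN dy dy'.
have [ac' cx''] := cx'.
have h1 := chart_deriv_comp ci cB dA.
have h2 := chart_deriv_comp (f := f) (h := id) cf h1 dC.
rewrite (chart_deriv_unique (atlas_chart hM ac') cx'' dA' h2) /=.
by rewrite (tangent_change w dy dy' dC) wd (tangent_change v cx' cx cB).
Qed.

End TangentSpaces.
End Charts.

Lemma analytic_continuous (R : realType) (K : ultraField R) (X Y : ultraBanach K)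
    (g : X -> Y) x : analytic_at g x -> g @ nbh X x --> nbh Y (g x).
Proof.
move=> /analytic_deriv[A /is_deriv_near[[D bA] gA]] W [e /= e0 eW].
have [d d0 dg] := gA 1 ltr01; have [d' d'0 dA] := blin_small bA e0.
exists (Num.min (Num.min d e) d') => [|y]; first by rewrite /= !lt_min d0 e0.
rewrite /norm_ball/= !lt_min => /andP[/andP[yd ye] /dA h]; apply: eW.
rewrite /norm_ball/= -(subrK (A (y - x)) (_ - _)); apply: norm_add_lt h.
have := dg _ yd; rewrite [x + _]addrC subrK mul1r => /le_lt_trans; exact.
Qed.

(** * Coordinates with values in an auxiliary Banach space *)

Section Coordinates.
Variables (R : realType) (K : ultraField R).

(** The inverse [s] is part of the data, so that coordinate changes compose explicitly. [X] is free
    because the coordinate [psi] below takes values in a normed tangent space. *)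
Record homeo_coords (T : topologicalType) (X : ultraBanach K) (D : set T) (c : T -> X)
    (V : set X) (s : X -> T) : Prop := HomeoCoords {
  coords_open : open D;
  coords_image_open : norm_open (@ub_norm R K X) V;
  coordsK : forall x, D x -> V (c x) /\ s (c x) = x;
  coordsV : forall v, V v -> D (s v) /\ c (s v) = v;
  coords_cts : forall x, D x -> c @ x --> nbh X (c x);
  coords_inv_cts : forall x, D x -> forall W, nbhs x W -> nbh X (c x) (s @^-1` W) }.

Lemma is_chart_coords (T : topologicalType) (E : ultraBanach K) (D : set T) (c : T -> E) V s :
  homeo_coords D c V s -> is_chart (Chart D c).
Proof. by case=> *; apply: is_chart_param; eassumption. Qed.

Lemma chart_homeo (T : topologicalType) (E : ultraBanach K) (c : chart T E) x :
  is_chart c -> cdom c x -> exists s, homeo_coords (cdom c) c (c @` cdom c) s.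
Proof.
move=> hc cx; have [s [sK sV sc]] := chart_inverse hc cx; exists s.
have [oD oV _ cc _] := hc; split=> // y cy; split; last exact: sK.
by exists y.
Qed.

Lemma homeo_coords_post (T : topologicalType) (X Y : ultraBanach K) (D : set T)
    (c : T -> X) V s (V1 : set X) (V2 : set Y) (Phi : X -> Y) (Psi : Y -> X) :
  homeo_coords D c V s -> V1 `<=` V ->
  norm_open (@ub_norm R K X) V1 -> norm_open (@ub_norm R K Y) V2 ->
  (forall x, V1 x -> V2 (Phi x) /\ Psi (Phi x) = x) ->
  (forall y, V2 y -> V1 (Psi y) /\ Phi (Psi y) = y) ->
  (forall x, V1 x -> Phi @ nbh X x --> nbh Y (Phi x)) ->
  (forall y, V2 y -> Psi @ nbh Y y --> nbh X (Psi y)) ->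
  homeo_coords [set x | D x /\ V1 (c x)] (fun x => Phi (c x)) V2 (fun y => s (Psi y)).
Proof.
move=> [oD oV cK cV cc cs] V1V oV1 oV2 PhiK PsiK cPhi cPsi; split => //.
- apply: open_nbhsP => x [Dx V1x]; apply: filterI; first exact: open_nbhs_nbhs.
  by apply: cc => //; exact: oV1.
- by move=> x [Dx /PhiK[V2x ->]]; split=> //; exact: (cK x Dx).2.
- move=> y /[dup] V2y /PsiK[V1y py]; have [Ds cy] := cV _ (V1V _ V1y).
  by rewrite /= cy.
- by move=> x [Dx V1x] W /(cPhi _ V1x) /(cc _ Dx).
- move=> x [Dx V1x] W xW; have [V2x px] := PhiK _ V1x.
  by have := cs x Dx W xW; rewrite -{1}px => /(cPsi _ V2x).
Qed.

Section OneManifold.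
Variables (E : ultraBanach K) (M : manifold E).
Hypothesis hM : analytic_manifold M.

Definition coords (X : ultraBanach K) (D : set M) (c : M -> X) (V : set X) (s : X -> M) :=
  homeo_coords D c V s /\ forall x d, D x -> chart_at x d -> rep_at id x d c /\ rep_at id x c d.

Lemma chart_coords (c : chart M E) x : chart_at x c ->
  exists s, coords (cdom c) c (c @` cdom c) s.
Proof.
move=> [ac cx]; have [s hs] := chart_homeo (atlas_chart hM ac) cx; exists s; split=> //.
by move=> y d cy dy; split; apply: atlas_rep.
Qed.

Lemma coords_atlas (D : set M) (c : M -> E) V s : coords D c V s -> atlas (Chart D c).
Proof.
move=> [hc rc]; apply: (atlas_criterion hM); first exact: is_chart_coords hc.
move=> x Dx; have [d dx] := chart_exists hM x; exists d; split=> //.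
- exact: (rc x d Dx dx).2.
- exact: (rc x d Dx dx).1.
Qed.

Lemma coords_post (X Y : ultraBanach K) (D : set M) (c : M -> X) V s
    (V1 : set X) (V2 : set Y) (Phi : X -> Y) (Psi : Y -> X) :
  coords D c V s -> V1 `<=` V ->
  norm_open (@ub_norm R K X) V1 -> norm_open (@ub_norm R K Y) V2 ->
  (forall x, V1 x -> V2 (Phi x) /\ Psi (Phi x) = x) ->
  (forall y, V2 y -> V1 (Psi y) /\ Phi (Psi y) = y) ->
  (forall x, V1 x -> analytic_at Phi x) ->
  (forall y, V2 y -> analytic_at Psi y) ->
  coords [set x | D x /\ V1 (c x)] (fun x => Phi (c x)) V2 (fun y => s (Psi y)).
Proof.
move=> [hc rc] V1V oV1 oV2 PhiK PsiK aPhi aPsi; split.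
  apply: homeo_coords_post hc V1V oV1 oV2 PhiK PsiK _ _.
    by move=> x /aPhi; exact: analytic_continuous.
  by move=> x /aPsi; exact: analytic_continuous.
have ci (x : M) : {for x, continuous id} by exact: cvg_id.
move=> x d [Dx V1x] dx; have [r1 r2] := rc x d Dx dx.
have [V2x px] := PhiK _ V1x; split.
  apply: (rep_at_comp (f := id) (h := id) (ci x) r1).
  exact: rep_at_fun (aPhi _ V1x).
apply: (rep_at_comp (f := id) (h := id) (ci x) _ r2).
exists Psi; last by apply: aPsi.
have [_ _ _ _ cc _] := hc.
have V1n : nbhs x (c @^-1` V1) := cc x Dx V1 (oV1 _ V1x); apply: filterS V1n => y V1y.
exact: (PhiK _ V1y).2.
Qed.

End OneManifold.

Lemma coords_map (E F X Y : ultraBanach K) (M : manifold E) (N : manifold F)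
    (D1 : set M) (d1 : M -> X) V1 s1 (D2 : set N) (d2 : N -> Y) V2 s2
    (L : X -> Y) (h : M -> N) x :
  coords D1 d1 V1 s1 -> coords D2 d2 V2 s2 -> D1 x -> D2 (h x) ->
  (\forall y \near x, h y = s2 (L (d1 y))) -> (\forall y \near x, V2 (L (d1 y))) ->
  analytic_at L (d1 x) -> {for x, continuous h} /\ rep_at h x d1 d2.
Proof.
move=> [[oD1 oV1 K1 W1 c1 i1] r1] [[oD2 oV2 K2 W2 c2 i2] r2] Dx Dhx hE hV aL.
have hx := nbhs_singleton hE; have Vx := nbhs_singleton hV.
split.
  move=> W hxW; have := i2 _ Dhx _ hxW; rewrite hx (W2 _ Vx).2.
  move/(analytic_continuous aL)/(c1 _ Dx) => near_s.
  rewrite /nbhs/=/fmap/=; near=> y.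
  by rewrite /= (near hE y)//; near: y.
exists L => //; near=> y.
by rewrite (near hE y)// (W2 _ _).2//; near: y.
Unshelve. all: by end_near.
Qed.

Section TangentImages.
Variables (E F : ultraBanach K) (M : manifold E) (N : manifold F).
Variables (f : N -> M) (x : N) (y : M) (c : chart N F) (d : chart M E) (A : F -> E).
Hypotheses (hM : analytic_manifold M) (hN : analytic_manifold N) (fx : f x = y)
  (cf : {for x, continuous f}) (cx : chart_at x c) (dy : chart_at y d)
  (dA : chart_deriv f x c d A).

Lemma tangent_range : range (tangent_map f x y) = [set w : tangent y | range A (w d)].
Proof.
apply/seteqP; split=> [_ [v _ <-]|w [u _ Au]].
  by exists (v c) => //; rewrite (tangent_mapE v hN hM fx cf cx dy dA).
have [v vc] := tangent_exists hN u cx; exists v => //.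
by apply: (tangent_inj hM dy); rewrite (tangent_mapE v hN hM fx cf cx dy dA) vc.
Qed.

Lemma tangent_injective : injective (tangent_map f x y) <-> injective A.
Proof.
have tE v := tangent_mapE v hN hM fx cf cx dy dA.
split=> inj.
  move=> u u' Au; have [v vc] := tangent_exists hN u cx.
  have [v' vc'] := tangent_exists hN u' cx.
  by rewrite -vc -vc'; congr (tcoord _ _); apply: inj; apply: (tangent_inj hM dy); rewrite !tE vc vc'.
move=> v v' vv'; apply: (tangent_inj hN cx); apply: inj.
by rewrite -!tE vv'.
Qed.

Lemma tangent_complemented (p : E -> E) D : blin p D -> (forall u, p (p u) = p u) ->
  range p = range A -> complemented (tangent_nbhs y) (range (tangent_map f x y)).
Proof.
move=> bp pp pA; have [lp D0 pD] := bp.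
have /choice[q qE] (w : tangent y) : exists v : tangent y, v d = p (w d).
  exact: tangent_exists.
exists q; split.
- by move=> k u v; apply: (tangent_inj hM dy); rewrite qE !tcoordL !qE lp.
- move=> w W /(tangent_nbhsP hM _ _ dy)[r r0 rW]; apply/(tangent_nbhsP hM _ _ dy).
  have [d' d'0 dP] := blin_small bp r0; exists d' => // u /dP h.
  by apply: rW; rewrite !qE -(linB _ _ lp).
- by move=> w; apply: (tangent_inj hM dy); rewrite !qE pp.
rewrite tangent_range -pA; apply/seteqP; split=> [_ [w _ <-]|w [u _ uw]].
  by exists (w d); rewrite // qE.
by exists w => //; apply: (tangent_inj hM dy); rewrite qE -uw pp.
Qed.

End TangentImages.

Lemma chart_deriv_linear (M N : topologicalType) (E F : ultraBanach K) (f : M -> N) x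
    (c : chart M E) (d : chart N F) (A : E -> F) D : blin A D ->
  (\forall y \near x, d (f y) = A (c y)) -> chart_deriv f x c d A.
Proof.
move=> bA fA; exists A; first by apply: filterS fA => y ->.
have [lA _ _] := bA; apply: is_deriv_intro bA _ => e e0; exists 1 => // h _.
by rewrite (linD _ _ lA) [A _ + _]addrC addrK subrr norm0 mulr_ge0 ?norm_ge0// ltW.
Qed.

Section SingleChart.
Variables (T : topologicalType) (F : ultraBanach K) (c0 : T -> F) (V : set F) (s : F -> T).
Hypotheses (hT : hausdorff_space T) (hc0 : homeo_coords setT c0 V s).

(** The maximal atlas generated by one global chart. *)
Definition single_chart_manifold : manifold F :=
  @Manifold R K F T [set c | is_chart c /\
    forall x, cdom c x -> rep_at id x c c0 /\ rep_at id x c0 c].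

Lemma single_chart_atlas : @atlas R K F single_chart_manifold (Chart setT c0).
Proof. by split; [exact: is_chart_coords hc0|move=> x _; split; exact: rep_at_id]. Qed.

Lemma single_chart_analytic : analytic_manifold single_chart_manifold.
Proof.
have ci (x : T) : {for x, continuous id} by exact: cvg_id.
split=> //.
- by move=> c [].
- by move=> x; exists (Chart setT c0) => //; exact: single_chart_atlas.
- move=> c d [hc rc] [hd rd]; apply: transition_of_rep => // x cx dx.
  exact: (rep_at_comp (f := id) (h := id) (ci x) (rc x cx).1 (rd x dx).2).
- move=> c hc cP; split=> // x cx.
  have h0 := is_chart_coords hc0; have [t1 t2] := cP _ single_chart_atlas.
  by split; [exact: rep_of_transition hc h0 cx I t1|exact: rep_of_transition h0 hc I cx t2].
Qed.

Lemma single_chart_coords : @coords F single_chart_manifold F setT c0 V s.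
Proof.
split=> // x d _ dx.
have c0x : chart_at (M := single_chart_manifold) x (Chart setT c0).
  by split=> //; exact: single_chart_atlas.
split; first exact: (atlas_rep single_chart_analytic dx c0x).
exact: (atlas_rep single_chart_analytic c0x dx).
Qed.

End SingleChart.

End Coordinates.

(** * Open submanifolds *)

Section SubtypeTopology.
Variables (T : topologicalType) (U : set T).

Lemma sub_val_continuous (x : set_type U) : {for x, continuous (set_val : set_type U -> T)}.
Proof. exact: initial_continuous. Qed.

Lemma sub_nbhsP (x : set_type U) (W : set (set_type U)) : nbhs x W <->
  exists2 W' : set T, nbhs (set_val x) W' & (set_val : set_type U -> T) @^-1` W' `<=` W.
Proof.
split=> [|[W' xW' WW]].
  move=> [_ [ [A oA <-] /= Ox] AW]; exists A => //.
  exact: open_nbhs_nbhs.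
by apply: filterS WW _; exact: sub_val_continuous.
Qed.

Lemma sub_nbhs_open (x : set_type U) (W : set T) : open U ->
  nbhs x ((set_val : set_type U -> T) @^-1` W) -> nbhs (set_val x) W.
Proof.
move=> oU /sub_nbhsP[W' xW' WW].
have xU : nbhs (set_val x) U by apply: open_nbhs_nbhs; split=> //; exact: set_valP.
apply: filterS (filterI xU xW') => y [Uy W'y].
by have := WW (exist _ y (mem_set Uy)) W'y.
Qed.

Lemma sub_hausdorff : hausdorff_space T -> hausdorff_space (set_type U).
Proof.
move=> hT x y xy; apply: val_inj; apply: hT => A B xA yB.
have [z [Az Bz]] := xy _ _ (sub_val_continuous xA) (sub_val_continuous yB).
by exists (set_val z).
Qed.

End SubtypeTopology.

Section OpenSubmanifold.
Variables (R : realType) (K : ultraField R) (F : ultraBanach K) (N : manifold F).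
Variable U : set N.
Hypotheses (hN : analytic_manifold N) (oU : open U).
Local Notation inc := (set_val : set_type U -> N).

Definition sub_chart (d : chart N F) : chart (set_type U) F :=
  Chart (inc @^-1` cdom d) (fun y => d (inc y)).

Lemma sub_chart_atlas d : atlas d -> cdom d `<=` U ->
  @atlas R K F (open_submanifold U) (sub_chart d).
Proof. by move=> ad dU; exists d. Qed.

Lemma sub_is_chart (c : chart (set_type U) F) (d : chart N F) : is_chart d ->
  cdom d `<=` U -> cdom c = inc @^-1` cdom d ->
  (forall y, cdom c y -> c y = d (inc y)) -> is_chart c.
Proof.
move=> hd dU Dc cd; have [od od' inj dc do_] := hd.
have oc : open (cdom c).
  rewrite Dc; apply: open_nbhsP => y dy; apply: sub_val_continuous.
  exact: chart_near.
have lift x : cdom d x -> exists y, [/\ inc y = x, cdom c y & c y = d x].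
  move=> dx; have yP : cdom c (exist _ x (mem_set (dU x dx))) by rewrite Dc.
  by exists (exist _ x (mem_set (dU x dx))); split=> //; rewrite cd.
have im : c @` cdom c = d @` cdom d.
  apply/seteqP; split=> [_ [y cy <-]|_ [x dx <-]].
    by exists (inc y); [rewrite Dc in cy|rewrite cd].
  by have [y [_ cy <-]] := lift x dx; exists y.
split=> //; first by rewrite im.
- move=> y z /set_mem cy /set_mem cz; rewrite !cd// => dd; apply: val_inj.
  by apply: inj => //; apply/mem_set; [rewrite Dc in cy|rewrite Dc in cz].
- move=> y cy; rewrite (cd y cy) => W dW.
  have dy : cdom d (inc y) by rewrite Dc in cy.
  have h1 : nbhs y (inc @^-1` (d @^-1` W)) by apply: sub_val_continuous; exact: dc.
  have h2 : nbhs y (cdom c) by apply: open_nbhs_nbhs.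
  by apply: filterS (filterI h1 h2) => z [Wz cz]; rewrite /= cd.
- move=> y W cy yW; have [W' yW' WW] := (sub_nbhsP y W).1 yW.
  have dy : cdom d (inc y) by rewrite Dc in cy.
  have [e e0 eW] := do_ _ _ dy yW'; exists e => //.
  rewrite cd// => v /eW[x [W'x dx] <-]; have [z [zx cz cdz]] := lift x dx.
  by exists z; rewrite // -zx in W'x *; split=> //; exact: WW.
Qed.

Lemma rep_at_val (X Y : ultraBanach K) (c : set_type U -> X) (d : set_type U -> Y)
    (c' : N -> X) (d' : N -> Y) (y : set_type U) :
  (\forall z \near y, c z = c' (inc z)) -> (\forall z \near y, d z = d' (inc z)) ->
  rep_at id y c d <-> rep_at id (inc y) c' d'.
Proof.
move=> cc dd; have cy := nbhs_singleton cc.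
split=> [[g gE ag]|[g gE ag]]; exists g; rewrite -?cy// in ag *.
  apply: (sub_nbhs_open oU).
  by near=> z; rewrite /= -(near cc z)// (near gE z)// (near dd z).
have gE' : \forall z \near y, g (c' (inc z)) = d' (inc z) := sub_val_continuous gE.
by near=> z; rewrite (near cc z)// (near gE' z)// (near dd z).
Unshelve. all: by end_near.
Qed.

Lemma sub_chart_at (x : N) : U x -> exists2 d : chart N F, chart_at x d & cdom d `<=` U.
Proof.
move=> Ux; have [e [ae ex]] := chart_exists hN x.
exists (Chart (cdom e `&` U) e) => [|y []//]; split; last by split.
apply: (atlas_restrict hN ae) => [|y []//].
by apply: openI => //; have [] := atlas_chart hN ae.
Qed.

Lemma open_submanifold_analytic : analytic_manifold (open_submanifold U).
Proof.
have hch (c : chart (set_type U) F) : @atlas R K F (open_submanifold U) c -> is_chart c.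
  move=> [d [ad dU Dc cd]]; exact: sub_is_chart (atlas_chart hN ad) dU Dc cd.
split.
- by apply: sub_hausdorff; case: hN.
- exact: hch.
- move=> x; have [d [ad dx] dU] := sub_chart_at (set_valP x).
  by exists (sub_chart d) => //; exact: sub_chart_atlas.
- move=> c d ac ad; have hc := hch c ac; have hd := hch d ad.
  apply: (@transition_of_rep R K F (open_submanifold U)) => // x cx dx.
  have [c' [ac' _ Dc cE]] := ac; have [d' [ad' _ Dd dE]] := ad.
  apply/(@rep_at_val F F c d c' d' x).
  + by have := chart_near hc cx; apply: filterS => z; exact: cE.
  + by have := chart_near hd dx; apply: filterS => z; exact: dE.
  by apply: (atlas_rep hN); split=> //; [rewrite Dc in cx|rewrite Dd in dx].
move=> c hc cP; have [oc oc' inj cc co] := hc.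
(* For maximality, a chart of the subtype has to come from a chart of [N]: it is transported to its
   image and extended by 0 off [U]. *)
pose d : chart N F := Chart (inc @` cdom c)
  (fun x => if pselect (U x) is left Ux then c (exist _ x (mem_set Ux)) else 0).
have dE y : d (inc y) = c y.
  rewrite /=; case: pselect => [Uy|]; last by case; exact: set_valP.
  by congr (cmap c _); apply: val_inj.
have dom_inc y : cdom d (inc y) <-> cdom c y.
  by split=> [[z cz /val_inj <-]//|cy]; exists y.
exists d; split.
- apply: (atlas_criterion hN).
    have im : d @` cdom d = c @` cdom c.
      apply/seteqP; split=> [_ [_ [y cy <-] <-]|_ [y cy <-]]; first by rewrite dE; exists y.
      by exists (inc y); [exists y|rewrite dE].
    split; first 2 last.
    + move=> _ _ /set_mem[y cy <-] /set_mem[z cz <-]; rewrite !dE => yz.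
      by congr (inc _); apply: inj => //; exact/mem_set.
    + move=> _ [y cy <-] W; rewrite dE => /(cc _ cy) h.
      have h' : nbhs y (c @^-1` W) := h.
      by apply: (sub_nbhs_open oU); apply: filterS h' => z; rewrite /preimage/= -dE.
    + move=> _ W [y cy <-] yW; rewrite dE.
      have [e e0 eW] := co y (inc @^-1` W) cy (sub_val_continuous yW).
      by exists e => // v /eW[z [Wz cz] <-]; exists (inc z); rewrite ?dE//; split=> //; exists z.
    + apply: open_nbhsP => _ [y cy <-]; apply: (sub_nbhs_open oU).
      have ny : nbhs y (cdom c) by apply: open_nbhs_nbhs.
      by apply: filterS ny => z cz; exists z.
    + by rewrite im.
  move=> _ [y cy <-]; have [e [ae ey] eU] := sub_chart_at (set_valP y).
  exists e; have [t1 t2] := cP _ (sub_chart_atlas ae eU).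
  have nc : \forall z \near y, cdom c z by apply: open_nbhs_nbhs.
  have cd : \forall z \near y, c z = d (inc z) by apply: filterS nc => z _; rewrite dE.
  have ee : \forall z \near y, sub_chart e z = e (inc z) by apply: filterS nc.
  have he := hch _ (sub_chart_atlas ae eU).
  split=> //.
    by apply/(rep_at_val cd ee); exact: rep_of_transition hc he cy ey t1.
  by apply/(rep_at_val ee cd); exact: rep_of_transition he hc ey cy t2.
- by move=> _ [y _ <-]; exact: set_valP.
- by apply/seteqP; split=> y /dom_inc.
- by move=> y _; rewrite dE.
Unshelve. all: by end_near.
Qed.

End OpenSubmanifold.

(** * The linear model at the fixed point *)

Section Model.
Variables (R : realType) (K : ultraField R) (E : ultraBanach K) (M : manifold E) (p : M).
Hypothesis hM : analytic_manifold M.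
Variable c0 : chart M E.
Hypothesis c0p : chart_at p c0.
Variable n : tangent p -> R.
Hypotheses (hn : ultrametric_norm n) (nb : forall v, norm_nbhs n v = tangent_nbhs p v).

(** [n] and the norm of [E] read in [c0] define the same linear topology, hence have the same Cauchy
    sequences; completeness is inherited from [E]. *)
Lemma tangent_norm_complete : norm_complete n.
Proof.
move=> u cu.
have small e : 0 < e -> exists2 d, 0 < d & forall v, n v < d -> ⟦v c0⟧ < e.
  move=> e0; have : norm_nbhs n 0 [set v : tangent p | ⟦v c0⟧ < e].
    rewrite nb; apply/(tangent_nbhsP hM _ _ c0p); exists e => // v.
    by rewrite subr0.
  by move=> [d d0 dv]; exists d => // v vd; apply: dv; rewrite /norm_ball/= subr0.
have [e e0|l ul] := @ub_complete _ _ E (fun i => u i c0).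
  have [d d0 dv] := small e e0; have [N HN] := cu d d0; exists N => i j Ni Nj.
  exact: (dv (u i - u j) (HN i j Ni Nj)).
have [v vl] := tangent_exists hM l c0p; exists v => W.
rewrite nb => /(tangent_nbhsP hM _ _ c0p)[r r0 rW].
have [N _ HN] := ul _ (ex_intro2 _ _ r r0 (fun _ => id)).
by exists N => // i /= Ni; apply: rW; rewrite vl; exact: HN.
Qed.

Definition tangent_banach := UltraBanach hn tangent_norm_complete.

Lemma tangent_coordinates : exists (D D' : R) (ki : E -> tangent_banach),
  [/\ blin (fun v : tangent_banach => (v : tangent p) c0) D, blin ki D',
      forall v : tangent_banach, ki ((v : tangent p) c0) = v &
      forall e, (ki e : tangent p) c0 = e].
Proof.
have /choice[ki kiE] e : exists v : tangent p, v c0 = e by exact: tangent_exists.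
pose k (v : tangent_banach) : E := (v : tangent p) c0.
have kiK (v : tangent p) : ki (v c0) = v by apply: (tangent_inj hM c0p); rewrite kiE.
have lk : linear k by [].
have lki : linear (ki : E -> tangent_banach).
  by move=> a x y; apply: (tangent_inj hM c0p); rewrite kiE tcoordL !kiE.
have [D bk] : exists D, blin k D.
  apply: continuous_blin lk _ => v W [e /= e0 eW].
  change (norm_nbhs n v (k @^-1` W)); rewrite nb.
  by apply/(tangent_nbhsP hM _ _ c0p); exists e => // w wv; exact: eW.
have [D' bki] : exists D, blin (ki : E -> tangent_banach) D.
  apply: continuous_blin lki _ => e W.
  change (norm_nbhs n (ki e) W -> nbh E e (ki @^-1` W)).
  rewrite nb => /(tangent_nbhsP hM _ _ c0p)[r r0 rW]; exists r => // e'.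
  by rewrite /norm_ball/= => h; apply: rW; rewrite !kiE.
by exists D, D', ki.
Qed.

End Model.

Lemma opnorm_on_le (R : realType) (K : ultraField R) (V : lmodType K) (n : V -> R)
    (S : set V) (A : V -> V) (c : R) : ultrametric_norm n ->
  (forall x, n x = 0 -> n (A x) = 0) -> (opnorm_on n S A <= c%:E)%E ->
  forall x, S x -> n (A x) <= c * n x.
Proof.
move=> [n0 nz _ _] A0 Ac x Sx; have [nx0|nx] := eqVneq (n x) 0.
  by rewrite (A0 x nx0) nx0 mulr0.
have nx0 : 0 < n x by rewrite lt_neqAle eq_sym nx n0.
rewrite -ler_pdivrMr// -lee_fin; apply: le_trans Ac.
by apply: ereal_sup_ubound; exists x.
Qed.

(** If the operator norm is 0, its inverse is +oo and q = 0 will do; the value +oo has inverse 0 and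
    contradicts 0 < a. *)
Lemma opnorm_on_inv (R : realType) (K : ultraField R) (V : lmodType K) (n : V -> R)
    (T : set V) (A : V -> V) (a : R) : T 0 -> ultrametric_norm n -> 0 < a ->
  (a%:E < (opnorm_on n T A)^-1)%E ->
  exists q : R, [/\ 0 <= q, a * q < 1 & (opnorm_on n T A <= q%:E)%E].
Proof.
move=> T0 [n0 nz _ _] a0.
have : (0 <= opnorm_on n T A)%E.
  have /le_trans : (0 <= (n (A 0) / n 0)%:E :> \bar R)%E by rewrite lee_fin divr_ge0.
  by apply; apply: ereal_sup_ubound; exists 0.
case: opnorm_on => [q| |]//.
  rewrite lee_fin => q0; rewrite /inve; case: ifPn => [/eqP -> _|qn].
    by exists 0; split; rewrite ?mulr0 ?ltr01.
  rewrite lte_fin => aq; exists q; split=> //.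
  have qp : 0 < q by rewrite lt_neqAle eq_sym qn.
  by rewrite -ltr_pdivlMr// mul1r.
by rewrite /inve lte_fin ltNge (ltW a0).
Qed.

Section Decomposition.
Variables (K : fieldType) (V : lmodType K) (S T : set V).
Hypotheses (hS : subspace_set S) (hT : subspace_set T) (ST : S `&` T = [set 0])
  (STV : [set x + y | x in S & y in T] = setT).

Lemma subspaceB (U : set V) x y : subspace_set U -> U x -> U y -> U (x - y).
Proof. by move=> [_ UL] Ux Uy; rewrite addrC -scaleN1r; exact: UL. Qed.

Lemma decomposition_projection : exists P : V -> V, [/\ linear P, forall x, S (P x),
  forall x, T (x - P x), forall x, S x -> P x = x & forall x, T x -> P x = 0].
Proof.
have /choice[P PP] x : exists y, S y /\ T (x - y).
  have : [set x + y | x in S & y in T] x by rewrite STV.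
  by move=> [y Sy [z Tz <-]]; exists y; rewrite addrAC subrr add0r.
have uniq x y : S y -> T (x - y) -> P x = y.
  move=> Sy Tz; have [SPx TQx] := PP x; apply/eqP; rewrite -subr_eq0; apply/eqP.
  suff : (S `&` T) (P x - y) by rewrite ST.
  split; first exact: subspaceB.
  have -> : P x - y = (x - y) - (x - P x).
    by rewrite opprB [RHS]addrC addrA subrK.
  exact: subspaceB.
have [S0 SL] := hS; have [T0 TL] := hT.
exists P; split.
- move=> k x y; have [SPx TQx] := PP x; have [SPy TQy] := PP y; apply: uniq; first exact: SL.
  by rewrite opprD addrACA -scalerBr; exact: TL.
- by move=> x; case: (PP x).
- by move=> x; case: (PP x).
- by move=> x Sx; apply: uniq; rewrite ?subrr.
- by move=> x Tx; apply: uniq; rewrite ?subr0.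
Qed.

End Decomposition.

Lemma centre_stable_model (R : realType) (K : ultraField R) (E : ultraBanach K)
    (M : manifold E) (f : M -> M) (p : M) (c0 : chart M E) (A0 : E -> E) (a : R)
    (Tcs : set (tangent p)) :
  analytic_manifold M -> f p = p -> {for p, continuous f} -> chart_at p c0 ->
  chart_deriv f p c0 c0 A0 -> 0 < a <= 1 ->
  centre_stable_subspace (tangent_nbhs p) (tangent_map f p p) a Tcs ->
  exists (X : ultraBanach K) (k : X -> E) (ki : E -> X) (P beta : X -> X) (q D D' : R),
    [/\ blin k D, blin ki D', forall x, ki (k x) = x, forall e, k (ki e) = e &
      splitting (fun x => ki (A0 (k x))) P beta a q /\
      forall v : tangent p, Tcs v <-> P (ki (v c0)) = ki (v c0)].
Proof.
move=> hM fp cf c0p dA ha; have /andP[a0 a1] := ha.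
set alpha := tangent_map f p p.
move=> [hS [aS [T [hT aT [ST STV] [beta [bT ba ab [n [hn nb nmax nS nT]]]]]]]].
have [D [D' [ki [bk bki kiK kiE]]]] := tangent_coordinates hM c0p hn nb.
have [P [lP SP TQ PS PT]] := decomposition_projection hS hT ST STV.
have aE (v : tangent p) : (alpha v) c0 = A0 (v c0).
  by rewrite /alpha (tangent_mapE v hM hM fp cf c0p c0p dA).
have alphaE (v : tangent p) : ki (A0 (v c0)) = alpha v.
  by apply: (tangent_inj hM c0p); rewrite kiE aE.
have [DA bA] := chart_deriv_blin dA; have [lA _ _] := bA.
have [q [q0 aq nq]] := opnorm_on_inv hT.1 hn a0 nT.
have la : linear alpha.
  by move=> r v w; apply: (tangent_inj hM c0p); rewrite tcoordL !aE tcoordL lA.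
have S0 := hS.1; have T0 := hT.1.
have a0' : alpha 0 = 0 by have := la (-1) 0 0; rewrite !scaleN1r oppr0 addr0 addNr.
have [n0 nz nZ nU] := hn.
have laB v w : alpha (v - w) = alpha v - alpha w.
  by rewrite addrC -scaleN1r la scaleN1r addrC.
(* Nothing is known of [beta] off [T]; on [T] it is linear, being the inverse of a linear map. *)
have lb v w r : T v -> T w -> beta (r *: v + w) = r *: beta v + beta w.
  move=> Tv Tw; have bv := bT _ (ex_intro2 _ _ v Tv erefl).
  have bw := bT _ (ex_intro2 _ _ w Tw erefl).
  by rewrite -[in LHS](ab v Tv) -[in LHS](ab w Tw) -la ba//; exact: hT.2.
pose X := tangent_banach hM c0p hn nb.
have aST v : P (alpha v) = alpha (P v).
  have -> : alpha v = alpha (P v) + alpha (v - P v) by rewrite laB addrC subrK.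
  rewrite -[alpha (P v)]scale1r lP scale1r (PS _ (aS _ (ex_intro2 _ _ _ (SP v) erefl))).
  by rewrite (PT _ (aT _ (ex_intro2 _ _ _ (TQ v) erefl))) addr0 scale1r.
have b0 : beta 0 = 0 by rewrite -{1}a0' ba.
have nPQ v : n v = Num.max (n (P v)) (n (v - P v)) by rewrite -nmax// addrC subrK.
have nQ v : n (v - P v) <= n v by rewrite [leRHS]nPQ le_max lexx orbT.
(* Precomposing [beta] with [v - P v] makes it linear everywhere and 0 on the centre-stable
   subspace. *)
exists X, (fun v : X => (v : tangent p) c0), ki, P, (fun v => beta (v - P v)), q, D, D'.
split=> //; split; last first.
  by move=> v; rewrite kiK; split=> [/PS//|<-].
have aTQ v : T (alpha (v - P v)) by apply: aT; exists (v - P v).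
split=> //.
- by move=> x; rewrite PS.
- exists (D' * (DA * D)); exact: blin_comp (blin_comp bk bA) bki.
- by move=> x; rewrite !alphaE aST.
- move=> x; rewrite alphaE.
  apply: (opnorm_on_le hn _ nS (SP x)) => y /nz ->; rewrite a0'; exact/nz.
- move=> r v w; rewrite -lb//; congr beta.
  by rewrite lP opprD addrACA scalerBr.
- move=> x; apply: PT; apply: bT; exists (x - P x) => //.
- by move=> x; rewrite (PS _ (SP x)) subrr b0.
- by move=> x; rewrite alphaE ab.
- by move=> x; rewrite alphaE aST -laB ba.
- move=> x; apply: le_trans (_ : q * n (x - P x) <= _); last by rewrite ler_wpM2l.
  apply: (opnorm_on_le hn _ nq (TQ x)) => y /nz ->; rewrite b0; exact/nz.
Qed.

(** * The map near its fixed point *)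

Section Balls.
Variables (R : realType) (K : ultraField R).

Definition zero_ball (X : ultraBanach K) (r : R) : set X := [set x | ⟦x⟧ < r].
Arguments zero_ball : clear implicits.

Lemma zero_ball_open (X : ultraBanach K) r : norm_open (@ub_norm R K X) (zero_ball X r).
Proof.
move=> x xr; exists r; first by apply: le_lt_trans xr; exact: norm_ge0.
by move=> y yx; rewrite /zero_ball/= -(subrK x y); exact: norm_add_lt.
Qed.

Lemma preimage_open (X Y : ultraBanach K) (g : X -> Y) V : (forall x, analytic_at g x) ->
  norm_open (@ub_norm R K Y) V -> norm_open (@ub_norm R K X) (g @^-1` V).
Proof. by move=> ag oV x Vx; exact: (analytic_continuous (ag x)) (oV _ Vx). Qed.

Lemma analytic_affine (X Y : ultraBanach K) (L : X -> Y) D e x : blin L D ->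
  analytic_at (fun y => L y + e) x.
Proof.
move=> bL; apply: analytic_atD; [exact: analytic_at_blin bL|exact: analytic_at_cst].
Qed.

End Balls.
Arguments zero_ball {R K} X r.

(* The map [f] near its fixed point [p], written in a coordinate [psi] with values
   in [X], together with the function [phi] whose graph over the fixed space of [P]
   is the local centre-stable manifold. *)
Record local_model (R : realType) (K : ultraField R) (E X : ultraBanach K)
    (M : manifold E) (M0 : set M) (f : M -> M) (p : M) (a : R) (c0 : chart M E)
    (k : X -> E) (ki : E -> X) (P phi ft : X -> X) (rho : R)
    (psi : M -> X) (D0 : set M) (sig : X -> M) : Prop := LocalModel {
  lm_a : 0 < a <= 1;
  lm_k : exists D, blin k D;
  lm_ki : exists D, blin ki D;
  lm_kiK : forall x, ki (k x) = x;
  lm_kK : forall e, k (ki e) = e;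
  lm_P : linear P;
  lm_PP : forall x, P (P x) = P x;
  lm_max : forall x, ⟦x⟧ = Num.max ⟦P x⟧ ⟦x - P x⟧;
  lm_rho : 0 < rho;
  lm_psi : forall y, psi y = ki (c0 y - c0 p);
  lm_coords : coords D0 psi (zero_ball X rho) sig;
  lm_p : D0 p;
  lm_M0 : D0 `<=` M0;
  lm_f : forall x, ⟦x⟧ < rho -> psi (f (sig x)) = ft x;
  lm_fsig : forall x, ⟦x⟧ < rho -> f (sig x) = sig (ft x);
  lm_ft : forall x, ⟦x⟧ < rho -> analytic_at ft x;
  lm_ft_le : forall x, ⟦x⟧ < rho -> ⟦P (ft x)⟧ <= a * ⟦x⟧;
  lm_phi : forall x, ⟦x⟧ < rho -> analytic_at phi x;
  lm_phiP : forall x, phi (P x) = phi x;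
  lm_Pphi : forall x, P (phi x) = 0;
  lm_phi2 : exists2 D, 0 <= D & forall x, ⟦x⟧ < rho -> ⟦phi x⟧ <= D * ⟦x⟧ ^+ 2;
  lm_phi_le : forall x, ⟦x⟧ < rho -> ⟦phi x⟧ <= ⟦P x⟧;
  lm_graph : forall x, ⟦x⟧ < rho -> let y := ft (P x + phi x) in
    ⟦P y⟧ <= a * ⟦P x⟧ /\ y = P y + phi y;
  lm_uniq : forall z D, (forall n, ⟦z n⟧ < rho) -> (forall n, z n.+1 = ft (z n)) ->
    (forall n, ⟦z n⟧ <= D * a ^+ n) -> z 0 = P (z 0) + phi (z 0) }.

Lemma local_model_exists (R : realType) (K : ultraField R) (E : ultraBanach K)
    (M : manifold E) (M0 : set M) (f : M -> M) (p : M) (a : R) (Tcs : set (tangent p))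
    (c0 : chart M E) :
  analytic_manifold M -> analytic_map M0 f -> M0 p -> f p = p -> 0 < a <= 1 ->
  centre_stable_subspace (tangent_nbhs p) (tangent_map f p p) a Tcs -> chart_at p c0 ->
  exists (X : ultraBanach K) (k : X -> E) (ki : E -> X) (P phi ft : X -> X) (rho : R)
    (psi : M -> X) (D0 : set M) (sig : X -> M),
    local_model M0 f p a c0 k ki P phi ft rho psi D0 sig /\
    forall v : tangent p, Tcs v <-> P (ki (v c0)) = ki (v c0).
Proof.
move=> hM hf hp fp ha hcs c0p; have [oM0 cf _] := hf.
have c0fp : chart_at (f p) c0 by rewrite fp.
have [g0 g0f ag0] := analytic_map_rep hM hM hf hp c0p c0fp.
have [A0 dA0] := analytic_deriv ag0.
have dA : chart_deriv f p c0 c0 A0 by exists g0.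
have [X [k [ki [P [beta [q [D [D' [bk bki kiK kK [spl TcsP]]]]]]]]]] :=
  centre_stable_model hM fp (cf p hp) c0p dA ha hcs.
have [lk Dk0 kD] := bk; have [lki Dki0 kiD] := bki.
pose ft x := ki (g0 (c0 p + k x) - c0 p).
have g0p : g0 (c0 p) = c0 p by rewrite (nbhs_singleton g0f) fp.
have ft0 : ft 0 = 0 by rewrite /ft (lin0 lk) addr0 g0p subrr (lin0 lki).
have [aft dft] : analytic_at ft 0 /\ has_deriv ft 0 (fun x => ki (A0 (k x))).
  exact: (affine_conjugate (c0 p) bk bki ag0 dA0).
have [b [C [N [r1 [Pb b0 b1 r10 bft]]]]] := analytic_series aft dft; rewrite ft0 in b0.
have bft' y : ⟦y⟧ < r1 -> sums_to b y (ft y) by move=> /bft; rewrite add0r.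
have [phi [r [[/andP[r0 rr1] phiP] aphi [Pphi phi2] graph uniq]]] :=
  local_centre_stable spl Pb b0 b1 r10 bft'.
have [r2 r20 aft2] := analytic_at_near aft.
have [_ small] := is_deriv_near dft; have [a0 a1] := andP ha.
(* With tolerance [a] the error of linearisation obeys the same bound as the centre-stable part of
   the linear map, so [P (ft x)] has norm at most [a * ⟦x⟧]. *)
have [d d0 dft'] := small a a0.
have [s cs] := chart_coords hM c0p; have [hs _] := cs; have [ac0 c0p'] := c0p.
(* On [W] the function [g0] represents [f] and the image stays in the chart; [rho] is chosen so that
   [sig] sends the whole ball into [W]. *)
pose W := [set y | [/\ M0 y, cdom c0 y, g0 (c0 y) = c0 (f y) & cdom c0 (f y)]].
have pW : nbhs p W.
  have n1 : nbhs p M0 by exact: open_nbhs_nbhs.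
  have n2 := chart_near (atlas_chart hM ac0) c0p'.
  have n3 : \forall y \near p, cdom c0 (f y).
    by apply: (cf p hp); rewrite fp; exact: n2.
  by near=> y; split; [near: y|near: y|near: y|near: y].
have [e e0 eW] := coords_inv_cts hs c0p' pW.
have [e' e'0 eV] := coords_image_open hs (coordsK hs c0p').1.
have [e3 e30 ke3] : exists2 d, 0 < d & forall x, ⟦x⟧ < d -> ⟦k x⟧ < Num.min e e'.
  by apply: blin_small bk _; rewrite lt_min e0.
pose rho := Num.min (Num.min r r2) (Num.min d e3).
have rho0 : 0 < rho by rewrite !lt_min r0 r20 d0.
have rhoP (x : X) : ⟦x⟧ < rho -> [/\ ⟦x⟧ < r, ⟦x⟧ < r2, ⟦x⟧ < d, ⟦k x⟧ < e & ⟦k x⟧ < e'].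
  rewrite /rho !(lt_min ⟦x⟧) => /andP[/andP[-> ->] /andP[-> /ke3]].
  by rewrite lt_min => /andP[-> ->].
pose psi y := ki (c0 y - c0 p).
pose sig x := s (c0 p + k x).
pose V1 := [set v : E | ⟦ki (v - c0 p)⟧ < rho].
have shift v : analytic_at (fun v => ki (v - c0 p)) v.
  have -> : (fun v => ki (v - c0 p)) = fun v => ki v - ki (c0 p).
    by apply/funext => w; rewrite (linB _ _ lki).
  exact: analytic_affine bki.
have cpsi : coords [set y | cdom c0 y /\ V1 (c0 y)] psi (zero_ball X rho) sig.
  apply: (coords_post (Phi := fun v => ki (v - c0 p)) (Psi := fun x => c0 p + k x)) cs _ _ _ _ _ _ _ => //.
  - move=> v /rhoP[_ _ _ _]; rewrite kK => h.
    by apply: eV.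
  - exact: (preimage_open (g := fun v => ki (v - c0 p)) shift (@zero_ball_open _ _ X rho)).
  - exact: zero_ball_open.
  - by move=> v V1v; split=> //; rewrite kK addrC subrK.
  - by move=> x xr; rewrite /V1/= addrC addKr kiK.
  - by move=> x _; apply: analytic_atD; [exact: analytic_at_cst|exact: analytic_at_blin bk].
have sigW x : ⟦x⟧ < rho -> W (sig x) /\ c0 (sig x) = c0 p + k x.
  move=> /rhoP[_ _ _ ke ke']; split.
    by apply: eW; rewrite /norm_ball/= addrC addKr.
  by have [] := coordsV hs (eV (c0 p + k x) _); rewrite // /norm_ball/= addrC addKr.
exists X, k, ki, P, phi, ft, rho, psi, [set y | cdom c0 y /\ V1 (c0 y)], sig; split; last exact: TcsP.
have lP := spl_P spl.
split=> //.
- by exists D.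
- by exists D'.
- exact: (spl_PP spl).
- exact: (spl_max spl).
- by split=> //; rewrite /V1/= subrr (lin0 lki) norm0.
- move=> y [cy V1y]; have [[M0y _ _ _] _] := sigW _ V1y.
  by move: M0y; rewrite /sig kK addrC subrK (coordsK hs cy).2.
- move=> x xr; have [[_ _ gE _] cE] := sigW x xr.
  by rewrite /psi -gE cE.
- move=> x xr; have [[_ csx gE cfx] cE] := sigW x xr.
  rewrite /sig /ft kK -cE gE addrC subrK.
  by rewrite (coordsK hs cfx).2 (coordsK hs csx).2.
- by move=> x /rhoP[_ xr2 _ _ _]; have := aft2 x xr2; rewrite add0r.
- move=> x /rhoP[_ _ xd _ _]; have := dft' x xd; rewrite add0r ft0 subr0 => h.
  rewrite -(subrK (ki (A0 (k x))) (ft x)) (linD _ _ lP); apply: norm_add_le.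
    by rewrite (le_trans (norm_proj spl _)).
  rewrite -(spl_comm spl) (le_trans (spl_stable spl _))// ler_pM2l//.
  exact: norm_proj spl _.
- by move=> x /rhoP[xr _ _ _ _]; exact: aphi.
- by have [D2 D20 h] := phi2; exists D2 => // x /rhoP[xr _ _ _ _]; exact: h.
- by move=> x /rhoP[/graph[]].
- by move=> x /rhoP[/graph[]].
- move=> z D2 zr; apply: uniq => n; by have [] := rhoP _ (zr n).
Unshelve. all: by end_near.
Qed.

(** * Centre-stable manifolds *)

Section CentreStableManifolds.
Variables (R : realType) (K : ultraField R) (E X : ultraBanach K).
Variables (M : manifold E) (M0 : set M) (f : M -> M) (p : M) (a : R) (Tcs : set (tangent p))
  (c0 : chart M E) (k : X -> E) (ki : E -> X) (P phi ft : X -> X) (rho : R)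
  (psi : M -> X) (D0 : set M) (sig : X -> M).
Hypotheses (hM : analytic_manifold M) (fp : f p = p)
  (c0p : chart_at p c0) (lm : local_model M0 f p a c0 k ki P phi ft rho psi D0 sig)
  (TcsP : forall v : tangent p, Tcs v <-> P (ki (v c0)) = ki (v c0)).

Let lP : linear P := lm_P lm.
Let hpsi : homeo_coords D0 psi (zero_ball X rho) sig := (lm_coords lm).1.
Let rho_le : 0 < rho <= rho. Proof. by rewrite lexx (lm_rho lm). Qed.

Lemma lm_norm_proj x : ⟦P x⟧ <= ⟦x⟧.
Proof. by rewrite [leRHS](lm_max lm) le_max lexx. Qed.

Lemma lm_norm_coproj x : ⟦x - P x⟧ <= ⟦x⟧.
Proof. by rewrite [leRHS](lm_max lm) le_max lexx orbT. Qed.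

Lemma lm_blinP : blin P 1.
Proof. by split=> [|//|x]; [exact: lm_P lm|rewrite mul1r lm_norm_proj]. Qed.

Section NormalForm.
Variables (F : ultraBanach K) (N : manifold F) (i : N -> M) (x0 : N).
Hypotheses (hi : centre_stable_manifold M0 f Tcs i) (ix0 : i x0 = p).

(** The tangent map of the inclusion is injective with image the centre-stable subspace, the fixed
    space of [P] in [X]. The open mapping theorem bounds its inverse, and [P] extends this inverse
    to all of [X]. *)
Lemma tangent_isomorphism (e : chart N F) A : chart_at x0 e -> chart_deriv i x0 e c0 A ->
  exists (D : R) (B : X -> F) (D' : R), [/\ blin (fun v => ki (A v)) D, blin B D',
    forall v, B (ki (A v)) = v & forall x, ki (A (B x)) = P x].
Proof.
move=> ex dA; case: hi => [[hN inji [_ ci _] imm] _ [x ix rx] _].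
have {x ix rx} rx : range (tangent_map i x0 p) = Tcs.
  by have <- : x = x0 by apply: inji; rewrite ix ix0.
have cx0 : {for x0, continuous i} by exact: ci.
have c0i : chart_at (i x0) c0 by rewrite ix0.
have injA : injective A.
  apply/(tangent_injective hM hN erefl cx0 ex c0i dA).
  by case: (imm x0).
have [DA bA] := chart_deriv_blin dA; have [Dk bki] := lm_ki lm.
have bAF := blin_comp bA bki; have [lAF _ _] := bAF.
pose AF v := ki (A v).
have rangeE := tangent_range hM hN ix0 cx0 ex c0p dA.
have PAF v : P (AF v) = AF v.
  have [w wv] := tangent_exists hM (A v) c0p.
  rewrite /AF -wv; apply/TcsP; rewrite -rx rangeE /=.
  by exists v.
have AFsurj x : P x = x -> exists v, AF v = x.
  move=> Px; have [w wv] := tangent_exists hM (k x) c0p.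
  have : Tcs w by apply/TcsP; rewrite wv (lm_kiK lm).
  by rewrite -rx rangeE /= => -[v _ Av]; exists v; rewrite /AF Av wv (lm_kiK lm).
have injAF : injective AF.
  by move=> v w /(congr1 k); rewrite !(lm_kK lm) => /injA.
have hS : subspace_set [set x | P x = x].
  by split=> [|r u v /= Pu Pv]; rewrite /= ?(lin0 lP)// lP Pu Pv.
have [Y [j [q [bj bq jn jq [jS qj]]]]] :=
  subspace_banach hS lm_blinP (lm_PP lm) (fun x h => h).
have [C C0 open_AF] : exists2 C, 0 < C & forall y, exists2 v, q (AF v) = y & ⟦v⟧ <= C * ⟦y⟧.
  apply: (open_mapping (blin_comp bAF bq)) => y.
  by have [v vy] := AFsurj _ (jS y); exists v; rewrite -/(AF v) vy qj.
have /choice[B BP] y : exists v, q (AF v) = y /\ ⟦v⟧ <= C * ⟦y⟧.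
  by have [v vy vC] := open_AF y; exists v.
have [lq q0 qb] := bq.
have AFB x : AF (B (q x)) = P x by rewrite -PAF -jq (BP (q x)).1 jq.
exists (Dk * DA), (fun x => B (q x)), (C * 1); split=> //; last 1 first.
- by move=> v; apply: injAF; rewrite -/(AF v) AFB PAF.
split=> [r u v||x]; last 2 first.
- by rewrite mulr_ge0// ltW.
- by rewrite (le_trans (BP _).2)// -mulrA ler_pM2l.
by apply: injAF; rewrite AFB [RHS]lAF -!/(AF _) !AFB lP.
Qed.

Theorem normal_form : exists (AF : F -> X) (B : X -> F),
  [/\ exists D, blin AF D, exists D, blin B D, forall v, B (AF v) = v,
    forall x, AF (B x) = P x &
    forall W, nbhs x0 W -> exists2 s0, 0 < s0 & forall s, 0 < s <= s0 ->
      exists (D : set N) (d : N -> F) (sd : F -> N),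
      [/\ coords D d [set v | ⟦AF v⟧ < s] sd /\ s <= rho, D x0, D `<=` W,
        forall y, D y -> D0 (i y) /\ psi (i y) = AF (d y) + phi (AF (d y)) &
        forall g, (forall y, i (g y) = f (i y)) -> forall y, D y -> D (g y)]].
Proof.
case: (hi) => [[hN inji ai imm] _ _ [g ag gE]].
have c0i : chart_at (i x0) c0 by rewrite ix0.
have [e ex] := chart_exists hN x0; have [ae ex'] := ex.
have [g1 g1E ag1] := analytic_map_rep hN hM ai I ex c0i.
have [A dA0] := analytic_deriv ag1.
have dA : chart_deriv i x0 e c0 A by exists g1.
have [D [B [D' [bAF bB BAF AFB]]]] := tangent_isomorphism ex dA.
have [Dk bki] := lm_ki lm; have [lki _ _] := bki.
pose AF v := ki (A v); exists AF, B; split=> //; [by exists D|by exists D'|].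
have [lAF AD0 AFD] := bAF; have [lB D'0 BD] := bB.
have AF0 : AF 0 = 0 := lin0 lAF.
have PAF v : P (AF v) = AF v by rewrite -AFB BAF.
pose C := D' + 1; have C0 : 0 < C by rewrite ltr_wpDl.
have AFlow v : ⟦v⟧ <= C * ⟦AF v⟧.
  rewrite -{1}(BAF v) (le_trans (BD _))// ler_wpM2r ?norm_ge0// lerDl//.
pose io v := ki (g1 (e x0 + v) - c0 p).
have g1x0 : g1 (e x0) = c0 p by rewrite (nbhs_singleton g1E) ix0.
have io0 : io 0 = 0 by rewrite /io addr0 g1x0 subrr (lin0 lki).
have [aio dio] : analytic_at io 0 /\ has_deriv io 0 AF.
  exact: (affine_conjugate (c0 p) (blin_id F) bki ag1 dA0).
have [b [Cb [Mb [r1 [Pb b0 b1 r10 bio]]]]] := analytic_series aio dio; rewrite io0 in b0.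
(* [theta] is the centre-stable component of the inclusion, read in [F]. Its derivative at 0 is the
   identity, so its inverse parametrises [N] by that component. *)
pose theta v := B (io v).
have th_sum v : ⟦v⟧ < r1 -> sums_to (fun s => B (b s)) v (theta v).
  by move=> /bio; rewrite add0r => /(sums_to_post bB).
have [||u [ru [/andP[ru0 _] au uP]]] :=
  local_inverse (powser_post Pb bB) _ _ r10 th_sum.
- by rewrite b0 (lin0 lB).
- by move=> v; rewrite b1 BAF.
have ath : analytic_at theta 0 by apply: analytic_at_comp aio (analytic_at_blin _ bB).
have [r2 r20 ath2] := analytic_at_near ath.
have [r3 r30 au3] := analytic_at_near au.
have [_ small] := is_deriv_near dio.
(* This tolerance makes the deviation of the inclusion from its linear part at most the norm of the
   centre-stable component, so that on small pieces [psi (i y)] and [P (psi (i y))] have equal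
   norms. *)
have Ci0 : 0 < C^-1 by rewrite invr_gt0.
have [d1 d10 io_small] := small _ Ci0.
have ci : {for x0, continuous i} by case: ai => _ + _; exact.
have [se [hse rse]] := chart_coords hN ex.
have kse := coordsK hse.
move=> W x0W.
pose Wn := [set y | [/\ cdom e y, g1 (e y) = c0 (i y), D0 (i y) & W y]].
have x0Wn : nbhs x0 Wn.
  have n1 := chart_near (atlas_chart hN ae) ex'.
  have n2 : \forall y \near x0, D0 (i y).
    apply: ci; rewrite ix0; apply: open_nbhs_nbhs; split; [exact: coords_open hpsi|exact: lm_p lm].
  by near=> y; split; near: y.
have [e1 e10 e1W] := coords_inv_cts hse ex' x0Wn.
have [e2 e20 e2V] := coords_image_open hse (kse x0 ex').1.
pose r := Num.min (Num.min (Num.min ru r1) (Num.min r2 r3)) (Num.min d1 (Num.min e1 e2)).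
have r0 : 0 < r by rewrite /r !lt_min ru0 r10 r20 r30 d10 e10.
have rP (v : F) : ⟦v⟧ < r -> [/\ ⟦v⟧ < ru, ⟦v⟧ < r2, ⟦v⟧ < r3 & ⟦v⟧ < d1 /\ (⟦v⟧ < e1 /\ ⟦v⟧ < e2)].
  rewrite /r !lt_min => /andP[/andP[/andP[-> _] /andP[-> ->]] /andP[-> /andP[-> ->]]].
  by [].
pose V1 s := [set w : F | ⟦w - e x0⟧ < r /\ ⟦AF (theta (w - e x0))⟧ < s].
pose D_ s := [set y | cdom e y /\ V1 s (e y)].
pose d y := theta (e y - e x0).
pose sd v := se (e x0 + u v).
pose s1 := Num.min rho (r / C).
have cD s : 0 < s -> s <= s1 -> coords (D_ s) d [set v | ⟦AF v⟧ < s] sd.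
  move=> s0; rewrite le_min => /andP[srho sr].
  have V2r v : ⟦AF v⟧ < s -> ⟦v⟧ < r.
    move=> vs; rewrite (le_lt_trans (AFlow v))// -ltr_pdivlMl// mulrC.
    exact: lt_le_trans vs sr.
  have sub w : analytic_at theta (w - e x0) -> analytic_at (fun w => theta (w - e x0)) w.
    move=> ah; apply: (analytic_at_comp (g := fun v => v - e x0)) ah.
    exact: analytic_affine (blin_id F).
  apply: (coords_post (Phi := fun w => theta (w - e x0)) (Psi := fun v => e x0 + u v)
    (conj hse rse)).
  - move=> w [wr _]; apply: e2V; rewrite /norm_ball/=.
    by have [_ _ _ [_ []]] := rP _ wr.
  - move=> w [wr ws]; have [_ wr2 _ _] := rP _ wr.
    have aw : analytic_at (fun w => AF (theta (w - e x0))) w.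
      apply: analytic_at_comp (analytic_at_blin _ bAF); apply: sub.
      by have := ath2 _ wr2; rewrite add0r.
    have [q1 q10 q1P] := analytic_continuous aw (zero_ball_open ws).
    exists (Num.min r q1) => [|w']; first by rewrite /= lt_min r0.
    rewrite /norm_ball/= lt_min => /andP[w'r /q1P]; split=> //.
    exact: norm_dist_lt w'r wr.
  - exact: (preimage_open (fun x => analytic_at_blin x bAF) (@zero_ball_open _ _ X s)).
  - move=> w [wr ws]; split=> //; have [wru _ _ _] := rP _ wr.
    by have [_ _ -> _] := uP _ wru; rewrite addrC subrK.
  - move=> v vs; have [vru _ _ _] := rP _ (V2r v vs); have [uv tuv _ _] := uP _ vru.
    by rewrite /V1/= addrC addKr tuv uv; split=> //; split=> //; exact: V2r.
  - move=> w [wr _]; have [_ wr2 _ _] := rP _ wr; apply: sub.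
    by have := ath2 _ wr2; rewrite add0r.
  - move=> v vs; have [_ _ vr3 _] := rP _ (V2r v vs).
    apply: analytic_atD; first exact: analytic_at_cst.
    by have := au3 _ vr3; rewrite add0r.
have facts s y : D_ s y -> [/\ D0 (i y), W y, P (psi (i y)) = AF (d y),
    ⟦psi (i y)⟧ = ⟦AF (d y)⟧ & ⟦AF (d y)⟧ < s /\ ⟦e y - e x0⟧ <= C * ⟦AF (d y)⟧].
  move=> [ey [yr ys]]; have [yru _ _ [yd1 [ye1 _]]] := rP _ yr.
  have : Wn (se (e y)) by apply: e1W.
  rewrite (kse y ey).2 => -[_ gy Dy Wy].
  have [_ _ _ nth_] := uP _ yru.
  have psiE : psi (i y) = io (e y - e x0).
    by rewrite (lm_psi lm) /io [e x0 + _]addrC subrK gy.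
  have Ppsi : P (psi (i y)) = AF (d y) by rewrite -AFB psiE.
  have yC : ⟦e y - e x0⟧ <= C * ⟦AF (d y)⟧ by rewrite -nth_; exact: AFlow.
  split=> //; rewrite [LHS](lm_max lm) Ppsi max_l//.
  have -> : psi (i y) - AF (d y) = (psi (i y) - AF (e y - e x0)) - P (psi (i y) - AF (e y - e x0)).
    by rewrite (linB _ _ lP) PAF Ppsi opprB addrA subrK.
  rewrite (le_trans (lm_norm_coproj _))//.
  have := io_small _ yd1; rewrite add0r io0 subr0 -psiE => /le_trans; apply.
  by rewrite ler_pdivrMl.
have s10 : 0 < s1 by rewrite lt_min (lm_rho lm) divr_gt0.
have Dx0 s : 0 < s -> D_ s x0.
  by move=> s0; split=> //; rewrite /V1/= subrr norm0 /theta io0 (lin0 lB) AF0 norm0.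
have gx0 : g x0 = x0 by apply: inji; rewrite gE ix0 fp.
(* Continuity of [g] in the topology of [N] only brings points into the larger piece [D_ s1]. There
   the norm is that of the centre-stable component, which contracts by [a], so the image falls back
   into [D_ s]. *)
have [e3 e30 e3G] : exists2 e3, 0 < e3 & forall w, ⟦w - e x0⟧ < e3 -> D_ s1 (g (se w)).
  have cg : {for x0, continuous g} by case: ag => _ + _; exact.
  have [hD _] := cD s1 s10 (lexx _).
  have nG : nbhs x0 (g @^-1` D_ s1).
    by apply: cg; rewrite gx0; apply: open_nbhs_nbhs; split; [exact: coords_open hD|exact: Dx0].
  by have [e3 e30 e3P] := coords_inv_cts hse ex' nG; exists e3.
exists (Num.min s1 (e3 / C)) => [|s]; first by rewrite lt_min s10 divr_gt0.
rewrite le_min => /andP[s0 /andP[ss1 se3]].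
exists (D_ s), d, sd.
have srho : s <= rho by move: ss1; rewrite le_min => /andP[].
have step y : D_ s y -> [/\ D_ s (g y), psi (i (g y)) = ft (psi (i y)) &
    ⟦psi (i (g y))⟧ <= a * ⟦psi (i y)⟧].
  move=> Dy; have [D0y Wy Py ny [ys yC]] := facts s y Dy.
  have zs : ⟦psi (i y)⟧ < rho by rewrite ny (lt_le_trans ys).
  have psig : psi (i (g y)) = ft (psi (i y)).
    by rewrite gE -(lm_f lm zs) (coordsK hpsi D0y).2.
  have [ey _] := Dy.
  have Dgy : D_ s1 (g y).
    have := e3G (e y); rewrite (kse y ey).2; apply.
    by rewrite (le_lt_trans yC)// -ltr_pdivlMl// mulrC (lt_le_trans ys).
  have [_ _ Pgy ngy _] := facts s1 _ Dgy.
  have [a0 a1] := andP (lm_a lm).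
  have le_a : ⟦AF (d (g y))⟧ <= a * ⟦psi (i y)⟧ by rewrite -Pgy psig; exact: lm_ft_le lm _ zs.
  split=> //; last by rewrite ngy.
  have [egy [gyr _]] := Dgy; split=> //; split=> //.
  rewrite (le_lt_trans le_a)//; apply: le_lt_trans (_ : ⟦psi (i y)⟧ < s); last by rewrite ny.
  by rewrite ler_piMl ?norm_ge0.
split=> //.
- by split=> //; exact: cD.
- exact: Dx0.
- by move=> y /facts[].
- move=> y Dy; have [D0y _ Py ny [ys _]] := facts s y Dy; split=> //.
  (* The orbit of [y] never leaves the piece and is bounded by a multiple of a^n, so [lm_uniq] puts
     [psi (i y)] on the graph. *)
  have Dn n : D_ s (iter n g y) by elim: n => [//|n IH]; have [] := step _ IH.
  have [a0 a1] := andP (lm_a lm).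
  have bound n : ⟦psi (i (iter n g y))⟧ <= ⟦psi (i y)⟧ * a ^+ n.
    elim: n => [|n IH]; first by rewrite mulr1.
    have [_ _ h] := step _ (Dn n); rewrite iterS (le_trans h)// exprS mulrCA.
    by rewrite ler_pM2l.
  have := @lm_uniq _ _ _ _ _ _ _ _ _ _ _ _ _ _ _ _ _ _ _ lm
    (fun n => psi (i (iter n g y))) ⟦psi (i y)⟧.
  rewrite /= -(lm_phiP lm (psi (i y))) Py; apply => // n.
    have [_ _ _ -> [h _]] := facts s _ (Dn n); exact: lt_le_trans h srho.
  by have [] := step _ (Dn n).
- move=> g' g'E y Dy; have -> : g' y = g y by apply: inji; rewrite g'E gE.
  by have [] := step y Dy.
Unshelve. all: by end_near.
Qed.

End NormalForm.

Lemma lm_psip : psi p = 0.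
Proof. by have [D [lki _ _]] := lm_ki lm; rewrite (lm_psi lm) subrr (lin0 lki). Qed.

Lemma lm_phi0 : phi 0 = 0.
Proof.
apply: norm_eq0; apply/eqP; rewrite eq_le norm_ge0 andbT.
by rewrite (le_trans (lm_phi_le lm _)) ?(lin0 lP) ?norm0 ?lexx// (lm_rho lm).
Qed.

Lemma lm_phi_shift x y : P y = 0 -> phi (x + y) = phi x.
Proof. by move=> Py; rewrite -(lm_phiP lm) (linD _ _ lP) Py addr0 (lm_phiP lm). Qed.

Lemma lm_phi_norm x : ⟦x⟧ < rho -> ⟦phi x⟧ <= ⟦x⟧.
Proof. by move=> xr; rewrite (le_trans (lm_phi_le lm xr))// (lm_norm_proj). Qed.

(* In these coordinates the graph of [phi] becomes the fixed space of [P]. *)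
Definition flat (y : M) : E := k (psi y - phi (psi y)).

Definition flat_dom (s : R) : set M := [set y | D0 y /\ zero_ball X s (psi y)].

Definition graph_set (s : R) : set M :=
  [set y | flat_dom s y /\ psi y = P (psi y) + phi (psi y)].

(** The shear x - phi x has inverse x + phi x, since [phi] depends on [P x] alone and takes values
    killed by [P]. *)
Lemma flat_coords s : 0 < s <= rho -> coords (flat_dom s) flat
  [set e | ⟦ki e⟧ < s] (fun e => sig (ki e + phi (ki e))).
Proof.
move=> /andP[s0 sr]; have [Dk bk] := lm_k lm; have [Di bki] := lm_ki lm.
have oppX : blin (fun x : X => - x) 1.
  by split=> [r x y||x]; rewrite ?ler01// ?mul1r ?normN// opprD scalerN.
apply: (coords_post (Phi := fun x => k (x - phi x)) (Psi := fun e => ki e + phi (ki e))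
  (lm_coords lm)).
- by move=> x xs; exact: lt_le_trans xs sr.
- exact: zero_ball_open.
- exact: (preimage_open (fun x => analytic_at_blin x bki) (@zero_ball_open _ _ X s)).
- move=> x xs; rewrite /= (lm_kiK lm); split.
    by rewrite norm_sub_lt// (le_lt_trans (lm_phi_norm _))// (lt_le_trans xs).
  by rewrite lm_phi_shift ?subrK// -scaleN1r (linZ _ _ lP) (lm_Pphi lm) scaler0.
- move=> e es; split.
    by apply: norm_add_lt => //; rewrite (le_lt_trans (lm_phi_norm _))// (lt_le_trans es).
  by rewrite lm_phi_shift ?(lm_Pphi lm)// addrK (lm_kK lm).
- move=> x xs; have xr := lt_le_trans xs sr.
  apply: analytic_at_comp (analytic_at_blin _ bk).
  apply: analytic_atD; first exact: analytic_at_blin (blin_id X).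
  exact: analytic_at_comp (lm_phi lm xr) (analytic_at_blin _ oppX).
- move=> e es; apply: analytic_atD; first exact: analytic_at_blin bki.
  apply: analytic_at_comp (analytic_at_blin _ bki) _.
  by apply: (lm_phi lm); exact: lt_le_trans es sr.
Qed.

Lemma flat_atlas s : 0 < s <= rho -> atlas (Chart (flat_dom s) flat).
Proof. by move=> /flat_coords; exact: coords_atlas. Qed.

Lemma flat_dom_p s : 0 < s -> flat_dom s p.
Proof. by move=> s0; split; [exact: lm_p lm|rewrite /zero_ball/= lm_psip norm0]. Qed.

Lemma graph_flat s y : graph_set s y -> flat y = k (P (psi y)).
Proof. by move=> [_ yE]; rewrite /flat {1}yE addrK. Qed.

Lemma graph_set_p s : 0 < s -> graph_set s p.
Proof.
by move=> s0; split; [exact: flat_dom_p|rewrite lm_psip (lin0 lP) add0r lm_phi0].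
Qed.

(** [phi] is quadratically small, so the shear has derivative the identity at 0. Tangent vectors at
    [p] thus have the same coordinate in the flat chart as in [c0], and [Tcs] can be read there. *)
Lemma flat_deriv s : chart_deriv id p c0 (Chart (flat_dom s) flat) id.
Proof.
exists (fun v => k (ki (v - c0 p) - phi (ki (v - c0 p)))).
  by apply: filterE => y; rewrite /= /flat (lm_psi lm).
have [Dk bk] := lm_k lm; have [Di bki] := lm_ki lm.
have [lk Dk0 kD] := bk; have [lki Di0 kiD] := bki.
apply: is_deriv_intro (blin_id E) _ => e e0.
have [D D0' phi2] := lm_phi2 lm.
have C0 : 0 <= Dk * (D * Di ^+ 2) by rewrite !mulr_ge0 ?exprn_ge0.
pose C := Dk * (D * Di ^+ 2) + 1; have C1 : 0 < C by rewrite ltr_wpDl.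
have Di1 : 0 < Di + 1 by rewrite ltr_wpDl.
exists (Num.min (rho / (Di + 1)) (e / C)) => [|h].
  by rewrite lt_min !divr_gt0// (lm_rho lm).
rewrite lt_min !ltr_pdivlMr// => /andP[hr hC].
have h0 := norm_ge0 h.
have hrho : ⟦ki h⟧ < rho.
  by apply: le_lt_trans hr; rewrite (le_trans (kiD h))// mulrC ler_wpM2l// lerDl.
rewrite [c0 p + h]addrC addrK subrr (lin0 lki) lm_phi0 subrr (lin0 lk) subr0.
rewrite (linB _ _ lk) (lm_kK lm) addrAC subrr add0r normN (le_trans (kD _))//.
rewrite (le_trans (ler_wpM2l Dk0 (phi2 _ hrho)))//.
have h2 : ⟦ki h⟧ ^+ 2 <= (Di * ⟦h⟧) ^+ 2.
  by rewrite lerXn2r ?nnegrE ?norm_ge0// mulr_ge0.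
rewrite (le_trans (ler_wpM2l Dk0 (ler_wpM2l D0' h2)))// exprMn.
have -> : Dk * (D * (Di ^+ 2 * ⟦h⟧ ^+ 2)) = Dk * (D * Di ^+ 2) * ⟦h⟧ * ⟦h⟧ by ring.
rewrite ler_wpM2r//; apply: ltW; apply: le_lt_trans hC.
by rewrite mulrC ler_wpM2l// lerDl.
Qed.

Lemma flat_tangent s (v : tangent p) : 0 < s <= rho -> v (Chart (flat_dom s) flat) = v c0.
Proof.
move=> /[dup] hs /andP[s0 _].
have cp : chart_at p (Chart (flat_dom s) flat) by split; [exact: flat_atlas|exact: flat_dom_p].
by rewrite (tangent_change v c0p cp (flat_deriv s)).
Qed.

Lemma flat_projection : exists D, [/\ blin (fun e => k (P (ki e))) D,
  forall e, k (P (ki (k (P (ki e))))) = k (P (ki e)) &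
  forall e, range (fun e => k (P (ki e))) e <-> P (ki e) = ki e].
Proof.
have [Dk bk] := lm_k lm; have [Di bki] := lm_ki lm.
exists (Dk * (1 * Di)); split; first exact: blin_comp (blin_comp bki lm_blinP) bk.
  by move=> e; rewrite (lm_kiK lm) (lm_PP lm).
move=> e; split=> [[e' _ <-]|Pe]; first by rewrite (lm_kiK lm) (lm_PP lm).
by exists e; rewrite // Pe (lm_kK lm).
Qed.

Section Immersion.
Variables (F : ultraBanach K) (N : manifold F) (i : N -> M) (s : R) (J : F -> X) (B : X -> F).
Hypotheses (hN : analytic_manifold N) (inji : injective i)
  (ci : forall y, {for y, continuous i}) (hs : 0 < s <= rho)
  (bJ : exists D, blin J D) (BJ : forall v, B (J v) = v) (JB : forall x, J (B x) = P x)
  (flat_i : forall y, exists c, [/\ chart_at y c, flat_dom s (i y) &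
    \forall z \near y, flat (i z) = k (J (c z))]).

Lemma flat_fixed v : P (J v) = J v.
Proof. by rewrite -JB BJ. Qed.

Lemma flat_range e : range (fun v => k (J v)) e <-> P (ki e) = ki e.
Proof.
split=> [[v _ <-]|Pe]; first by rewrite (lm_kiK lm) flat_fixed.
by exists (B (ki e)); rewrite // JB Pe (lm_kK lm).
Qed.

(** In the flat chart [i] is the linear map [k] after [J], so its derivative is known at every
    point. This applies to the manifold constructed for existence and to the small pieces of any
    other one. *)
Lemma flat_immersion : immersed_submanifold i.
Proof.
have [DJ bJ'] := bJ; have [Dk bk] := lm_k lm; have bkJ := blin_comp bJ' bk.
split=> //.
  apply: (analytic_mapP hN hM) => [|y _|y _]; [exact: openT|exact: ci|].
  have [c [cy iy near_i]] := flat_i y.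
  exists c, (Chart (flat_dom s) flat); split=> //; first by split=> //; exact: flat_atlas.
  by exists (fun v => k (J v)); [apply: filterS near_i => z /= ->|exact: analytic_at_blin bkJ].
move=> y; have [c [cy iy near_i]] := flat_i y.
have c'y : chart_at (i y) (Chart (flat_dom s) flat) by split=> //; exact: flat_atlas.
have dA : chart_deriv i y c (Chart (flat_dom s) flat) (fun v => k (J v)).
  by apply: (chart_deriv_linear bkJ); exact: near_i.
split.
  have [_] := tangent_injective hM hN erefl (@ci y) cy c'y dA; apply.
  move=> u v /(congr1 (fun e => B (ki e))).
  by rewrite !(lm_kiK lm) !BJ.
have [D [bpi pipi rpi]] := flat_projection.
apply: (tangent_complemented hM hN erefl (@ci y) cy c'y dA bpi pipi).
by apply/seteqP; split=> e he; [apply/flat_range/rpi|apply/rpi/flat_range].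
Qed.

Lemma flat_tangent_range x : i x = p -> range (tangent_map i x p) = Tcs.
Proof.
move=> ix; have [DJ bJ'] := bJ; have [Dk bk] := lm_k lm; have bkJ := blin_comp bJ' bk.
have [c [cx ix' near_i]] := flat_i x; rewrite ix in ix'.
have c'p : chart_at p (Chart (flat_dom s) flat) by split=> //; exact: flat_atlas.
have dA : chart_deriv i x c (Chart (flat_dom s) flat) (fun v => k (J v)).
  by apply: (chart_deriv_linear bkJ); exact: near_i.
rewrite (tangent_range hM hN ix (@ci x) cx c'p dA); apply/seteqP; split=> w /=.
  by move/flat_range; rewrite flat_tangent// => /TcsP.
by move/TcsP => h; apply/flat_range; rewrite flat_tangent.
Qed.

End Immersion.

Lemma graph_invariant y : graph_set rho y -> graph_set rho (f y) /\ psi (f y) = ft (psi y).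
Proof.
move=> [[D0y yr] yE]; have sy : sig (psi y) = y := (coordsK hpsi D0y).2.
have ftE : psi (f y) = ft (psi y) by rewrite -{1}sy (lm_f lm).
have := lm_graph lm yr; rewrite /= -yE => -[Pa zE].
have [a0 a1] := andP (lm_a lm).
have Pr : ⟦P (ft (psi y))⟧ < rho.
  rewrite (le_lt_trans Pa)//; apply: le_lt_trans yr.
  by rewrite (le_trans _ (lm_norm_proj _))// ler_piMl ?norm_ge0.
have zr : ⟦ft (psi y)⟧ < rho.
  rewrite zE norm_add_lt// -(lm_phiP lm).
  by rewrite (le_lt_trans (lm_phi_norm _))// (lm_PP lm).
have [D0z pz] := coordsV hpsi zr.
have fy : f y = sig (ft (psi y)) by rewrite -{1}sy (lm_fsig lm).
split=> //; split; last by rewrite ftE.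
by split; rewrite ?fy// /zero_ball/= pz.
Qed.

(** [N] is the graph over the ball of radius [rho], with the topology induced by [M] and the
    centre-stable component as single global chart. *)
Lemma centre_stable_exists : exists (F : ultraBanach K) (N : manifold F) (i : N -> M),
  centre_stable_manifold M0 f Tcs i.
Proof.
have hS : subspace_set [set x | P x = x].
  by split=> [|r u v /= Pu Pv]; rewrite /= ?(lin0 lP)// lP Pu Pv.
have [F [j [q [bj bq jn jq [jS qj]]]]] :=
  subspace_banach hS lm_blinP (lm_PP lm) (fun x h => h).
have Pj v : P (j v) = j v := jS v.
pose inc : set_type (graph_set rho) -> M := set_val.
pose c y := q (psi (inc y)).
have jr v : zero_ball F rho v -> ⟦j v + phi (j v)⟧ < rho.
  move=> vr; have jvr : ⟦j v⟧ < rho by rewrite jn.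
  by apply: norm_add_lt => //; rewrite (le_lt_trans (lm_phi_norm jvr)).
have incE y : psi (inc y) = j (c y) + phi (j (c y)).
  by have [_ {1}->] := set_valP y; rewrite /c jq (lm_phiP lm).
have grP v : zero_ball F rho v -> graph_set rho (sig (j v + phi (j v))) /\
    psi (sig (j v + phi (j v))) = j v + phi (j v).
  move=> /jr h; have [D0s ps] := coordsV hpsi h; split=> //.
  split; first by split=> //; rewrite /zero_ball/= ps.
  by rewrite ps (lm_phi_shift) ?(lm_Pphi lm)// (linD _ _ lP) (lm_Pphi lm) addr0 Pj.
have grp : graph_set rho p by exact: (graph_set_p (lm_rho lm)).
pose p0 : set_type (graph_set rho) := exist _ p (mem_set grp).
(* The inverse chart has to be total, hence the default value [p0] outside the ball. *)
pose s v : set_type (graph_set rho) := if pselect (zero_ball F rho v) is left vr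
  then exist (fun x => x \in graph_set rho) _ (mem_set (grP v vr).1) else p0.
have sE v : zero_ball F rho v -> inc (s v) = sig (j v + phi (j v)).
  by move=> vr; rewrite /s; case: pselect.
have cr y : zero_ball F rho (c y).
  have [[_ yr] _] := set_valP y.
  by rewrite /zero_ball/= -jn /c jq (le_lt_trans (lm_norm_proj _)).
have sc y : s (c y) = y.
  apply: val_inj; rewrite -[LHS]/(inc _) sE// -incE.
  by have [[D0y _] _] := set_valP y; exact: (coordsK hpsi D0y).2.
have cs v : zero_ball F rho v -> c (s v) = v.
  move=> vr; rewrite /c sE// (grP v vr).2.
  have [lq _ _] := bq; have -> : q (j v + phi (j v)) = q (j (q (j v + phi (j v)))) by rewrite qj.
  by rewrite jq (linD _ _ lP) (lm_Pphi lm) addr0 Pj qj.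
have aj (v : F) : zero_ball F rho v -> analytic_at (fun v => j v + phi (j v)) v.
  move=> vr; apply: analytic_atD; first exact: analytic_at_blin bj.
  apply: analytic_at_comp (analytic_at_blin _ bj) _; apply: (lm_phi lm).
  by rewrite jn.
have hc : homeo_coords setT c (zero_ball F rho) s.
  split.
  - exact: openT.
  - exact: zero_ball_open.
  - by move=> y _; split; [exact: cr|exact: sc].
  - by move=> v vr; split=> //; exact: cs.
  - move=> y _ W cW; have [[D0y _] _] := set_valP y.
    have h1 : nbh X (psi (inc y)) (q @^-1` W).
      exact: (analytic_continuous (analytic_at_blin _ bq)) cW.
    exact: sub_val_continuous (coords_cts hpsi D0y h1).
  - move=> y _ W /sub_nbhsP[W' yW' WW]; have [[D0y _] _] := set_valP y.
    have : nbh X (psi (inc y)) (sig @^-1` W') := coords_inv_cts hpsi D0y yW'.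
    rewrite incE => /(analytic_continuous (aj _ (cr y))) h.
    have [r r0 rP] := h; have [r' r'0 r'P] := zero_ball_open (cr y).
    exists (Num.min r r') => [|v]; first by rewrite /= lt_min; apply/andP.
    rewrite /norm_ball/= lt_min => /andP[vr vr']; apply: WW.
    by rewrite /preimage/= -/(inc _) sE; [exact: rP|exact: r'P].
pose N := single_chart_manifold c.
have hN : analytic_manifold N.
  by apply: (single_chart_analytic _ hc); apply: sub_hausdorff; case: hM.
have cN : coords (M := N) setT c (zero_ball F rho) s.
  by apply: (single_chart_coords _ hc); apply: sub_hausdorff; case: hM.
have ci (y : N) : {for y, continuous (inc : N -> M)} := @sub_val_continuous _ _ y.
have flat_i (y : N) : exists d, [/\ chart_at y d, flat_dom rho (inc y) &
    \forall z \near y, flat (inc z) = k (j (d z))].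
  exists (Chart setT c); split=> //.
  - by split=> //; exact: single_chart_atlas hc.
  - by have [] := set_valP y.
  - by apply: filterE => z; rewrite (graph_flat (set_valP z)) /= /c jq.
have bj' : exists D, blin j D by exists 1.
exists F, N, inc; split.
- exact: (flat_immersion hN val_inj ci rho_le bj' qj jq flat_i).
- by move=> _ [y _ <-]; have [[D0y _] _] := set_valP y; exact: lm_M0 lm _ D0y.
- exists p0 => //; exact: (flat_tangent_range hN ci rho_le bj' qj jq flat_i).
pose g (y : set_type (graph_set rho)) : set_type (graph_set rho) :=
  exist (fun x => x \in graph_set rho) (f (inc y)) (mem_set (graph_invariant (set_valP y)).1).
pose L v := q (ft (j v + phi (j v))).
have gE y : c (g y) = L (c y).
  have [_ fE] := graph_invariant (set_valP y).
  by rewrite /c /L fE -incE.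
have g_rep (y : N) : {for y, continuous (g : N -> N)} /\ rep_at (g : N -> N) y c c.
  apply: (coords_map (L := L) cN cN) => //.
  - by apply: filterE => z; rewrite -gE sc.
  - by apply: filterE => z; rewrite -gE; exact: cr.
  apply: analytic_at_comp (analytic_at_blin _ bq).
  by apply: analytic_at_comp (aj _ (cr y)) _; apply: (lm_ft lm); exact: jr.
exists g => //; apply: (analytic_mapP hN hN) => [|y _|y _]; first exact: openT.
  by have [] := g_rep y.
exists (Chart setT c), (Chart setT c); split; [by split=> //; exact: single_chart_atlas hc..|].
by have [] := g_rep y.
Qed.

(** The geometric content of [normal_form], without its dynamical clause. *)
Definition graph_chart (F : ultraBanach K) (N : manifold F) (i : N -> M) (s : R)
    (AF : F -> X) (D : set N) (d : N -> F) (sd : F -> N) :=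
  coords D d [set v | ⟦AF v⟧ < s] sd /\
  forall y, D y -> D0 (i y) /\ psi (i y) = AF (d y) + phi (AF (d y)).

Section GraphChart.
Variables (F : ultraBanach K) (N : manifold F) (i : N -> M) (s : R)
  (AF : F -> X) (B : X -> F) (D : set N) (d : N -> F) (sd : F -> N).
Hypotheses (inji : injective i) (hs : 0 < s <= rho) (BA : forall v, B (AF v) = v)
  (AB : forall x, AF (B x) = P x) (gc : graph_chart i s AF D d sd).

Lemma graph_chart_mem y : D y -> graph_set s (i y) /\ P (psi (i y)) = AF (d y).
Proof.
move=> Dy; have [[hd _] di] := gc; have [D0y yE] := di y Dy.
have [ys _] := coordsK hd Dy; have /andP[_ sr] := hs.
have PAF v : P (AF v) = AF v by rewrite -AB BA.
have Py : P (psi (i y)) = AF (d y) by rewrite yE (linD _ _ lP) (lm_Pphi lm) addr0 PAF.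
split=> //; split; last by rewrite Py {1}yE -[phi (psi _)](lm_phiP lm) Py.
split=> //; rewrite /zero_ball/= yE norm_add_lt//.
by rewrite (le_lt_trans (lm_phi_norm _))// (lt_le_trans ys).
Qed.

Lemma graph_chart_surj z : graph_set s z -> exists y, [/\ D y, i y = z & d y = B (psi z)].
Proof.
move=> [[D0z zs] zE]; have [[hd _] di] := gc.
have Vz : [set v | ⟦AF v⟧ < s] (B (psi z)).
  by rewrite /= AB (le_lt_trans (lm_norm_proj _)).
have [Dy dy] := coordsV hd Vz; exists (sd (B (psi z))); split=> //.
have [D0y yE] := di _ Dy.
rewrite -(coordsK hpsi D0y).2 -[RHS](coordsK hpsi D0z).2; congr sig.
by rewrite yE dy AB (lm_phiP lm).
Qed.

(** Each point of the graph is already attained on [D]; as [i] is injective, no other sheet of [N]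
    meets the graph. *)
Lemma graph_chart_dom : i @^-1` graph_set s = D.
Proof.
apply/seteqP; split=> y => [/graph_chart_surj[y' [Dy' /inji <-]]//|Dy].
exact: (graph_chart_mem Dy).1.
Qed.

Lemma graph_chart_range : graph_set s `<=` range i.
Proof. by move=> z /graph_chart_surj[y [_ yz _]]; exists y. Qed.

End GraphChart.

(** Both charts record the centre-stable component of the same point of [M], so the identity is, in
    these charts, the linear map [B2] after [A1]. *)
Lemma graph_chart_transition (F1 F2 : ultraBanach K) (N1 : manifold F1) (N2 : manifold F2)
    (i1 : N1 -> M) (i2 : N2 -> M) (s : R) A1 B1 D1 d1 s1 A2 B2 D2 d2 s2 (y2 : N2) :
  analytic_manifold N1 -> analytic_manifold N2 -> injective i1 -> injective i2 ->
  0 < s <= rho -> (forall v, B1 (A1 v) = v) -> (forall x, A1 (B1 x) = P x) ->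
  (forall v, B2 (A2 v) = v) -> (forall x, A2 (B2 x) = P x) ->
  (exists C, blin A1 C) -> (exists C, blin B2 C) ->
  graph_chart i1 s A1 D1 d1 s1 -> graph_chart i2 s A2 D2 d2 s2 ->
  exists2 h : N1 -> N2, analytic_map (i1 @^-1` graph_set s) h &
    forall x, graph_set s (i1 x) -> i2 (h x) = i1 x.
Proof.
move=> hN1 hN2 inj1 inj2 hs BA1 AB1 BA2 AB2 [C bA1] [C' bB2] gc1 gc2.
have [[hd1 rd1] di1] := gc1; have [[hd2 rd2] di2] := gc2.
pose L v := B2 (A1 v).
have PA v : P (A1 v) = A1 v by rewrite -AB1 BA1.
have VL y : D1 y -> ⟦A2 (L (d1 y))⟧ < s.
  by move=> Dy; rewrite /L AB2 PA; exact: (coordsK hd1 Dy).1.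
exists (fun y => s2 (L (d1 y))).
  rewrite (graph_chart_dom inj1 hs BA1 AB1 gc1).
  have oD1 := coords_open hd1.
  have nD1 y : D1 y -> \forall z \near y, D1 z by move=> Dy; apply: open_nbhs_nbhs.
  have cm y : D1 y -> {for y, continuous (fun y => s2 (L (d1 y)))} /\
      rep_at (fun y => s2 (L (d1 y))) y d1 d2.
    move=> Dy; apply: (coords_map (L := L) gc1.1 gc2.1) => //.
    - exact: (coordsV hd2 (VL y Dy)).1.
    - exact: filterE.
    - by apply: filterS (nD1 y Dy) => z /VL.
    - exact: analytic_at_blin (blin_comp bA1 bB2).
  apply: (analytic_mapP hN1 hN2) => // y Dy; first by case: (cm y Dy).
  exists (Chart D1 d1), (Chart D2 d2); split; last by case: (cm y Dy).
    by split=> //; exact: coords_atlas gc1.1.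
  split; first exact: coords_atlas gc2.1.
  exact: (coordsV hd2 (VL y Dy)).1.
move=> x Gx; have Dx : D1 x by rewrite -(graph_chart_dom inj1 hs BA1 AB1 gc1).
have [D0x xE] := di1 x Dx; have [Dh dh] := coordsV hd2 (VL x Dx).
have [D0h hE] := di2 _ Dh.
rewrite -(coordsK hpsi D0h).2 -[RHS](coordsK hpsi D0x).2; congr sig.
by rewrite hE xE dh /L AB2 PA.
Qed.

(** [normal_form] holds for all small radii, so one radius serves both manifolds, and both contain
    the same graph as an open set. *)
Lemma centre_stable_germ (F1 F2 : ultraBanach K) (N1 : manifold F1) (N2 : manifold F2)
    (i1 : N1 -> M) (i2 : N2 -> M) :
  centre_stable_manifold M0 f Tcs i1 -> centre_stable_manifold M0 f Tcs i2 ->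
  same_germ p i1 i2.
Proof.
move=> h1 h2; case: (h1) => [[hN1 inj1 _ _] _ [x1 ix1 _] _].
case: (h2) => [[hN2 inj2 _ _] _ [x2 ix2 _] _].
have [A1 [B1 [bA1 bB1 BA1 AB1 nf1]]] := normal_form h1 ix1.
have [A2 [B2 [bA2 bB2 BA2 AB2 nf2]]] := normal_form h2 ix2.
have [t1 t10 nfs1] := nf1 setT filterT; have [t2 t20 nfs2] := nf2 setT filterT.
pose s := Num.min t1 t2; have s0 : 0 < s by rewrite lt_min t10.
have [|D1 [d1 [s1 [[cd1 sr] _ _ di1 _]]]] := nfs1 s; first by rewrite s0 ge_min lexx.
have [|D2 [d2 [s2 [[cd2 _] _ _ di2 _]]]] := nfs2 s; first by rewrite s0 ge_min lexx orbT.
have hs : 0 < s <= rho by rewrite s0.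
have gc1 : graph_chart i1 s A1 D1 d1 s1 by [].
have gc2 : graph_chart i2 s A2 D2 d2 s2 by [].
exists (graph_set s); split.
- exact: (graph_set_p s0).
- split; first exact: (graph_chart_range AB1 gc1).
  by rewrite (graph_chart_dom inj1 hs BA1 AB1 gc1); exact: (coords_open cd1.1).
- split; first exact: (graph_chart_range AB2 gc2).
  by rewrite (graph_chart_dom inj2 hs BA2 AB2 gc2); exact: (coords_open cd2.1).
- exact: (graph_chart_transition x2 hN1 hN2 inj1 inj2 hs BA1 AB1 BA2 AB2 bA1 bB2 gc1 gc2).
- exact: (graph_chart_transition x1 hN2 hN1 inj2 inj1 hs BA2 AB2 BA1 AB1 bA2 bB1 gc2 gc1).
Qed.

(** In the flat chart the equation of the graph becomes P x = x, so this one chart is adapted at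
    every point. *)
Lemma graph_submanifold (s : R) (S : set M) : 0 < s <= rho -> S = graph_set s ->
  forall x, S x -> adapted_chart S [set e | P (ki e) = ki e]
      (Chart (flat_dom s) (flat)) /\
    cdom (Chart (flat_dom s) (flat)) x.
Proof.
move=> hs -> x [xs xE]; split=> //; split; first exact: (flat_atlas hs).
apply/seteqP; split=> [_ [y [gy dy] <-]|e /= [Pe [y dy ye]]].
  split; last by exists y.
  by rewrite /= (graph_flat gy) (lm_kiK lm) (lm_PP lm).
exists y => //; split=> //; split=> //.
have h : P (psi y) = psi y - phi (psi y).
  move: Pe; rewrite -ye /flat (lm_kiK lm) => <-.
  by rewrite (linB _ _ lP) (lm_Pphi lm) subr0.
by rewrite h subrK.
Qed.

(** [Omega] is a piece given by [normal_form]: its image is exactly a graph, hence flat in a chart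
    of [M], and the dynamical clause of [normal_form] gives its invariance. *)
Lemma centre_stable_shrink (F : ultraBanach K) (N : manifold F) (i : N -> M) x (W : set N) :
  centre_stable_manifold M0 f Tcs i -> i x = p -> nbhs x W ->
  exists Omega : set N,
    [/\ open Omega, Omega x, Omega `<=` W &
        let iO : open_submanifold Omega -> M := fun y => i (set_val y) in
        [/\ centre_stable_manifold M0 f Tcs iO,
            submanifold (range iO) & submanifold_structure iO]].
Proof.
move=> hi ix xW; case: (hi) => [[hN inji ai _] iM0 _ [g ag gE]].
have [A [B [bA bB BA AB nf]]] := normal_form hi ix.
have [s s0 /(_ s)] := nf W xW.
rewrite s0 lexx => /(_ isT)[D [d [sd [[cD sr] Dx DW di gD]]]].
have hs : 0 < s <= rho by rewrite s0.
have gc : graph_chart i s A D d sd by [].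
have oD := coords_open cD.1.
exists D; split=> // iO.
pose inc : set_type D -> N := set_val.
have hNO : analytic_manifold (open_submanifold D) by exact: open_submanifold_analytic.
have ad : atlas (Chart D d) by exact: (coords_atlas hN cD).
have ci (y : open_submanifold D) : {for y, continuous iO}.
  apply: (@continuous_comp _ _ _ inc i); first exact: sub_val_continuous.
  by case: ai => _ + _; exact.
have injO : injective iO by move=> y z /inji /val_inj.
have mem (y : set_type D) := graph_chart_mem hs BA AB gc (set_valP y).
have flatE (y : set_type D) : flat (iO y) = k (A (d (inc y))).
  have [gy Py] := mem y.
  by rewrite (graph_flat gy) Py.
have flat_i (y : open_submanifold D) : exists c, [/\ chart_at y c, flat_dom s (iO y) &
    \forall z \near y, flat (iO z) = k (A (c z))].
  exists (sub_chart D (Chart D d)); split.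
  - by split; [exact: sub_chart_atlas|exact: (set_valP y)].
  - by have [[]] := mem y.
  - by apply: filterE => z; exact: flatE.
pose x' : set_type D := exist (fun y => y \in D) x (mem_set Dx).
have rO : range iO = graph_set s.
  apply/seteqP; split=> [_ [y _ <-]|z /(graph_chart_surj AB gc)[y [Dy yz _]]].
    by case: (mem y).
  by exists (exist (fun y => y \in D) y (mem_set Dy)).
have [Dk bk] := lm_k lm; have [Di bki] := lm_ki lm.
have [DA bA'] := bA; have bkA := blin_comp bA' bk.
have [Dpi [bpi pipi rpi]] := flat_projection.
have V0E : [set e | P (ki e) = ki e] = range (fun e => k (P (ki e))).
  by apply/seteqP; split=> e h; [apply/rpi|apply/rpi].
have jE : range (fun v => k (A v)) = [set e | P (ki e) = ki e].
  by apply/seteqP; split=> e h; [apply/(flat_range BA AB)|apply/(flat_range BA AB)].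
have compl : complemented (nbh E) [set e | P (ki e) = ki e].
  exists (fun e => k (P (ki e))); split.
  - by case: bpi.
  - exact: (blin_continuous bpi).
  - exact: pipi.
  - by rewrite V0E.
have adapted := graph_submanifold hs rO.
split.
- split.
  + exact: (flat_immersion hNO injO ci hs bA BA AB flat_i).
  + by move=> _ [y _ <-]; apply: iM0; exists (inc y).
  + exists x' => //; exact: (flat_tangent_range hNO ci hs bA BA AB flat_i).
  pose gO (y : set_type D) : set_type D :=
    exist (fun y => y \in D) (g (inc y)) (mem_set (gD g gE _ (set_valP y))).
  exists gO; last by move=> y; exact: gE.
  have cg y : {for y, continuous g} by case: ag => _ + _; exact.
  apply: (analytic_mapP hNO hNO) => [|y _|y _]; first exact: openT.
    move=> V' /sub_nbhsP[V'' yV'' VV].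
    have : nbhs y (inc @^-1` (g @^-1` V'')).
      by apply: sub_val_continuous; exact: cg.
    by apply: filterS => z h; exact: (VV (gO z) h).
  have cy : chart_at (inc y) (Chart D d) by split=> //; exact: (set_valP y).
  have cgy : chart_at (g (inc y)) (Chart D d).
    by split=> //; exact: (gD g gE _ (set_valP y)).
  have [h hE ah] := analytic_map_rep hN hN ag I cy cgy.
  exists (sub_chart D (Chart D d)), (sub_chart D (Chart D d)); split.
  + by split; [exact: sub_chart_atlas|exact: (set_valP y)].
  + by split; [exact: sub_chart_atlas|exact: (set_valP (gO y))].
  exists h => //.
  have hE' : nbhs y (inc @^-1` [set z | h (d z) = d (g z)]) := sub_val_continuous hE.
  by apply: filterS hE'.
- exists [set e | P (ki e) = ki e]; split=> // z /adapted[ac cz].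
  by exists (Chart (flat_dom s) (flat)).
exists (fun v => k (A v)); split.
- by case: bkA.
- by move=> v w /(congr1 (fun e => B (ki e))); rewrite !(lm_kiK lm) !BA.
- have [DB bB'] := bB; have bBki := blin_comp bki bB'.
  move=> U; split=> [oU|[V oV ->]].
    exists ((fun e => B (ki e)) @^-1` U).
      exact: (preimage_open (fun e => analytic_at_blin e bBki) oU).
    by apply/seteqP; split=> v; rewrite /preimage/= (lm_kiK lm) BA.
  exact: (preimage_open (fun e => analytic_at_blin e bkA) oV).
- by rewrite jE.
move=> y; exists (Chart (flat_dom s) (flat)).
have [ac cy] := adapted (iO y) (ex_intro2 _ _ y I erefl).
split=> //; first by rewrite jE.
exists (sub_chart D (Chart D d)); first exact: sub_chart_atlas.
split; last by move=> z _; exact: flatE.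
apply/seteqP; split=> z _; first by have [[]] := mem z.
exact: (set_valP z).
Qed.

End CentreStableManifolds.

Theorem theorem1p9 (R : realType) (K : ultraField R) (E : ultraBanach K)
    (M : manifold E) (hM : analytic_manifold M)
    (M0 : set M) (hM0 : open M0)
    (f : M -> M) (hf : analytic_map M0 f)
    (p : M) (hp : M0 p) (hfp : f p = p)
    (a : R) (ha : 0 < a <= 1)
    (Tcs : set (tangent p))
    (hcs : centre_stable_subspace (tangent_nbhs p) (tangent_map f p p) a Tcs) :
  [/\ exists (F : ultraBanach K) (N : manifold F) (i : N -> M),
        centre_stable_manifold M0 f Tcs i,
      forall (F1 : ultraBanach K) (N1 : manifold F1) (i1 : N1 -> M)
             (F2 : ultraBanach K) (N2 : manifold F2) (i2 : N2 -> M),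
        centre_stable_manifold M0 f Tcs i1 ->
        centre_stable_manifold M0 f Tcs i2 ->
        same_germ p i1 i2 &
      forall (F : ultraBanach K) (N : manifold F) (i : N -> M),
        centre_stable_manifold M0 f Tcs i ->
        forall (x : N) (W : set N), i x = p -> nbhs x W ->
        exists Omega : set N,
          [/\ open Omega, Omega x, Omega `<=` W &
              let iO : open_submanifold Omega -> M := fun y => i (set_val y) in
              [/\ centre_stable_manifold M0 f Tcs iO,
                  submanifold (range iO) & submanifold_structure iO]]].
Proof.
have [c0 c0p] := chart_exists hM p.
have [X [k [ki [P [phi [ft [rho [psi [D0 [sig [lm TcsP]]]]]]]]]]] :=
  local_model_exists hM hf hp hfp ha hcs c0p.
split.
- exact: (centre_stable_exists hM c0p lm TcsP).
- by move=> *; exact: (centre_stable_germ hM hfp c0p lm TcsP).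
- by move=> *; exact: (centre_stable_shrink hM hfp c0p lm TcsP).
Qed.
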